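(* Let $A,B$ be positive integers, with $\frac{A}{B}$ regarded as a rational approximation of $\frac{3^2\pi}{4^3}$. For positive integers $k$ such that $r=\frac{A}{B}k^2$ is an integer, let $\omega_N$ be the random set of $N=kr$ points of $\mathbb{S}^3$ obtained by drawing $r$ points from the Spherical ensemble on $\mathbb{S}^2$ and taking, in the Hopf fibre over each of them, $k$ equally spaced points, randomly rotated. Then, as $N\to\infty$ (that is, as $k\to\infty$ through such values with $A,B$ fixed), $$ \mathbb{E}\left[E_0(\omega_N)\right] = -\frac{N^2}{4} -\frac{1}{3}N\log N + N\left( \frac{\sqrt{\pi}}{4}\left(\frac{B}{A}\right)^{1/2} -\log\left(\left(\frac{B}{A}\right)^{1/3}\right) \right) +o(N). $$ In particular, the coefficient of the linear term tends to $\frac{1}{3}\left(2+\log\frac{9\pi}{64}\right)$ as $\frac{A}{B}\to\frac{3^2\pi}{4^3}$.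
   Context: Logarithmic energy: for $\omega_N=\{x_1,\dots,x_N\}\subset\mathbb{S}^3\subset\mathbb{R}^4$, $E_0(\omega_N)=\sum_{i\neq j}\log\frac{1}{\|x_i-x_j\|}$, the sum being over ordered pairs $(i,j)$, $1\le i,j\le N$, $i\ne j$, with $\|\cdot\|$ the Euclidean norm. Hopf fibration: $h:\mathbb{S}^3\to\mathbb{S}^2$, $h(a,b,c,d)=(a^2+b^2-c^2-d^2,\,2(ad+bc),\,2(bd-ac))$. For each $y\in\mathbb{S}^2$ the fibre $h^{-1}(y)$ is a great circle of $\mathbb{S}^3$. Lifting: given $y_1,\dots,y_r\in\mathbb{S}^2$, for each $i$ one takes $k$ equally spaced points on the great circle $h^{-1}(y_i)$ (a copy of the $k$-th roots of unity) rotated along the circle by a random angle uniform in $[0,2\pi)$; the rotations are independent of each other and of the base points. Spherical ensemble: the random set of $r$ points on $\mathbb{S}^2$ whose joint density with respect to the $r$-fold product of surface measure is proportional to $\prod_{1\le i<j\le r}\|y_i-y_j\|^2$. Equivalently, identifying $\mathbb{S}^2$ with $\mathbb{CP}^1$ (Riemann sphere, by stereographic projection), it is the determinantal point process on $\mathbb{CP}^1$, with respect to the Fubini–Study volume normalized to total mass $\pi$, with a projection kernel $K$ satisfying $|K([\mathbf p],[\mathbf q])|=\frac{r}{\pi}|\langle \mathbf p,\mathbf q\rangle|^{r-1}$ for unit vectors $\mathbf p,\mathbf q\in\mathbb{C}^2$. *)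

(* Defs.v *)
From HB Require Import structures.
From mathcomp Require Import all_boot all_order all_algebra.
From mathcomp Require Import all_classical all_reals all_analysis measurable_realfun.
From mathcomp Require Import ring lra.

Set Implicit Arguments.
Unset Strict Implicit.
Unset Printing Implicit Defensive.

Import Order.TTheory GRing.Theory Num.Theory.
Import numFieldNormedType.Exports.

Local Open Scope classical_set_scope.
Local Open Scope ring_scope.

(* Points of R^n are n-tuples of reals, with the product (= Borel)
   sigma-algebra of n.-tuple R. *)

Definition edist {R : realType} {n : nat} (x y : n.-tuple R) : R :=
  Num.sqrt (\sum_(i < n) (tnth x i - tnth y i) ^+ 2).

Definition usphere {R : realType} {n : nat} : set (n.-tuple R) :=
  [set x | \sum_(i < n) tnth x i ^+ 2 = 1].

(* ln 0 = 0 in the library: two coinciding points contribute 0 instead of +oo.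
   For the point processes below this concerns an event of probability 0. *)
Definition log_energy {R : realType} {n : nat} {I : finType}
    (x : I -> n.-tuple R) : R :=
  \sum_(i : I) \sum_(j : I | i != j) ln (edist (x i) (x j))^-1.

Definition hopf {R : realType} (x : 4.-tuple R) : 3.-tuple R :=
  [tuple x`_0 ^+ 2 + x`_1 ^+ 2 - x`_2 ^+ 2 - x`_3 ^+ 2;
         2 * (x`_0 * x`_3 + x`_1 * x`_2);
         2 * (x`_1 * x`_3 - x`_0 * x`_2)].

(* With z = x0 + i x1 and w = x2 + i x3, the map hopf is
   (|z|^2 - |w|^2, 2 Im (z w), -2 Re (z w)); its fibre through (z, w) is the
   great circle of the points (e^(it) z, e^(-it) w), which are at arc length t
   from (z, w). *)
Definition hopf_rot {R : realType} (t : R) (x : 4.-tuple R) : 4.-tuple R :=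
  [tuple cos t * x`_0 - sin t * x`_1;
         sin t * x`_0 + cos t * x`_1;
         cos t * x`_2 + sin t * x`_3;
         cos t * x`_3 - sin t * x`_2].

Lemma hopf_hopf_rot {R : realType} (t : R) (x : 4.-tuple R) :
  hopf (hopf_rot t x) = hopf x.
Proof.
have c2 := cos2Dsin2 t.
have sE : sin t ^+ 2 = 1 - cos t ^+ 2 by rewrite -c2; ring.
by apply/val_inj => /=; congr [:: _; _; _]; ring: sE.
Qed.

(* A Borel choice of base point in each fibre, for instance
   s y = (a, 0, - y_2 / (2 a), y_1 / (2 a)) with a = sqrt ((1 + y_0) / 2), and
   s (-1, 0, 0) = (0, 0, 1, 0).  Values off the sphere are irrelevant. *)
Definition hopf_section {R : realType} (s : 3.-tuple R -> 4.-tuple R) :=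
  measurable_fun [set: 3.-tuple R] s /\
  forall y, usphere y -> usphere (s y) /\ hopf (s y) = y.

(* The k equally spaced points of the fibre over each y_i, rotated by th_i. *)
Definition hopf_lift {R : realType} (s : 3.-tuple R -> 4.-tuple R) {r : nat}
    (k : nat) (y : r.-tuple (3.-tuple R)) (th : 'I_r -> R)
    (ij : 'I_r * 'I_k) : 4.-tuple R :=
  hopf_rot (th ij.1 + 2 * pi * ij.2%:R / k%:R) (s (tnth y ij.1)).

Section surface_measure.
Local Open Scope ereal_scope.
Context {R : realType}.

(* Spherical coordinates (colatitude, longitude) on the unit sphere of R^3,
   and their area element, cut off outside [0, pi] x [0, 2 pi]. *)
Definition sph_coord (x : R * R) : 3.-tuple R :=
  [tuple sin x.1 * cos x.2; sin x.1 * sin x.2; cos x.1]%R.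

Definition sph_jacobian (x : R * R) : R :=
  if [&& 0 <= x.1, x.1 <= pi, 0 <= x.2 & x.2 <= 2 * pi]%R then sin x.1 else 0%R.

Local Notation mu := (@lebesgue_measure R).

Definition surface_measure (A : set (3.-tuple R)) : \bar R :=
  \int[mu \x mu]_(x in sph_coord @^-1` A) (sph_jacobian x)%:E.

Lemma sph_jacobian_ge0 x : (0 <= sph_jacobian x)%R.
Proof.
rewrite /sph_jacobian; case: ifPn => // /and4P[x0 xpi _ _].
by rewrite sin_ge0_pi// x0 xpi.
Qed.

Lemma sph_jacobian_le1 x : (sph_jacobian x <= 1)%R.
Proof. by rewrite /sph_jacobian; case: ifPn => // _; exact: sin_le1. Qed.

Lemma measurable_sph_coord : measurable_fun [set: R * R] sph_coord.
Proof.
have msin : measurable_fun [set: R] (@sin R).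
  by apply: continuous_measurable_fun; exact: continuous_sin.
have mcos : measurable_fun [set: R] (@cos R).
  by apply: continuous_measurable_fun; exact: continuous_cos.
apply/measurable_fun_tnthP => -[[|[|[|//]]] i3] /=.
- apply: (eq_measurable_fun (fun x : R * R => sin x.1 * cos x.2)%R) => //.
  by apply: measurable_funM; apply: measurableT_comp.
- apply: (eq_measurable_fun (fun x : R * R => sin x.1 * sin x.2)%R) => //.
  by apply: measurable_funM; apply: measurableT_comp.
- apply: (eq_measurable_fun (fun x : R * R => cos x.1)) => //.
  exact: measurableT_comp.
Qed.

Lemma measurable_sph_jacobian : measurable_fun [set: R * R] sph_jacobian.
Proof.
have msin : measurable_fun [set: R] (@sin R).
  by apply: continuous_measurable_fun; exact: continuous_sin.
apply: measurable_fun_if => //=.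
  do 3 (apply: measurable_and; first exact: measurable_fun_ler).
  exact: measurable_fun_ler.
by apply: measurable_funTS; exact: measurableT_comp.
Qed.

Let mpreimage (A : set (3.-tuple R)) :
  measurable A -> measurable (sph_coord @^-1` A).
Proof. by move=> mA; rewrite -[X in measurable X]setTI; exact: measurable_sph_coord. Qed.

Let surface_measure0 : surface_measure set0 = 0.
Proof. by rewrite /surface_measure preimage_set0 integral_set0. Qed.

Let surface_measure_ge0 A : 0 <= surface_measure A.
Proof. by apply: integral_ge0 => x _; rewrite lee_fin sph_jacobian_ge0. Qed.

Let surface_measure_sigma_additive : semi_sigma_additive surface_measure.
Proof.
move=> F mF tF mUF; rewrite /surface_measure; apply: cvg_toP.
  apply: ereal_nondecreasing_is_cvgn => m n mn.
  by apply: lee_sum_nneg_natr => // k _ _; exact: surface_measure_ge0.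
rewrite preimage_bigcup ge0_integral_bigcup//=.
- by move=> n; exact: mpreimage.
- apply: measurable_funTS; apply: measurableT_comp => //.
  exact: measurable_sph_jacobian.
- by move=> x _; rewrite lee_fin sph_jacobian_ge0.
- apply/trivIsetP => i j _ _ ij; rewrite -preimage_setI.
  by move/trivIsetP : tF => /(_ _ _ I I ij) ->; rewrite preimage_set0.
Qed.

HB.instance Definition _ := isMeasure.Build _ _ _ surface_measure
  surface_measure0 surface_measure_ge0 surface_measure_sigma_additive.

Let surface_measure_fin : fin_num_fun surface_measure.
Proof.
move=> A mA; rewrite ge0_fin_numE; last exact: surface_measure_ge0.
pose box : set (R * R) := `[0%R, pi]%classic `*` `[0%R, (2 * pi)%R]%classic.
have mbox : measurable box by exact: measurableX.
apply: (@le_lt_trans _ _ (\int[mu \x mu]_(x in sph_coord @^-1` A) (\1_box x)%:E)).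
  apply: ge0_le_integral => //.
  - exact: mpreimage.
  - by move=> x _; rewrite lee_fin sph_jacobian_ge0.
  - apply: measurable_funTS; apply: measurableT_comp => //.
    exact: measurable_sph_jacobian.
  - by apply: measurable_funTS; exact: measurableT_comp.
  - move=> x _; rewrite lee_fin indicE; have [xbox|xbox] := boolP (x \in box).
      exact: sph_jacobian_le1.
    rewrite /sph_jacobian; case: ifPn => // /and4P[x1 x2 x3 x4].
    by case/negP: xbox; rewrite inE /box /= !in_itv/= x1 x2 x3 x4.
rewrite integral_indic//; last exact: mpreimage.
apply: (@le_lt_trans _ _ ((mu \x mu) box)).
  by apply: le_measure; rewrite ?inE//; apply: measurableI => //; exact: mpreimage.
have itv_fin (a b : R) : mu `[a, b]%classic \is a fin_num.
  by rewrite lebesgue_measure_itv/=; case: ifP.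
rewrite product_measure1E// lte_mul_pinfty ?itv_fin//.
by rewrite -ge0_fin_numE ?itv_fin.
Qed.

HB.instance Definition _ := Measure_isFinite.Build _ _ _ surface_measure
  surface_measure_fin.

End surface_measure.

Section finite_measure_of.
Context {d : measure_display} {T : measurableType d} {R : realType}.
Variable nu : {measure set T -> \bar R}.

Definition finite_measure_of (_ : fin_num_fun nu) : set T -> \bar R := nu.

Hypothesis nufin : fin_num_fun nu.

HB.instance Definition _ := Measure.on (finite_measure_of nufin).
HB.instance Definition _ :=
  Measure_isFinite.Build _ _ _ (finite_measure_of nufin) nufin.

End finite_measure_of.

Section tuple_measure.
Local Open Scope ereal_scope.
Context {d : measure_display} {T : measurableType d} {R : realType}.
Variable mu : {finite_measure set T -> \bar R}.

(* The n-fold product measure of mu. *)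
Fixpoint tuple_measure (n : nat) : set (n.-tuple T) -> \bar R :=
  match n with
  | 0 => \d_([tuple] : 0.-tuple T)
  | m.+1 => fun A => \int[mu]_x
      @tuple_measure m [set t : m.-tuple T | A [tuple of x :: t]]
  end.

Lemma tuple_measure_is_finite_measure n :
  exists m : {finite_measure set (n.-tuple T) -> \bar R}, @tuple_measure n = m.
Proof.
elim: n => [|n [m IH]].
  by exists (\d_([tuple] : 0.-tuple T)).
pose f (p : T * n.-tuple T) : n.+1.-tuple T := [tuple of p.1 :: p.2].
have mf : measurable_fun setT f.
  exact: (measurable_cons measurable_fst measurable_snd).
pose nu' := [the {measure set (n.+1.-tuple T) -> \bar R} of
  pushforward (mu \x m) f].
pose nu : {measure set (n.+1.-tuple T) -> \bar R} := nu' mf.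
have nuE : @tuple_measure n.+1 = nu.
  apply/funext => A /=; rewrite /pushforward /product_measure1.
  apply: eq_integral => x _ /=; rewrite IH; congr (m _).
  by rewrite xsectionE.
suff nufin : fin_num_fun nu.
  by exists [the {finite_measure set _ -> \bar R} of finite_measure_of nufin].
move=> A mA.
rewrite ge0_fin_numE//; apply: (@le_lt_trans _ _ ((mu \x m) setT)).
  apply: (@le_measure _ _ _ (mu \x m)%E); rewrite ?inE//.
  by rewrite -[X in measurable X]setTI; exact: (mf measurableT).
rewrite -setXTT product_measure1E// lte_mul_pinfty//.
  exact: fin_num_measure.
by rewrite -ge0_fin_numE//; exact: fin_num_measure.
Qed.


Let tuple_measure0 n : @tuple_measure n set0 = 0.
Proof. by have [m ->] := tuple_measure_is_finite_measure n. Qed.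

Let tuple_measure_ge0 n A : 0 <= @tuple_measure n A.
Proof. by have [m ->] := tuple_measure_is_finite_measure n. Qed.

Let tuple_measure_sigma_additive n : semi_sigma_additive (@tuple_measure n).
Proof.
have [m ->] := tuple_measure_is_finite_measure n.
exact: measure_semi_sigma_additive.
Qed.

HB.instance Definition _ n := isMeasure.Build _ _ _ (@tuple_measure n)
  (tuple_measure0 n) (@tuple_measure_ge0 n) (@tuple_measure_sigma_additive n).

Let tuple_measure_fin n : fin_num_fun (@tuple_measure n).
Proof.
have [m ->] := tuple_measure_is_finite_measure n; exact: fin_num_measure.
Qed.

HB.instance Definition _ n := Measure_isFinite.Build _ _ _ (@tuple_measure n)
  (@tuple_measure_fin n).

End tuple_measure.

Section random_model.
Local Open Scope ereal_scope.
Context {R : realType} {d : measure_display} {T : measurableType d}.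
Context {P : probability T R} {r : nat}.

Definition spherical_weight (y : r.-tuple (3.-tuple R)) : R :=
  (\prod_(i < r) \prod_(j < r | (i < j)%N)
     edist (tnth y i) (tnth y j) ^+ 2)%R.

Definition spherical_ensemble (Y : {RV P >-> r.-tuple (3.-tuple R)}) : Prop :=
  exists c : R, forall C : set (r.-tuple (3.-tuple R)), measurable C ->
    distribution P Y C =
    c%:E * \int[tuple_measure surface_measure (n:=r)]_(y in C)
             (spherical_weight y)%:E.

Lemma two_pi_gt0 : (0 < 2 * pi :> R)%R.
Proof. by rewrite mulr_gt0// pi_gt0. Qed.

Definition uniform_angles (Th : 'I_r -> {RV P >-> R}) : Prop :=
  forall (i : 'I_r) (U : set R), measurable U ->
    distribution P (Th i) U = uniform_prob two_pi_gt0 U.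

(* The variables Y, Th 0, ..., Th (r - 1) are mutually independent.  Taking a
   factor to be the full set gives the product rule for subfamilies. *)
Definition independent_angles (Y : {RV P >-> r.-tuple (3.-tuple R)})
    (Th : 'I_r -> {RV P >-> R}) : Prop :=
  forall (C : set (r.-tuple (3.-tuple R))) (U : 'I_r -> set R),
    measurable C -> (forall i, measurable (U i)) ->
    P [set x | C (Y x) /\ forall i, U i (Th i x)] =
    P (Y @^-1` C) * \prod_(i < r) P (Th i @^-1` U i).

End random_model.

(* The numbers r = (A / B) k^2 and N = k r, for the k such that r is an
   integer. *)
Definition admissible (A B : nat) : set nat :=
  [set k | (0 < k)%N && (B %| A * k ^ 2)%N].

Definition base_number (A B k : nat) : nat := (A * k ^ 2 %/ B)%N.

Definition point_number (A B k : nat) : nat := (k * base_number A B k)%N.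

Definition linear_coef (R : realType) (A B : nat) : R :=
  Num.sqrt pi / 4 * (B%:R / A%:R) `^ (1 / 2) - ln ((B%:R / A%:R) `^ (1 / 3)).

(* Main.v *)
(* Two distinct fibres: if y and y' are the base points and w = 1 - |y - y'|^2 / 4,
   then the squared distance from a point of the first fibre to the point of the
   second one at angle t is 2 - 2 (X cos t + Y sin t) with X^2 + Y^2 = w, and
   the mean of its logarithm over t is ln (1 + sqrt (1 - w)) (Jensen's formula).
   One fibre: the k-th roots of unity have energy - k ln k.  So only the
   expectation of the sum over pairs of ln (1 + sqrt (1 - w)) remains.

   In spherical coordinates the density of the spherical ensemble is |det|^2 for
   the matrix of the orthogonal monomials u^l v^(n - l), where n = r - 1 and
   (u, v) is a unit vector of C^2 over the point.  Expanding the determinants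
   gives r^2 (1 / (M + 1) - 1 / (M + r)) for the sum over pairs of the expectation of
   w^M.  These are r^2 times the moments of w = 1 - v^2 for the density
   2 v (1 - (1 - v^2)^n) on [0, 1]; by Bernstein approximation the sum for
   ln (1 + sqrt (1 - w)) is then r^2 / 2 - r W + 1 / 2, with W the integral of
   (1 - v^2)^n over [0, 1].

   The expected energy is therefore exactly - N^2 / 4 - N ln k + k^2 r W / 2 - k^2 / 4.
   The Wallis integral W satisfies pi / 4 <= r W^2 <= pi / 4 + pi / (4 r), hence the
   remainder is O(k^2) = o(N). *)

Require Import Defs.
From HB Require Import structures.
From mathcomp Require Import all_boot all_order all_algebra.
From mathcomp Require Import all_fingroup.
From mathcomp Require Import all_classical all_reals all_analysis measurable_realfun.
From mathcomp Require Import ring lra.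
From mathcomp Require Import complex.

Set Implicit Arguments.
Unset Strict Implicit.
Unset Printing Implicit Defensive.

Import Order.TTheory GRing.Theory Num.Theory.
Import numFieldNormedType.Exports.

Local Open Scope classical_set_scope.
Local Open Scope ring_scope.

(** * Roots of unity *)

(** The potential is unbounded where two points meet, so neither its integrability nor an exchange
    of integrals is available beforehand. Averaging a single rotation angle removes the obstacle:
    over distinct base points w < 1, the fibre integral is regular, and its value ln (1 + sqrt (1 -
    w)) stays between 0 and ln 2. Integrability of the energy comes out of the same computation.

    This bounded function is not a polynomial in w, and powers of w are what can be integrated: w =
    |<p, q>|^2 for unit vectors p, q of C^2 over the two points, so w^M is a finite sum of products
    of a function of p and a function of q, and orthogonality of monomials settles its expectation
    algebraically. The two-point function is K(p, p) K(q, q) - |K(p, q)|^2 with |K(p, q)|^2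
    proportional to w^n, so the subtracted term is a moment of order M + n for two independent
    uniform points. For such points w is uniform on [0, 1], whence 1 / (M + 1) and 1 / (M + r). The
    variable v with w = 1 - v^2 turns the square root into v and makes the last integral
    elementary. *)

Section roots_of_unity.
Local Open Scope complex_scope.
Context {R : realType}.
Implicit Types (t : R) (z : R[i]).

Definition cis t : R[i] := cos t +i* sin t.

Lemma cisD s t : cis (s + t) = cis s * cis t.
Proof. by rewrite /cis cosD sinD; congr (_ +i* _); ring. Qed.

Lemma cis0 : cis 0 = 1. Proof. by rewrite /cis cos0 sin0. Qed.

Lemma cisX t n : cis t ^+ n = cis (n%:R * t).
Proof.
elim: n => [|n IH]; first by rewrite expr0 mul0r cis0.
by rewrite exprS IH -cisD -{1}(mul1r t) -mulrDl nat1r.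
Qed.

Lemma conjc_cis t : conjc (cis t) = cis (- t).
Proof. by rewrite /cis cosN sinN. Qed.

Lemma cis2pi : cis (2 * pi) = 1.
Proof. by rewrite /cis mulr_natl cos2pi sin2pi. Qed.

(** The squared modulus, valued in R and polynomial in the real and imaginary parts, so that [ring]
    can settle identities about it. *)
Definition csq z : R := complex.Re z ^+ 2 + complex.Im z ^+ 2.

Lemma csq_ge0 z : 0 <= csq z.
Proof. by rewrite addr_ge0 ?sqr_ge0. Qed.

Lemma csqM : {morph csq : x y / x * y}.
Proof. by move=> [a b] [c d]; rewrite /csq /=; ring. Qed.

Lemma csq1 : csq 1 = 1.
Proof. by rewrite /csq /= expr1n expr0n addr0. Qed.

Lemma csq_prod I (r : seq I) (p : pred I) (f : I -> R[i]) :
  csq (\prod_(i <- r | p i) f i) = \prod_(i <- r | p i) csq (f i).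
Proof. exact: (big_morph _ csqM csq1). Qed.

Lemma csqX z n : csq (z ^+ n) = csq z ^+ n.
Proof. by elim: n => [|n IH]; rewrite ?csq1// !exprS csqM IH. Qed.

Lemma csq_cis t : csq (cis t) = 1.
Proof. exact: cos2Dsin2. Qed.

Lemma csq_real (x : R) : csq x%:C = x ^+ 2.
Proof. by rewrite /csq /= expr0n addr0. Qed.

Lemma csqE z : (csq z)%:C = z * conjc z.
Proof.
case: z => a b; apply/eqP; rewrite eq_complex /csq /=.
by apply/andP; split; apply/eqP; ring.
Qed.

Lemma csq_eq0 z : (csq z == 0) = (z == 0).
Proof. by rewrite /csq paddr_eq0 ?sqr_ge0// !sqrf_eq0 eq_complex. Qed.

(** The exact order m divides k. Were it smaller, s = 2 pi m / k would have its half strictly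
    between 0 and pi, where sin is positive, so cos s = 1 - 2 sin^2 (s / 2) could not be 1. *)
Lemma prim_root_cis k : (0 < k)%N -> k.-primitive_root (cis (2 * pi / k%:R)).
Proof.
move=> k0; have k0R : (0 : R) < k%:R by rewrite ltr0n.
have z1 : cis (2 * pi / k%:R) ^+ k = 1.
  by rewrite cisX mulrC divfK ?gt_eqF// cis2pi.
have [m pm mk] := prim_order_exists k0 z1.
have m0 := prim_order_gt0 pm.
suff km : k = m by rewrite {1}km.
apply/eqP; rewrite eqn_leq (dvdn_leq k0 mk) andbT leqNgt; apply/negP => mlt.
have := prim_expr_order pm; rewrite cisX.
set s := _ * _ => s1.
have cs : cos s = 1 by case: s1.
have s0 : 0 < s / 2 by rewrite /s !mulr_gt0 ?invr_gt0 ?pi_gt0 ?ltr0n.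
have spi : s / 2 < pi.
  have -> : s / 2 = (m%:R / k%:R) * pi by rewrite /s; field; lra.
  by rewrite gtr_pMl ?pi_gt0// ltr_pdivrMr// mul1r ltr_nat.
have : 0 < sin (s / 2) by apply: sin_gt0_pi; rewrite s0 spi.
have : cos s = 1 - 2 * sin (s / 2) ^+ 2.
  have ss : s = s / 2 + s / 2 by field.
  rewrite {1}ss cosD -!expr2; have := cos2Dsin2 (s / 2); lra.
rewrite cs => h1 /(exprn_gt0 2); lra.
Qed.

(** Homogenized factorization of X^k - 1, evaluated at x / z; the degenerate case z = 0 is split
    off. *)
Lemma prod_sub_prim_root (F : fieldType) k (x z w : F) : k.-primitive_root w ->
  \prod_(j < k) (x - z * w ^+ j) = x ^+ k - z ^+ k.
Proof.
move=> pw; have k0 := prim_order_gt0 pw.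
have [->|z0] := eqVneq z 0.
  rewrite expr0n eqn0Ngt k0/= subr0.
  under eq_bigr do rewrite mul0r subr0.
  by rewrite prodr_const card_ord.
have := factor_Xn_sub_1 pw => /(congr1 (horner^~ (x / z))).
rewrite horner_prod !hornerE big_mkord => h.
transitivity (\prod_(j < k) (z * ('X - (w ^+ j)%:P).[x / z])).
  by apply: eq_bigr => j _; rewrite !hornerE mulrBr mulrCA divff// mulr1.
rewrite big_split/= prodr_const card_ord h mulrBr mulr1 -exprMn.
by rewrite mulrCA divff ?mulr1.
Qed.

Lemma prod_csq_shift k z t : (0 < k)%N ->
  \prod_(j < k) csq (1 - z * cis (2 * pi * j%:R / k%:R - t))
    = csq (1 - (z * cis (- t)) ^+ k).
Proof.
move=> k0; rewrite -csq_prod; congr csq.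
rewrite -[in RHS](expr1n _ k).
rewrite -(prod_sub_prim_root 1 (z * cis (- t)) (prim_root_cis k0)).
apply: eq_bigr => j _; congr (1 - _).
by rewrite cisX -[RHS]mulrA -cisD; congr (_ * cis _); ring.
Qed.

(** Both sides are the derivative of X^k - 1 at w^a: in the factored form only the term where X -
    w^a is differentiated survives. *)
Lemma prod_neq_prim_root (F : fieldType) k (w : F) (a : 'I_k) :
  k.-primitive_root w ->
  \prod_(b < k | a != b) (w ^+ a - w ^+ b) = k%:R * w ^+ (a * k.-1).
Proof.
move=> pw; have := factor_Xn_sub_1 pw.
rewrite big_mkord (bigD1 a)//= => /(congr1 (fun p => (deriv p).[w ^+ a])).
rewrite derivB derivXn derivC subr0 derivM derivXsubC mul1r hornerD hornerM.
rewrite hornerXsubC subrr mul0r addr0 hornerMn hornerXn horner_prod -exprM.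
rewrite mulr_natl => <-; apply: eq_big => [b|b _]; first by rewrite eq_sym.
by rewrite hornerXsubC.
Qed.

(** Half the logarithm of this product gives - ln k as the energy of one point against the others of
    its fibre. *)
Lemma prod_csq_roots k (a : 'I_k) :
  \prod_(b < k | a != b)
    csq (cis (2 * pi * a%:R / k%:R) - cis (2 * pi * b%:R / k%:R)) = k%:R ^+ 2.
Proof.
have k0 : (0 < k)%N by case: (a) => m; exact: leq_trans.
have E (j : nat) : cis (2 * pi * j%:R / k%:R) = cis (2 * pi / k%:R) ^+ j.
  by rewrite cisX; congr cis; ring.
rewrite -csq_prod E; under eq_bigr do rewrite E.
rewrite prod_neq_prim_root; last exact: prim_root_cis.
rewrite csqM csqX csq_cis expr1n mulr1.
have -> : k%:R = (k%:R : R)%:C :> R[i] by rewrite rmorph_nat.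
by rewrite csq_real.
Qed.

End roots_of_unity.

(** * Polynomial approximation *)

Section bernstein.
Context {R : realType}.
Implicit Types (f g : nat -> R) (x : R).

(* The n-th Bernstein polynomial of f, as the n-th iterate of the averaging
   operator f |-> (1 - 'X) f + 'X f (. + 1), evaluated at 0. *)
Fixpoint bernstein (n : nat) f : {poly R} :=
  if n is m.+1 then
    (1 - 'X) * bernstein m f + 'X * bernstein m (fun i => f i.+1)
  else (f 0)%:P.

Lemma bernsteinS n f x : (bernstein n.+1 f).[x] =
  (1 - x) * (bernstein n f).[x] + x * (bernstein n (fun i => f i.+1)).[x].
Proof. by rewrite /= !hornerE. Qed.

Lemma bernsteinD n f g x : (bernstein n (fun i => f i + g i)).[x] =
  (bernstein n f).[x] + (bernstein n g).[x].
Proof.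
elim: n f g => [|n IH] f g; first by rewrite /= !hornerC.
by rewrite !bernsteinS !IH; ring.
Qed.

Lemma bernsteinZ n f a x : (bernstein n (fun i => a * f i)).[x] =
  a * (bernstein n f).[x].
Proof.
elim: n f => [|n IH] f; first by rewrite /= !hornerC.
by rewrite !bernsteinS !IH; ring.
Qed.

Lemma bernstein_cst n a x : (bernstein n (fun=> a)).[x] = a.
Proof. by elim: n => [|n IH]; rewrite ?bernsteinS ?IH /= ?hornerC//; ring. Qed.

Lemma bernstein_le n f g x : 0 <= x <= 1 ->
  (forall i, (i <= n)%N -> f i <= g i) ->
  (bernstein n f).[x] <= (bernstein n g).[x].
Proof.
move=> /andP[x0 x1]; elim: n f g => [|n IH] f g fg.
  by rewrite /= !hornerC fg.
rewrite !bernsteinS lerD// ler_wpM2l ?subr_ge0//; apply: IH => i ni; apply: fg.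
  exact: leqW.
by [].
Qed.

(** Second moment of the binomial law about c. The point c is arbitrary because the shift of i in
    the recursion replaces c by c - 1. *)
Lemma bernstein_var n c x :
  (bernstein n (fun i => (i%:R - c) ^+ 2)).[x]
    = (n%:R * x - c) ^+ 2 + n%:R * x * (1 - x).
Proof.
elim: n c => [|n IH] c; first by rewrite /= hornerC; ring.
rewrite bernsteinS IH.
have -> : (fun i : nat => (i.+1%:R - c) ^+ 2) = (fun i => (i%:R - (c - 1)) ^+ 2).
  by apply/funext => i; rewrite -natr1; ring.
by rewrite IH -natr1; ring.
Qed.

(* The modulus of continuity sqrt d is dominated by e + d^2 / e^3, whose average
   is controlled by the variance. *)
Lemma poly_approx (F : R -> R) (e : R) : 0 < e ->
  {in `[0, 1] &, forall x y, `|F x - F y| <= Num.sqrt `|x - y|} ->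
  exists p : {poly R}, {in `[0, 1], forall x, `|F x - p.[x]| <= e}.
Proof.
move=> e0 hF; pose a := e / 2; have a0 : 0 < a by rewrite divr_gt0.
have sqle d : 0 <= d -> Num.sqrt d <= a + d ^+ 2 / a ^+ 3.
  move=> d0; have [da|ad] := leP (Num.sqrt d) a.
    by rewrite (le_trans da)// lerDl divr_ge0 ?sqr_ge0// exprn_ge0// ltW.
  rewrite -{2}(sqr_sqrtr d0); set s := Num.sqrt d in ad *.
  rewrite (@le_trans _ _ ((s ^+ 2) ^+ 2 / a ^+ 3))//; last by rewrite lerDr ltW.
  have -> : (s ^+ 2) ^+ 2 = s * s ^+ 3 by ring.
  have s0 : 0 <= s by rewrite sqrtr_ge0.
  rewrite ler_pdivlMr ?exprn_gt0// ler_wpM2l// lerXn2r// ?nnegrE// ltW//.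
(* The variance contributes at most n / (n^2 a^3) = 1 / (n a^3), which is at most a once n >=
   a^-4. *)
have [n n0 nle] : exists2 n : nat, (0 < n)%N & (a ^+ 4)^-1 <= n%:R.
  pose m := Num.truncn (a ^+ 4)^-1; exists m.+1 => //.
  by rewrite ltW// truncnS_gt.
have nR : (0 : R) < n%:R by rewrite ltr0n.
exists (bernstein n (fun i => F (i%:R / n%:R))) => x; rewrite in_itv/= => x01.
pose G i := a + (i%:R - n%:R * x) ^+ 2 / (n%:R ^+ 2 * a ^+ 3).
have BG : (bernstein n G).[x] <= e.
  have -> : G = (fun i => a + (n%:R ^+ 2 * a ^+ 3)^-1 * (i%:R - n%:R * x) ^+ 2).
    by apply/funext => i; rewrite /G mulrC.
  rewrite (bernsteinD _ (fun=> a)) bernstein_cst bernsteinZ bernstein_var.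
  rewrite subrr expr0n add0r.
  have -> : e = a + a by rewrite /a; field.
  rewrite lerD2l mulrC ler_pdivrMr ?mulr_gt0 ?exprn_gt0//.
  have : n%:R * x * (1 - x) <= n%:R.
    rewrite -mulrA ler_piMr ?ler0n//; move: x01 => /andP[x0 x1].
    by rewrite mulr_ile1//; lra.
  move=> /le_trans; apply.
  have -> : a * (n%:R ^+ 2 * a ^+ 3) = n%:R * (n%:R * a ^+ 4) by ring.
  by rewrite ler_peMr ?ler0n// -ler_pdivrMr ?exprn_gt0// mul1r.
have bnd i : (i <= n)%N -> `|F x - F (i%:R / n%:R)| <= G i.
  move=> ni; apply: (le_trans (hF _ _ _ _)); rewrite ?in_itv//=.
    by rewrite divr_ge0//= ler_pdivrMr// mul1r ler_nat.
  apply: (le_trans (sqle _ _)) => //; rewrite lerD2l real_normK ?num_real//.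
  rewrite le_eqVlt; apply/orP; left; apply/eqP; field.
  by rewrite !gt_eqF.
have E y : F x - (bernstein n (fun i => F (i%:R / n%:R))).[y]
    = (bernstein n (fun i => F x + -1 * F (i%:R / n%:R))).[y].
  by rewrite bernsteinD bernsteinZ bernstein_cst mulN1r.
apply: le_trans BG; rewrite ler_norml E; apply/andP; split.
  have := bernsteinZ n G (-1) x; rewrite mulN1r => <-.
  apply: bernstein_le => // i /bnd.
  by rewrite ler_norml !mulN1r => /andP[].
by apply: bernstein_le => // i /bnd; rewrite ler_norml mulN1r => /andP[].
Qed.

End bernstein.

(** * Integrals in one variable *)

Lemma Rintegral_sum d (T : measurableType d) (R : realType)
    (mu : {measure set T -> \bar R}) (D : set T) (I : Type) (s : seq I)
    (P : pred I) (f : I -> T -> R) : measurable D ->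
  (forall i, mu.-integrable D (EFin \o f i)) ->
  \int[mu]_(x in D) \sum_(i <- s | P i) f i x
    = \sum_(i <- s | P i) \int[mu]_(x in D) f i x.
Proof.
move=> mD fi; elim: s => [|h t IH].
  under eq_Rintegral do rewrite big_nil.
  by rewrite big_nil Rintegral_cst// mul0r.
under eq_Rintegral do rewrite big_cons; rewrite big_cons.
case: ifP => // _; rewrite RintegralD//; first by rewrite IH.
rewrite (_ : _ \o _ = fun x => \sum_(i <- t | P i) (f i x)%:E)%E.
  by apply: integrable_sum => // i _; exact: fi.
by apply/funext => x /=; rewrite sumEFin.
Qed.

Lemma ln_prod (R : realType) (I : Type) (s : seq I) (P : pred I) (f : I -> R) :
  (forall i, P i -> 0 < f i) ->
  ln (\prod_(i <- s | P i) f i) = \sum_(i <- s | P i) ln (f i).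
Proof.
move=> f0; elim: s => [|h t IH]; rewrite ?(big_nil, big_cons) ?ln1//.
by case: ifP => // Ph; rewrite lnM ?posrE ?f0 ?prodr_gt0// IH.
Qed.

Section one_dimensional_integrals.
Context {R : realType}.
Local Notation mu := (@lebesgue_measure R).
Implicit Types (f F : R -> R) (a b : R).

Lemma continuous_itv_integrable f a b :
  (forall x, a <= x <= b -> {for x, continuous f}) ->
  mu.-integrable `[a, b] (EFin \o f).
Proof.
move=> cf; apply: continuous_compact_integrable; first exact: segment_compact.
by apply: continuous_in_subspaceT => x; rewrite inE/= in_itv/=; exact: cf.
Qed.

Lemma Rintegral_itv_cst (c a b : R) : a <= b ->
  \int[mu]_(x in `[a, b]) c = c * (b - a).
Proof.
move=> ab; rewrite Rintegral_cst//= lebesgue_measure_itv/= lte_fin.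
case: ltP => //= ba; have -> : a = b by apply/eqP; rewrite eq_le ab.
by rewrite subrr.
Qed.

Lemma is_derive_continuous f (x d : R) : is_derive x 1 f d -> {for x, continuous f}.
Proof. by move=> [df _]; exact/differentiable_continuous/derivable1_diffP. Qed.

Lemma Rintegral_FTC F f a b : a <= b ->
  (forall x, a <= x <= b -> is_derive x 1 F (f x)) ->
  (forall x, a <= x <= b -> {for x, continuous f}) ->
  \int[mu]_(x in `[a, b]) f x = F b - F a.
Proof.
rewrite le_eqVlt => /predU1P[->|ab] dF cf.
  by rewrite set_itv1 Rintegral_set1 subrr.
have cF x : a <= x <= b -> {for x, continuous F}.
  by move=> /dF; exact: is_derive_continuous.
have itvW x : x \in `]a, b[ -> a <= x <= b.
  by rewrite in_itv/= => /andP[/ltW -> /ltW ->].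
rewrite /Rintegral (@continuous_FTC2 _ f F)//=.
- by apply: continuous_in_subspaceT => x; rewrite inE/= in_itv/=; exact: cf.
- split.
  + by move=> x /itvW /dF[].
  + by apply/cvg_at_right_filter/cF; rewrite lexx ltW.
  + by apply/cvg_at_left_filter/cF; rewrite lexx ltW.
- by move=> x /itvW /dF dFx; rewrite derive1E; exact: derive_val.
Qed.

Lemma continuous_antiderivative f : continuous f ->
  exists F : R -> R, forall x : R, 0 <= x -> is_derive x 1 F (f x).
Proof.
(* Starting the integral at -1 makes 0 an interior point, so that the derivative at 0 is
   two-sided. *)
move=> cf; exists (fun x => \int[mu]_(t in `[-1, x]) f t) => x x0.
have [|||df f'] := @continuous_FTC1_closed _ f (-1) x (x + 1) _ _ _ (cf x).
- by rewrite ltrDl.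
- by apply: continuous_itv_integrable => y _; exact: cf.
- by lra.
- apply: DeriveDef; first exact: df.
  by rewrite -derive1E; exact: f'.
Qed.

Lemma is_derive_translate F (d s x : R) : is_derive (x + s) 1 F d ->
  is_derive x 1 (fun y => F (y + s)) d.
Proof.
move=> h; rewrite -[d]mulr1.
have h' : is_derive x 1 (fun y : R => y + s) 1.
  by apply: is_derive_eq; rewrite addr0.
exact: (@is_derive1_comp _ F (fun y => y + s) _ _ _ h h').
Qed.

Lemma Rintegral_periodic f p s : 0 <= p -> 0 <= s -> continuous f ->
  (forall x, f (x + p) = f x) ->
  \int[mu]_(x in `[0, p]) f (x + s) = \int[mu]_(x in `[0, p]) f x.
Proof.
move=> p0 s0 cf fp; have [F dF] := continuous_antiderivative cf.
have cs u : continuous (fun x => f (x + u)).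
  move=> x; apply: continuous_comp; [|exact: cf].
  by apply: continuousD; [exact: cvg_id|exact: cst_continuous].
have E u b : 0 <= u -> 0 <= b ->
    \int[mu]_(x in `[0, b]) f (x + u) = F (b + u) - F u.
  move=> u0 b0; have dFu (x : R) : 0 <= x <= b ->
      is_derive x 1 (fun y => F (y + u)) (f (x + u)).
    by move=> /andP[x0 _]; apply/is_derive_translate/dF; rewrite addr_ge0.
  by rewrite (Rintegral_FTC b0 dFu) ?add0r// => x _; exact: cs.
have E0 b : 0 <= b -> \int[mu]_(x in `[0, b]) f x = F b - F 0.
  by move=> b0; rewrite -[b in RHS]addr0 -E//; under [RHS]eq_Rintegral do rewrite addr0.
(* Periodicity is used on [0, s]: it gives F (s + p) - F p = F s - F 0, which rearranges to the
   claim. *)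
have := E p s p0 s0; under eq_Rintegral do rewrite fp.
rewrite (E0 s s0) (E s p)// (E0 p)// => h.
by rewrite [in LHS](addrC p s); lra.
Qed.

Lemma csq_onem_bounds (w : R[i]) :
  (1 - Num.sqrt (csq w)) ^+ 2 <= csq (1 - w) <= (1 + Num.sqrt (csq w)) ^+ 2.
Proof.
set q := Num.sqrt _; have q0 : 0 <= q by rewrite sqrtr_ge0.
have qE : q ^+ 2 = csq w by rewrite sqr_sqrtr ?csq_ge0.
have E : csq (1 - w) = 1 - 2 * complex.Re w + q ^+ 2.
  by rewrite qE; case: (w) => a b; rewrite /csq /=; ring.
have : `|complex.Re w| <= q.
  rewrite -(ler_pXn2r (ltn0Sn 1)) ?nnegrE// real_normK ?num_real// qE.
  by rewrite /csq lerDl sqr_ge0.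
rewrite E ler_norml => /andP[h1 h2]; apply/andP; split; lra.
Qed.

(** The triangle inequality puts |1 - w| between 1 - q and 1 + q, and (1 + q) (1 - q) <= 1 lets the
    lower bound control both signs of the logarithm. *)
Lemma ln_csq_onem_bound (w : R[i]) (q : R) : 0 <= q < 1 -> csq w <= q ^+ 2 ->
  0 < csq (1 - w) /\ `|ln (csq (1 - w))| <= - 2 * ln (1 - q).
Proof.
move=> /andP[q0 q1] wq; have /andP[lo hi] := csq_onem_bounds w.
set p := Num.sqrt _ in lo hi; have p0 : 0 <= p by rewrite sqrtr_ge0.
have pq : p <= q.
  rewrite -(ler_pXn2r (ltn0Sn 1)) ?nnegrE//.
  by rewrite sqr_sqrtr ?csq_ge0.
have c0 : 0 < csq (1 - w) by apply: lt_le_trans lo; rewrite exprn_gt0//; lra.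
split=> //; have lnX2 (x : R) : 0 < x -> ln (x ^+ 2) = 2 * ln x.
  by move=> x0; rewrite lnXn// mulr_natl.
rewrite ler_norml; apply/andP; split.
  rewrite mulNr opprK -lnX2; last lra.
  rewrite ler_ln ?posrE ?exprn_gt0//; last lra.
  by apply: le_trans lo; rewrite lerXn2r// ?nnegrE; lra.
apply: (@le_trans _ _ (ln ((1 + q) ^+ 2))).
  rewrite ler_ln ?posrE ?exprn_gt0//; last lra.
  by apply: (le_trans hi); rewrite lerXn2r// ?nnegrE; lra.
rewrite lnX2; last lra.
rewrite mulNr -mulrN ler_pM2l// -lnV ?posrE; last lra.
rewrite ler_ln ?posrE ?invr_gt0; [|lra|lra].
rewrite -[_^-1]mul1r ler_pdivlMr; last lra.
have : 0 <= q ^+ 2 by rewrite sqr_ge0.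
lra.
Qed.

Lemma continuous_csq_cis (z : R[i]) (u : R) :
  continuous (fun t : R => csq (1 - z * cis (u - t))).
Proof.
case: z => a b; have -> : (fun t : R => csq (1 - Complex a b * cis (u - t))) =
   (fun t => (1 - (a * cos (u - t) - b * sin (u - t))) ^+ 2
           + (a * sin (u - t) + b * cos (u - t)) ^+ 2).
  by apply/funext => t; rewrite /csq /=; ring.
have cu : continuous (fun t : R => u - t).
  by move=> t; apply: continuousB; [exact: cst_continuous|exact: cvg_id].
have cc : continuous (fun t : R => cos (u - t)).
  by move=> t; apply: continuous_comp; [exact: cu|exact: continuous_cos].
have cs : continuous (fun t : R => sin (u - t)).
  by move=> t; apply: continuous_comp; [exact: cu|exact: continuous_sin].
have cZ (x : R) (f : R -> R) : continuous f -> continuous (fun t => x * f t).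
  by move=> cf t; apply: continuousM; [exact: cst_continuous|exact: cf].
have cX (f : R -> R) : continuous f -> continuous (fun t => f t ^+ 2).
  move=> cf; under eq_fun do rewrite expr2.
  by move=> t; apply: continuousM; exact: cf.
have cB (f g : R -> R) : continuous f -> continuous g -> continuous (fun t => f t - g t).
  by move=> cf cg t; apply: continuousB; [exact: cf|exact: cg].
have cD (f g : R -> R) : continuous f -> continuous g -> continuous (fun t => f t + g t).
  by move=> cf cg t; apply: continuousD; [exact: cf|exact: cg].
apply: (cD); apply: cX.
  by apply: (cB); [exact: cst_continuous|apply: (cB); exact: cZ].
by apply: cD; exact: cZ.
Qed.

(* Averaging over the k-th roots of unity replaces [1 - z e^(-it)] by
   [1 - (z e^(-it))^k], whose logarithm stays bounded, so that the integral
   is O(1 / k) for every k. *)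
Lemma Rintegral_ln_csq (z : R[i]) : csq z < 1 ->
  \int[mu]_(t in `[0, 2 * pi]) ln (csq (1 - z * cis (- t))) = 0.
Proof.
move=> z1; pose q := Num.sqrt (csq z); have q0 : 0 <= q by rewrite sqrtr_ge0.
have qE : q ^+ 2 = csq z by rewrite sqr_sqrtr ?csq_ge0.
have q1 : q < 1 by rewrite -(@ltr_pXn2r _ 2) ?nnegrE// qE expr1n.
have tp0 : 0 <= 2 * pi :> R by rewrite mulr_ge0// pi_ge0.
have bnd t : 0 < csq (1 - z * cis t) /\
    `|ln (csq (1 - z * cis t))| <= - 2 * ln (1 - q).
  apply: ln_csq_onem_bound; first by rewrite q0.
  by rewrite csqM csq_cis mulr1 qE.
pose g u (t : R) := ln (csq (1 - z * cis (u - t))).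
have cg u : continuous (g u).
  move=> t; apply: continuous_comp; first exact: continuous_csq_cis.
  by apply: continuous_ln; have [] := bnd (u - t).
have gint u : mu.-integrable `[0, 2 * pi] (EFin \o g u).
  by apply: continuous_itv_integrable => t _; exact: cg.
have gp u t : g u (t + 2 * pi) = g u t.
  rewrite /g opprD addrA cisD -[in RHS](mulr1 (cis (u - t))); congr ln.
  by congr csq; congr (1 - _ * (_ * _)); rewrite -conjc_cis cis2pi rmorph1.
set I := LHS; have IE : I = \int[mu]_(t in `[0, 2 * pi]) g 0 t.
  by apply: eq_Rintegral => t _; rewrite /g sub0r.
have gI u : 0 <= u -> \int[mu]_(t in `[0, 2 * pi]) g u t = I.
  move=> u0; rewrite -(Rintegral_periodic tp0 u0 (cg u) (gp u)) IE.
  by apply: eq_Rintegral => t _; rewrite /g; congr (ln (csq (1 - _ * cis _))); ring.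
pose C := - 2 * ln (1 - q) * (2 * pi).
have kI (k : nat) : (0 < k)%N -> `|k%:R * I| <= C.
  move=> k0; have -> : k%:R * I =
      \int[mu]_(t in `[0, 2 * pi]) \sum_(j < k) g (2 * pi * j%:R / k%:R) t.
    rewrite Rintegral_sum//.
    transitivity (\sum_(j < k) I); first by rewrite sumr_const card_ord; exact: mulr_natl.
    apply: eq_bigr => j _; rewrite gI// divr_ge0 ?ler0n// mulr_ge0 ?ler0n//.
  have SE t : \sum_(j < k) g (2 * pi * j%:R / k%:R) t
      = ln (csq (1 - (z * cis (- t)) ^+ k)).
    rewrite -ln_prod; last by move=> j _; have [] := bnd (2 * pi * j%:R / k%:R - t).
    by rewrite prod_csq_shift.
  have Sint : mu.-integrable `[0, 2 * pi]
      (EFin \o fun t => \sum_(j < k) g (2 * pi * j%:R / k%:R) t).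
    rewrite (_ : _ \o _ = fun t => \sum_(j < k) (g (2 * pi * j%:R / k%:R) t)%:E)%E.
      by apply: integrable_sum => // j _; exact: gint.
    by apply/funext => t /=; rewrite sumEFin.
  apply: (le_trans (le_normr_Rintegral _ Sint)) => //=.
  have -> : C = \int[mu]_(t in `[0, 2 * pi]) (- 2 * ln (1 - q)).
    by rewrite Rintegral_itv_cst// subr0.
  apply: le_Rintegral => //.
  - by have := integrable_norm Sint.
  - by apply: continuous_itv_integrable => t _; exact: cst_continuous.
  - move=> t _; rewrite SE; apply: (ln_csq_onem_bound _ _).2.
      by rewrite q0.
    (* Since |z^k| <= |z|, the same constant C serves for every k. *)
    rewrite csqX csqM csq_cis mulr1 -qE -exprM mulnC exprM.
    rewrite lerXn2r ?nnegrE ?exprn_ge0//; case: (k) k0 => // k' _.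
    by rewrite exprS ler_piMr// exprn_ile1// ltW.
apply/eqP; rewrite -normr_le0; apply/ler_addgt0Pl => e e0; rewrite addr0.
pose k := (Num.truncn (C / e)).+1.
have : `|k%:R * I| <= C by exact: kI.
rewrite normrM normr_nat => h.
have : C / e < k%:R by rewrite truncnS_gt.
rewrite ltr_pdivrMr// => h2.
rewrite -(@ler_pM2l _ k%:R) ?ltr0n//.
by rewrite (le_trans h)// ltW.
Qed.

(** The integrand factors as ln (c |1 - z e^(-it)|^2) with z = (X + iY) / c. Matching constant terms
    requires c^2 - 2 c + w = 0, and the larger root c = 1 + sqrt (1 - w) is the one with |z| < 1, so
    that only ln c is left after integration. *)
Lemma Rintegral_ln_cos_sin (X Y : R) : X ^+ 2 + Y ^+ 2 < 1 ->
  \int[mu]_(t in `[0, 2 * pi]) ln (2 - 2 * (X * cos t + Y * sin t))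
    = 2 * pi * ln (1 + Num.sqrt (1 - (X ^+ 2 + Y ^+ 2))).
Proof.
set w := X ^+ 2 + Y ^+ 2 => w1; set c := 1 + Num.sqrt (1 - w).
have w0 : 0 <= w by rewrite addr_ge0 ?sqr_ge0.
have c1 : 1 <= c by rewrite lerDl sqrtr_ge0.
have c0 : 0 < c by apply: lt_le_trans c1.
have cw : w = 2 * c - c ^+ 2.
  have : Num.sqrt (1 - w) ^+ 2 = 1 - w by rewrite sqr_sqrtr// subr_ge0 ltW.
  rewrite /c; lra.
pose z : R[i] := Complex (X / c) (Y / c).
have zE : csq z = w / c ^+ 2 by rewrite /csq /z /w /=; field; rewrite gt_eqF.
have z1 : csq z < 1.
  rewrite zE ltr_pdivrMr ?exprn_gt0// mul1r (lt_le_trans w1)//.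
  by rewrite exprn_ege1.
have E t : 2 - 2 * (X * cos t + Y * sin t) = c * csq (1 - z * cis (- t)).
  have -> : csq (1 - z * cis (- t)) = 1 - 2 * (X * cos t + Y * sin t) / c
      + csq z * (cos t ^+ 2 + sin t ^+ 2).
    by rewrite /csq /z /= cosN sinN; field; rewrite gt_eqF.
  rewrite cos2Dsin2 mulr1 zE cw; field; by rewrite gt_eqF.
have tp0 : 0 <= 2 * pi :> R by rewrite mulr_ge0// pi_ge0.
have pos t : 0 < csq (1 - z * cis (- t)).
  have q1 : Num.sqrt (csq z) < 1.
    by rewrite -(@ltr_pXn2r _ 2) ?nnegrE// sqr_sqrtr ?csq_ge0// expr1n.
  apply: (@ln_csq_onem_bound _ (Num.sqrt (csq z)) _ _).1; first by rewrite sqrtr_ge0.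
  by rewrite sqr_sqrtr ?csq_ge0// csqM csq_cis mulr1.
under eq_Rintegral do rewrite E lnM ?posrE//.
rewrite RintegralD//.
- by rewrite Rintegral_itv_cst// Rintegral_ln_csq// subr0 addr0 mulrC.
- by apply: continuous_itv_integrable => t _; exact: cst_continuous.
- apply: continuous_itv_integrable => t _; apply: continuous_comp.
    have -> : (fun t => csq (1 - z * cis (- t))) = (fun t => csq (1 - z * cis (0 - t))).
      by apply/funext => u; rewrite sub0r.
    exact: continuous_csq_cis.
  exact: continuous_ln.
Qed.

Lemma continuous_fM (f g : R -> R) (t : R) : {for t, continuous f} ->
  {for t, continuous g} -> {for t, continuous (fun t => f t * g t)}.
Proof. exact: continuousM. Qed.

Lemma continuous_lin_comb (f g : R -> R) (x y t : R) :
  {for t, continuous f} -> {for t, continuous g} ->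
  {for t, continuous (fun t => x * f t - y * g t)}.
Proof.
move=> cf cg; apply: continuousB.
  by apply: continuous_fM => //; exact: cst_continuous.
by apply: continuous_fM => //; exact: cst_continuous.
Qed.

Lemma Rintegral_lin_comb (f g : R -> R) (a b x y : R) :
  (forall t, a <= t <= b -> {for t, continuous f}) ->
  (forall t, a <= t <= b -> {for t, continuous g}) ->
  \int[mu]_(t in `[a, b]) (x * f t - y * g t)
    = x * \int[mu]_(t in `[a, b]) f t - y * \int[mu]_(t in `[a, b]) g t.
Proof.
move=> /continuous_itv_integrable fi /continuous_itv_integrable gi.
have Z c (h : R -> R) : mu.-integrable `[a, b] (EFin \o h) ->
    mu.-integrable `[a, b] (EFin \o fun t => c * h t).
  by move=> hi; have := @integrableZl _ _ _ mu `[a, b] _ c _ hi; apply.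
by rewrite RintegralB ?RintegralZl//; exact: Z.
Qed.

Definition sin_pow_int n : R := \int[mu]_(t in `[0, pi / 2]) sin t ^+ n.

Definition onem_sqr_int n : R := \int[mu]_(v in `[0, 1]) (1 - v ^+ 2) ^+ n.

Lemma is_derive_fM f g (x df dg : R) : is_derive x 1 f df -> is_derive x 1 g dg ->
  is_derive x 1 (fun t => f t * g t) (df * g x + f x * dg).
Proof.
move=> hf hg; apply: (is_derive_eq (is_deriveM hf hg)).
by rewrite /GRing.scale/= addrC [g x * _]mulrC.
Qed.

Lemma is_derive_fX f (x df : R) n : is_derive x 1 f df ->
  is_derive x 1 (fun t => f t ^+ n.+1) (n.+1%:R * f x ^+ n * df).
Proof.
move=> hf; have -> : (fun t => f t ^+ n.+1) = f ^+ n.+1 by rewrite exprfctE.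
exact: is_deriveX.
Qed.

Lemma is_derive_fB f g (x df dg : R) : is_derive x 1 f df -> is_derive x 1 g dg ->
  is_derive x 1 (fun t => f t - g t) (df - dg).
Proof. exact: is_deriveB. Qed.

Lemma is_derive_onem_sqr (x : R) : is_derive x 1 (fun t => 1 - t ^+ 2) (- (2 * x)).
Proof.
have h1 : is_derive x 1 (fun=> 1 : R) 0 by exact: is_derive_cst.
have h2 : is_derive x 1 (fun t : R => t ^+ 2) (2 * x ^+ 1 * 1).
  exact: is_derive_fX.
by apply: (is_derive_eq (is_derive_fB h1 h2)); rewrite sub0r mulr1 expr1.
Qed.

(** The function cos t sin^(n+1) t vanishes at both ends of the interval, and its derivative is the
    difference of the two integrands. *)
Lemma sin_pow_int_rec n :
  (n%:R + 1) * sin_pow_int n = (n%:R + 2) * sin_pow_int n.+2.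
Proof.
have p0 : 0 <= pi / 2 :> R by rewrite divr_ge0// pi_ge0.
have cX m (t : R) : {for t, continuous (fun t : R => sin t ^+ m)}.
  case: m => [|m]; first exact: cst_continuous.
  exact: is_derive_continuous (is_derive_fX _ (is_derive_sin _)).
apply/eqP; rewrite -subr_eq0 -Rintegral_lin_comb//.
have dF (t : R) : 0 <= t <= pi / 2 ->
    is_derive t 1 (fun t => cos t * sin t ^+ n.+1)
     ((n%:R + 1) * sin t ^+ n - (n%:R + 2) * sin t ^+ n.+2).
  move=> _; apply: (is_derive_eq
    (is_derive_fM (is_derive_cos t) (is_derive_fX n (is_derive_sin t)))).
  have := cos2Dsin2 t => cs; have c2 : cos t ^+ 2 = 1 - sin t ^+ 2 by lra.
  have -> : cos t * (n.+1%:R * sin t ^+ n * cos t) =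
     n.+1%:R * sin t ^+ n * cos t ^+ 2 by ring.
  by rewrite c2 -natr1 !exprS; ring.
rewrite (Rintegral_FTC p0 dF); first by rewrite cos_pihalf sin0 expr0n/= mul0r mulr0 subrr.
by move=> t _; apply: continuous_lin_comb; exact: cX.
Qed.

Lemma sin_pow_int0 : sin_pow_int 0 = pi / 2.
Proof.
rewrite /sin_pow_int; under eq_Rintegral do rewrite expr0.
by rewrite Rintegral_itv_cst ?mul1r ?subr0// divr_ge0// pi_ge0.
Qed.

Lemma sin_pow_int1 : sin_pow_int 1 = 1.
Proof.
have p0 : 0 <= pi / 2 :> R by rewrite divr_ge0// pi_ge0.
have dF (t : R) : 0 <= t <= pi / 2 -> is_derive t 1 (fun t => - cos t) (sin t ^+ 1).
  move=> _; apply: (is_derive_eq (is_deriveN (is_derive_cos t))).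
  by rewrite opprK expr1.
rewrite /sin_pow_int (Rintegral_FTC p0 dF); first by rewrite cos_pihalf cos0; ring.
by move=> t _; exact: continuous_sin.
Qed.

Lemma sin_pow_int_decr n : sin_pow_int n.+1 <= sin_pow_int n.
Proof.
have cX m (t : R) : {for t, continuous (fun t : R => sin t ^+ m)}.
  case: m => [|m]; first exact: cst_continuous.
  exact: is_derive_continuous (is_derive_fX _ (is_derive_sin _)).
apply: le_Rintegral => //.
- by apply: continuous_itv_integrable => t _; exact: cX.
- by apply: continuous_itv_integrable => t _; exact: cX.
- move=> t; rewrite /= in_itv/= => /andP[t0 t1].
  have s0 : 0 <= sin t.
    by apply: sin_ge0_pi; rewrite t0 (le_trans t1)// ler_pdivrMr// ler_peMr ?pi_ge0// ler1n.
  by rewrite exprS ler_piMl ?exprn_ge0// sin_le1.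
Qed.

Lemma continuous_onem_sqrX n (t : R) :
  {for t, continuous (fun t : R => (1 - t ^+ 2) ^+ n)}.
Proof.
case: n => [|n]; first exact: cst_continuous.
exact: is_derive_continuous (is_derive_fX _ (is_derive_onem_sqr _)).
Qed.

Lemma onem_sqr_int_rec n :
  (2 * n%:R + 3) * onem_sqr_int n.+1 = (2 * n%:R + 2) * onem_sqr_int n.
Proof.
have cX := continuous_onem_sqrX.
apply/eqP; rewrite -subr_eq0 -Rintegral_lin_comb//.
have dF (t : R) : 0 <= t <= 1 ->
    is_derive t 1 (fun t => t * (1 - t ^+ 2) ^+ n.+1)
     ((2 * n%:R + 3) * (1 - t ^+ 2) ^+ n.+1 - (2 * n%:R + 2) * (1 - t ^+ 2) ^+ n).
  move=> _; apply: (is_derive_eq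
    (is_derive_fM (is_derive_id t 1) (is_derive_fX n (is_derive_onem_sqr t)))).
  by rewrite -natr1 !exprS; ring.
rewrite (Rintegral_FTC ler01 dF).
  by rewrite expr1n subrr !expr0n/= !mulr0 mul0r subrr.
by move=> t _; apply: continuous_lin_comb; exact: cX.
Qed.

(** The substitution behind this is v = cos t. The proof compares recursions instead: both sides
    start at 1 and obey the same one. *)
Lemma onem_sqr_intE n : onem_sqr_int n = sin_pow_int (2 * n).+1.
Proof.
elim: n => [|n IH].
  rewrite muln0 sin_pow_int1 /onem_sqr_int; under eq_Rintegral do rewrite expr0.
  by rewrite Rintegral_itv_cst// subr0 mulr1.
have n3 : 2 * n%:R + 3 != 0 :> R by rewrite gt_eqF// ltr_wpDl// mulr_ge0.
apply: (mulfI n3); rewrite onem_sqr_int_rec IH mulnS.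
have := sin_pow_int_rec (2 * n).+1; rewrite -natr1 natrM => h.
by rewrite (_ : 2 * _ + 2 = 2 * n%:R + 1 + 1) ?h; [congr (_ * _)|]; ring.
Qed.

(** Wallis' identity: for I_m the integral of sin^m, the product (m + 1) I_m I_(m+1) keeps its
    initial value pi / 2; here m = 2 n. *)
Lemma onem_sqr_int_sin n :
  onem_sqr_int n * sin_pow_int (2 * n) = pi / (2 * (2 * n%:R + 1)).
Proof.
elim: n => [|n IH].
  by rewrite onem_sqr_intE muln0 sin_pow_int1 sin_pow_int0 mul1r mulr0 add0r mulr1.
have h1 := onem_sqr_int_rec n; have h2 := sin_pow_int_rec (2 * n).
have n0 : (0 : R) <= n%:R by [].
have e1 : (2 * n.+1)%N = (2 * n).+2 by rewrite mulnS.
rewrite e1; move: h1 h2 IH; set W1 := onem_sqr_int n.+1; set W := onem_sqr_int n.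
set S1 := sin_pow_int _.+2; set S := sin_pow_int _.
rewrite -natr1 natrM => h1 h2 h3.
have -> : W1 = (2 * n%:R + 2) / (2 * n%:R + 3) * W.
  by rewrite mulrAC -h1; field; rewrite gt_eqF//; lra.
have -> : S1 = (2 * n%:R + 1) / (2 * n%:R + 2) * S.
  by rewrite mulrAC h2; field; rewrite gt_eqF//; lra.
transitivity ((2 * n%:R + 1) / (2 * n%:R + 3) * (W * S)).
  by field; rewrite !gt_eqF//; lra.
by rewrite h3; field; rewrite !gt_eqF//; lra.
Qed.

Lemma onem_sqr_int_ge0 n : 0 <= onem_sqr_int n.
Proof.
apply: Rintegral_ge0 => t; rewrite /= in_itv/= => /andP[t0 t1].
by rewrite exprn_ge0// subr_ge0 expr_le1.
Qed.

(** W = I_(2n+1) is squeezed between its neighbours I_(2n+2) and I_(2n). The product W I_(2n) is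
    known exactly, and the recursion relates I_(2n+2) to I_(2n). The relative error O(1 / n) makes
    the final remainder explicit. *)
Lemma onem_sqr_int_bounds n :
  pi / 4 <= n.+1%:R * onem_sqr_int n ^+ 2 <= pi / 4 + pi / (4 * n.+1%:R).
Proof.
have W0 := onem_sqr_int_ge0 n; have P := onem_sqr_int_sin n.
have le1 := sin_pow_int_decr (2 * n); have le2 := sin_pow_int_decr (2 * n).+1.
have h2 := sin_pow_int_rec (2 * n).
have n0 : (0 : R) <= n%:R by [].
have p0 : 0 < pi :> R by exact: pi_gt0.
rewrite -onem_sqr_intE in le1 le2.
move: W0 P le1 le2 h2; set W := onem_sqr_int n; set S := sin_pow_int _.
set S2 := sin_pow_int _.
rewrite natrM -[n.+1%:R]natr1; set m := n%:R : R => W0 P le1 le2 h2.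
have lo : (2 * m + 1) * S <= (2 * m + 2) * W.
  by rewrite h2 ler_wpM2l//; lra.
have P' : W * S * (2 * (2 * m + 1)) = pi.
  by rewrite P; field; rewrite gt_eqF//; lra.
apply/andP; split.
  suff : pi <= 4 * ((m + 1) * W ^+ 2) by lra.
  have := ler_wpM2l W0 lo; nra.
have -> : pi / 4 + pi / (4 * (m + 1)) = pi / 4 * (m + 2) / (m + 1).
  by field; rewrite gt_eqF//; lra.
rewrite ler_pdivlMr; last lra.
have := ler_wpM2l W0 le1 => h; nra.
Qed.

Lemma Rintegral_onem_sqr_moment n :
  \int[mu]_(v in `[0, 1]) (2 * v * (1 - v ^+ 2) ^+ n) = n.+1%:R^-1.
Proof.
have n0 : n.+1%:R != 0 :> R by rewrite pnatr_eq0.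
have dF (t : R) : 0 <= t <= 1 ->
    is_derive t 1 (fun t => - n.+1%:R^-1 * (1 - t ^+ 2) ^+ n.+1)
      (2 * t * (1 - t ^+ 2) ^+ n).
  move=> _; apply: (is_derive_eq (is_derive_fM (is_derive_cst _ t 1)
    (is_derive_fX n (is_derive_onem_sqr t)))).
  by rewrite -[cst _ t]/(- n.+1%:R^-1); field.
rewrite (Rintegral_FTC ler01 dF).
  by rewrite expr1n subrr expr0n/= mulr0 sub0r expr0n subr0 expr1n mulr1 opprK.
move=> t _; apply: continuous_fM; last exact: continuous_onem_sqrX.
by apply: continuous_fM; [exact: cst_continuous|exact: cvg_id].
Qed.

(** Integration by parts: the derivative 1 / (1 + v) of the logarithm cancels a factor of 1 - v^2
    and leaves (1 - v) (1 - v^2)^n. The boundary terms vanish, at 0 because ln 1 = 0 and at 1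
    because of 1 - v^2. *)
Lemma Rintegral_ln_onem_sqr n :
  \int[mu]_(v in `[0, 1]) (ln (1 + v) * (2 * v * (1 - v ^+ 2) ^+ n))
    = (onem_sqr_int n - (2 * n.+1%:R)^-1) / n.+1%:R.
Proof.
have n0 : n.+1%:R != 0 :> R by rewrite pnatr_eq0.
pose f (v : R) := ln (1 + v) * (2 * v * (1 - v ^+ 2) ^+ n).
pose g (v : R) := (1 - v ^+ 2) ^+ n.
pose h (v : R) := 2 * v * (1 - v ^+ 2) ^+ n.
have dln (t : R) : 0 <= t <= 1 -> is_derive t 1 (fun t => ln (1 + t)) (1 + t)^-1.
  move=> /andP[t0 _]; have dt : is_derive t 1 (fun t : R => 1 + t) 1.
    have h1 : is_derive t 1 (fun=> 1 : R) 0 by exact: is_derive_cst.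
    by apply: (is_derive_eq (is_deriveD h1 (is_derive_id t 1))); rewrite add0r.
  have t1 : 0 < 1 + t by lra.
  have := @is_derive1_comp _ (@ln R) (fun t => 1 + t) t _ _ (is_derive1_ln t1) dt.
  by rewrite mulr1.
have ch (t : R) : {for t, continuous h}.
  apply: continuous_fM; last exact: continuous_onem_sqrX.
  by apply: continuous_fM; [exact: cst_continuous|exact: cvg_id].
have cf (t : R) : 0 <= t <= 1 -> {for t, continuous f}.
  move=> /dln /is_derive_continuous cl.
  by apply: continuous_fM; [exact: cl|exact: ch].
have cg (t : R) : {for t, continuous g} by exact: continuous_onem_sqrX.
pose gh (v : R) := 1 * g v - 2^-1 * h v.
have cgh (t : R) : {for t, continuous gh}.
  by apply: continuous_lin_comb; [exact: cg|exact: ch].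
have dF (t : R) : 0 <= t <= 1 ->
    is_derive t 1 (fun t => - (1 : R) * (ln (1 + t) * (1 - t ^+ 2) ^+ n.+1))
      (n.+1%:R * f t - 1 * gh t).
  move=> t01; apply: (is_derive_eq (is_derive_fM (is_derive_cst _ t 1)
    (is_derive_fM (dln _ t01) (is_derive_fX n (is_derive_onem_sqr t))))).
  rewrite /f /gh /g /h exprS -[cst _ t]/(- (1 : R)); field.
  by rewrite gt_eqF//; case/andP: t01; lra.
have /(Rintegral_FTC ler01 dF) : forall t : R, 0 <= t <= 1 ->
    {for t, continuous (fun t => n.+1%:R * f t - 1 * gh t)}.
  by move=> t t01; apply: continuous_lin_comb; [exact: cf|exact: cgh].
rewrite Rintegral_lin_comb// (@Rintegral_lin_comb g h)//.
rewrite Rintegral_onem_sqr_moment -/(onem_sqr_int n).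
rewrite expr1n subrr exprS !mul0r mulr0 addr0 ln1 mul0r mulr0 subr0 => E.
apply: (mulfI n0); rewrite [RHS]mulrC divfK// -/f.
have -> : (2 * n.+1%:R)^-1 = 2^-1 * n.+1%:R^-1 :> R by rewrite invfM.
by move/eqP : E; rewrite !mul1r subr_eq0 => /eqP.
Qed.

End one_dimensional_integrals.

(** * Densities, images and products of measures *)

Section density.
Local Open Scope ereal_scope.
Context d (T : measurableType d) (R : realType).
Variables (mu nu : {measure set T -> \bar R}) (h : T -> R).
Hypotheses (mh : measurable_fun setT h) (h0 : forall x, (0 <= h x)%R).
Hypothesis nuE : forall A, measurable A -> nu A = \int[mu]_(x in A) (h x)%:E.

Import HBNNSimple.

Let mhE : measurable_fun setT (EFin \o h). Proof. exact/measurable_EFinP. Qed.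

Let integral_density_indic E : measurable E ->
  \int[nu]_x (\1_E x)%:E = \int[mu]_x ((\1_E x)%:E * (h x)%:E).
Proof.
move=> mE; rewrite integral_indic// setIT nuE// integral_mkcond.
apply: eq_integral => x _; rewrite patchE indicE.
by case: (x \in E); rewrite ?mul1e ?mul0e.
Qed.

Let integral_density_nnsfun (f : {nnsfun T >-> R}) :
  \int[nu]_x (f x)%:E = \int[mu]_x ((f x)%:E * (h x)%:E).
Proof.
under [LHS]eq_integral do rewrite fimfunE -fsumEFin//.
rewrite [LHS]ge0_integral_fsum//; last 2 first.
  - by move=> r; exact/measurable_EFinP/measurableT_comp.
  - by move=> n x _; rewrite EFinM nnfun_muleindic_ge0.
under [RHS]eq_integral.
  move=> x xD; rewrite fimfunE -fsumEFin// ge0_mule_fsuml; last first.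
    by move=> r; rewrite EFinM nnfun_muleindic_ge0.
  over.
rewrite [RHS]ge0_integral_fsum//; last 2 first.
  - move=> r; apply: emeasurable_funM => //.
    by apply/measurable_EFinP; apply/measurableT_comp.
  - by move=> n x _; rewrite EFinM mule_ge0 ?nnfun_muleindic_ge0 ?lee_fin.
apply: eq_fsbigr => r _.
rewrite integralZl_indic_nnsfun//= integral_density_indic//.
have [rneg|r0] := ltP r 0%R.
  rewrite preimage_nnfun0// (_ : \1_set0 = cst 0%R) ?indic0//.
  by rewrite !integral0_eq ?mule0// => x _; rewrite /= ?mulr0 !mul0e.
rewrite -ge0_integralZl//.
- by apply: eq_integral => x _; rewrite EFinM muleA.
- by apply: emeasurable_funM => //; apply/measurable_EFinP; exact: measurable_indic.
- by move=> x _; rewrite mule_ge0 ?lee_fin.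
Qed.

(** Linearity carries the identity from indicators to simple functions, monotone convergence to all
    nonnegative functions. *)
Lemma ge0_integral_density (f : T -> \bar R) :
  measurable_fun setT f -> (forall x, 0 <= f x) ->
  \int[nu]_x f x = \int[mu]_x (f x * (h x)%:E).
Proof.
move=> mf f0; pose f_ := nnsfun_approx measurableT mf.
have fcvg x : (f_ n x)%:E @[n --> \oo] --> f x by exact: cvg_nnsfun_approx.
transitivity (lim (\int[nu]_x (f_ n x)%:E @[n --> \oo])).
  rewrite -monotone_convergence//=.
  - by apply: eq_integral => x _; apply/esym/cvg_lim => //=.
  - by move=> n; exact/measurable_EFinP/measurable_funTS.
  - by move=> n x _; rewrite lee_fin.
  - by move=> x _ a b ab; rewrite lee_fin; exact/lefP/nd_nnsfun_approx.
under eq_fun do rewrite integral_density_nnsfun.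
rewrite -monotone_convergence//=.
- apply: eq_integral => x _; apply/cvg_lim => //=.
  by apply: cvgeZr => //; exact: fcvg.
- move=> n; apply: emeasurable_funM => //.
  exact/measurable_EFinP/measurable_funTS.
- by move=> n x _; rewrite mule_ge0 ?lee_fin.
- move=> x _ a b ab; rewrite lee_wpmul2r ?lee_fin//.
  exact/lefP/nd_nnsfun_approx.
Qed.

Lemma integrable_density (g : T -> R) : measurable_fun setT g ->
  mu.-integrable setT (fun x => (g x * h x)%:E) ->
  nu.-integrable setT (EFin \o g).
Proof.
move=> mg /integrableP[_ gi]; apply/integrableP; split.
  exact/measurable_EFinP.
rewrite ge0_integral_density//; last first.
  by apply: measurableT_comp => //; exact/measurable_EFinP.
apply: le_lt_trans gi; apply: ge0_le_integral => //.
- by move=> x _; rewrite mule_ge0 ?lee_fin.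
- apply: emeasurable_funM => //.
  by apply: measurableT_comp => //; exact/measurable_EFinP.
- apply: measurableT_comp => //; apply/measurable_EFinP.
  exact: measurable_funM.
- by move=> x _; rewrite EFinM abseM [`|(h x)%:E|]gee0_abs ?lee_fin.
Qed.

Lemma Rintegral_density (g : T -> R) : measurable_fun setT g ->
  mu.-integrable setT (fun x => (g x * h x)%:E) ->
  (\int[nu]_x g x = \int[mu]_x (g x * h x))%R.
Proof.
move=> mg gi; rewrite /Rintegral; congr fine.
have mgE : measurable_fun setT (EFin \o g) by exact/measurable_EFinP.
rewrite integralE [RHS]integralE; congr (_ - _).
  rewrite ge0_integral_density//; last exact: measurable_funepos.
  apply: eq_integral => x _; rewrite !funeposE EFinM.
  by rewrite maxe_pMl ?lee_fin// mul0e.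
rewrite ge0_integral_density//; last exact: measurable_funeneg.
apply: eq_integral => x _; rewrite !funenegE EFinM -mulNe.
by rewrite maxe_pMl ?lee_fin// mul0e.
Qed.

End density.

Section product_integral.
Context d1 d2 (T1 : measurableType d1) (T2 : measurableType d2) (R : realType).
Variables (m1 : {sigma_finite_measure set T1 -> \bar R}).
Variables (m2 : {sigma_finite_measure set T2 -> \bar R}).
Variables (f : T1 -> R) (g : T2 -> R).
Hypotheses (fi : m1.-integrable setT (EFin \o f)).
Hypotheses (gi : m2.-integrable setT (EFin \o g)).

Let mfg : measurable_fun setT (fun p : T1 * T2 => f p.1 * g p.2).
Proof.
have mf : measurable_fun setT f by exact/measurable_EFinP/(measurable_int _ fi).
have mg : measurable_fun setT g by exact/measurable_EFinP/(measurable_int _ gi).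
by apply: measurable_funM; [exact: (measurableT_comp mf)|exact: (measurableT_comp mg)].
Qed.

Lemma integrable_prodM :
  (m1 \x m2)%E.-integrable setT (fun p => (f p.1 * g p.2)%:E).
Proof.
apply/integrable12ltyP; first exact/measurable_EFinP.
have /integrableP[mf flty] := fi; have /integrableP[mg glty] := gi.
have E x : (\int[m2]_y `|(f x * g y)%:E| = `|(f x)%:E| * \int[m2]_y `|(g y)%:E|)%E.
  rewrite -ge0_integralZl//; last exact: measurableT_comp.
  by apply: eq_integral => y _; rewrite EFinM abseM.
under eq_integral => x _ do rewrite /= E.
rewrite ge0_integralZr//; last 2 first.
- exact: measurableT_comp.
- exact: integral_ge0.
by rewrite lte_mul_pinfty// ?integral_ge0// ge0_fin_numE// integral_ge0.
Qed.

Lemma Rintegral_prodM : \int[(m1 \x m2)%E]_p (f p.1 * g p.2)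
  = (\int[m1]_x f x) * (\int[m2]_y g y).
Proof.
rewrite /Rintegral -integral12_prod_meas1; last exact: integrable_prodM.
have gfin : (\int[m2]_y (g y)%:E)%E \is a fin_num by exact: integrable_fin_num.
have E x : (\int[m2]_y (f x * g y)%:E = (f x)%:E * \int[m2]_y (g y)%:E)%E.
  by rewrite -integralZl//; apply: eq_integral => y _; rewrite EFinM.
transitivity (fine (\int[m1]_x ((f x)%:E * (\int[m2]_y (g y)%:E)))%E).
  by congr fine; apply: eq_integral => x _; exact: E.
by rewrite -(fineK gfin) integralZr//= fineM// integrable_fin_num.
Qed.

End product_integral.

(** * Integration against an image measure known by its values on measurable sets *)

Section image_measure.
Context d1 d2 (T1 : measurableType d1) (T2 : measurableType d2) (R : realType).
Variables (mu : {measure set T1 -> \bar R}) (nu : {measure set T2 -> \bar R}).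
Variable phi : T1 -> T2.
Hypothesis mphi : measurable_fun setT phi.
Hypothesis nuE : forall A, measurable A -> nu A = mu (phi @^-1` A).

Let phi_mixin := isMeasurableFun.Build _ _ _ _ _ mphi.
Let phi_mfun : {mfun _ >-> _} := HB.pack phi phi_mixin.

Lemma ge0_integral_image (f : T2 -> \bar R) :
  measurable_fun setT f -> (forall x, 0 <= f x)%E ->
  (\int[nu]_x f x = \int[mu]_x f (phi x))%E.
Proof.
move=> mf f0; rewrite -[RHS](@ge0_integral_pushforward _ _ _ _ _ phi mphi mu setT)//.
by apply: (eq_measure_integral (pushforward mu phi_mfun)) => A mA _; exact: nuE.
Qed.

Lemma integrable_image (f : T2 -> R) : measurable_fun setT f ->
  mu.-integrable setT (EFin \o (f \o phi)) -> nu.-integrable setT (EFin \o f).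
Proof.
move=> mf /integrableP[_ fi]; apply/integrableP; split; first exact/measurable_EFinP.
rewrite ge0_integral_image//.
by apply: measurableT_comp => //; exact/measurable_EFinP.
Qed.

Lemma Rintegral_image (f : T2 -> R) : measurable_fun setT f ->
  mu.-integrable setT (EFin \o (f \o phi)) ->
  \int[nu]_x f x = \int[mu]_x f (phi x).
Proof.
move=> mf fi; rewrite /Rintegral; congr fine.
have mfE : measurable_fun setT (EFin \o f) by exact/measurable_EFinP.
rewrite -[RHS](@integral_pushforward _ _ _ _ _ phi mphi mu setT _ mfE)//.
by apply: (eq_measure_integral (pushforward mu phi_mfun)) => A mA _; exact: nuE.
Qed.

End image_measure.

Lemma bounded_integrable d (T : measurableType d) (R : realType)
    (m : {finite_measure set T -> \bar R}) (f : T -> R) (K : R) :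
  measurable_fun setT f -> (forall x, `|f x| <= K) ->
  m.-integrable setT (EFin \o f).
Proof.
move=> mf fK; apply: measurable_bounded_integrable => //.
  by have := @fin_num_measure _ _ _ m setT measurableT; rewrite ge0_fin_numE.
exists K; split; first exact: num_real.
by move=> x Kx y _ /=; rewrite (le_trans (fK y))// ltW.
Qed.

(** * Product measures on tuples *)

Section tuple_measure_theory.
Context d (T : measurableType d) (R : realType).
Variable mu : {finite_measure set T -> \bar R}.
Local Notation TM n := (@tuple_measure _ T R mu n).

Definition tcons n (p : T * n.-tuple T) : n.+1.-tuple T := [tuple of p.1 :: p.2].

Lemma measurable_tcons n : measurable_fun setT (@tcons n).
Proof. exact: (measurable_cons measurable_fst measurable_snd). Qed.

Lemma tuple_measureS n A : TM n.+1 A = (mu \x TM n)%E (@tcons n @^-1` A).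
Proof.
by rewrite /= /product_measure1; apply: eq_integral => x _ /=; rewrite xsectionE.
Qed.

Lemma Rintegral_tupleS n (f : n.+1.-tuple T -> R) : measurable_fun setT f ->
  (mu \x TM n)%E.-integrable setT (fun p => (f (tcons p))%:E) ->
  \int[TM n.+1]_x f x = \int[(mu \x TM n)%E]_p f (tcons p).
Proof.
apply: Rintegral_image; first exact: measurable_tcons.
by move=> A _; exact: tuple_measureS.
Qed.

End tuple_measure_theory.

(** Images commute with products, by comparing sections. This trades the r-fold surface measure for
    the r-fold measure of the coordinates, on which the spinors below are functions. *)
Lemma tuple_measure_pushforward d d' (T : measurableType d)
    (T' : measurableType d') (R : realType)
    (mu : {finite_measure set T -> \bar R})
    (mu' : {finite_measure set T' -> \bar R}) (s : T -> T') :
  measurable_fun setT s -> (forall A, measurable A -> mu' A = mu (s @^-1` A)) ->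
  forall n (A : set (n.-tuple T')), measurable A ->
    tuple_measure mu' A = tuple_measure mu ((map_tuple s : n.-tuple T -> _) @^-1` A).
Proof.
move=> ms mu'E; elim=> [|n IH] A mA.
  rewrite /= /dirac !indicE; congr (_%:R%:E); congr (nat_of_bool _).
  apply/idP/idP; rewrite !inE /=.
  by rewrite (tuple0 (map_tuple s _)).
  by rewrite (tuple0 (map_tuple s _)).
have mA' : measurable (@tcons _ T' n @^-1` A).
  by rewrite -[X in measurable X]setTI; exact: measurable_tcons.
transitivity (\int[mu']_y tuple_measure mu' (xsection (@tcons _ T' n @^-1` A) y))%E.
  by apply: eq_integral => x _ /=; rewrite xsectionE.
rewrite (ge0_integral_image ms mu'E)//; last exact: measurable_fun_xsection.
apply: eq_integral => x _ /=; rewrite IH; last exact: measurable_xsection.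
congr (tuple_measure mu _); apply/funext => t /=.
rewrite xsectionE /tcons /=; congr (A _); exact/val_inj.
Qed.

(** * Integrals of bounded measurable complex functions *)

Section complex_integral.
Local Open Scope complex_scope.
Context d (T : measurableType d) (R : realType).
Implicit Types (f g : T -> R[i]) (m : {measure set T -> \bar R}).

(** Boundedness, unlike integrability, is stable under products; for finite measures it makes the
    integrability of all the expanded determinants automatic. *)
Definition bmeas f := [/\ measurable_fun setT (fun x => complex.Re (f x)),
  measurable_fun setT (fun x => complex.Im (f x)) &
  exists K, forall x, csq (f x) <= K].

Definition cint m f : R[i] :=
  (\int[m]_x complex.Re (f x)) +i* (\int[m]_x complex.Im (f x)).

Lemma bmeas_cst (c : R[i]) : bmeas (fun=> c).
Proof. by split; [exact: measurable_cst|exact: measurable_cst|exists (csq c)]. Qed.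

Lemma bmeasD f g : bmeas f -> bmeas g -> bmeas (fun x => f x + g x).
Proof.
move=> [f1 f2 [K fK]] [g1 g2 [L gL]]; split.
- rewrite (_ : (fun x => _) = fun x => complex.Re (f x) + complex.Re (g x)).
    exact: measurable_funD.
  by apply/funext => x; case: (f x) (g x) => ? ? [].
- rewrite (_ : (fun x => _) = fun x => complex.Im (f x) + complex.Im (g x)).
    exact: measurable_funD.
  by apply/funext => x; case: (f x) (g x) => ? ? [].
- exists (2 * K + 2 * L) => x; have := fK x; have := gL x.
  case: (f x) (g x) => a b [c e]; rewrite /csq /= => h1 h2.
  have := sqr_ge0 (a - c); have := sqr_ge0 (b - e); lra.
Qed.

Lemma bmeasM f g : bmeas f -> bmeas g -> bmeas (fun x => f x * g x).
Proof.
move=> [f1 f2 [K fK]] [g1 g2 [L gL]]; split.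
- rewrite (_ : (fun x => _) = fun x =>
      complex.Re (f x) * complex.Re (g x) - complex.Im (f x) * complex.Im (g x)).
    by apply: measurable_funB; apply: measurable_funM.
  by apply/funext => x; case: (f x) (g x) => ? ? [].
- rewrite (_ : (fun x => _) = fun x =>
      complex.Re (f x) * complex.Im (g x) + complex.Im (f x) * complex.Re (g x)).
    by apply: measurable_funD; apply: measurable_funM.
  by apply/funext => x; case: (f x) (g x) => ? ? [].
- by exists (K * L) => x; rewrite csqM ler_pM ?csq_ge0.
Qed.

Lemma bmeas_conj f : bmeas f -> bmeas (fun x => conjc (f x)).
Proof.
move=> [f1 f2 [K fK]]; split.
- rewrite (_ : (fun x => _) = fun x => complex.Re (f x))//.
  by apply/funext => x; case: (f x).
- rewrite (_ : (fun x => _) = fun x => - complex.Im (f x)).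
    exact: measurable_funN.
  by apply/funext => x; case: (f x).
- by exists K => x; apply: le_trans (fK x); case: (f x) => a b; rewrite /csq /= sqrrN.
Qed.

Lemma bmeas_sum I (s : seq I) (P : pred I) (F : I -> T -> R[i]) :
  (forall i, P i -> bmeas (F i)) -> bmeas (fun x => \sum_(i <- s | P i) F i x).
Proof.
move=> FP; elim: s => [|h t IH].
  by under eq_fun do rewrite big_nil; exact: bmeas_cst.
under eq_fun do rewrite big_cons; case: (P h) (FP h) => // /(_ isT) Fh.
exact: bmeasD.
Qed.

Lemma bmeas_prod I (s : seq I) (P : pred I) (F : I -> T -> R[i]) :
  (forall i, P i -> bmeas (F i)) -> bmeas (fun x => \prod_(i <- s | P i) F i x).
Proof.
move=> FP; elim: s => [|h t IH].
  by under eq_fun do rewrite big_nil; exact: bmeas_cst.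
under eq_fun do rewrite big_cons; case: (P h) (FP h) => // /(_ isT) Fh.
exact: bmeasM.
Qed.

Lemma bmeasX f n : bmeas f -> bmeas (fun x => f x ^+ n).
Proof.
move=> bf; elim: n => [|n IH].
  by under eq_fun do rewrite expr0; exact: bmeas_cst.
by under eq_fun do rewrite exprS; exact: bmeasM.
Qed.

Lemma bmeas_ReIm f : bmeas f -> exists K,
  (forall x, `|complex.Re (f x)| <= K) /\ (forall x, `|complex.Im (f x)| <= K).
Proof.
move=> [_ _ [K fK]]; exists (1 + K); split=> x; have := fK x.
all: case: (f x) => a b; rewrite /csq /= => h; rewrite ler_norml.
  by apply/andP; split; have := sqr_ge0 (a - 1); have := sqr_ge0 (a + 1);
    have := sqr_ge0 a; have := sqr_ge0 b; lra.
by apply/andP; split; have := sqr_ge0 (b - 1); have := sqr_ge0 (b + 1);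
  have := sqr_ge0 a; have := sqr_ge0 b; lra.
Qed.

Section finite_measure.
Variable m : {finite_measure set T -> \bar R}.

Lemma bmeas_integrable f : bmeas f ->
  m.-integrable setT (EFin \o (fun x => complex.Re (f x))) /\
  m.-integrable setT (EFin \o (fun x => complex.Im (f x))).
Proof.
move=> bf; have [K [f1 f2]] := bmeas_ReIm bf; case: bf => mf1 mf2 _.
by split; apply: bounded_integrable; eassumption.
Qed.

Lemma cintD f g : bmeas f -> bmeas g ->
  cint m (fun x => f x + g x) = cint m f + cint m g.
Proof.
move=> /bmeas_integrable[f1 f2] /bmeas_integrable[g1 g2].
apply/eqP; rewrite eq_complex /cint /= -!RintegralD//; apply/andP; split; apply/eqP.
  by apply: eq_Rintegral => x _; case: (f x) (g x) => ? ? [].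
by apply: eq_Rintegral => x _; case: (f x) (g x) => ? ? [].
Qed.

Lemma cintZ (c : R[i]) f : bmeas f -> cint m (fun x => c * f x) = c * cint m f.
Proof.
move=> /bmeas_integrable[f1 f2].
have Z k (h : T -> R) : m.-integrable setT (EFin \o h) ->
    m.-integrable setT (EFin \o fun t => k * h t).
  by move=> hi; have := @integrableZl _ _ _ m setT measurableT k _ hi; apply.
apply/eqP; rewrite eq_complex /cint; case: c => a b /=.
rewrite -!RintegralZl// -RintegralB//; [|exact: Z..].
rewrite -RintegralD//; [|exact: Z..].
apply/andP; split; apply/eqP; apply: eq_Rintegral => x _.
  by case: (f x).
by case: (f x).
Qed.

Lemma cint0 : cint m (fun=> 0) = 0.
Proof. by rewrite /cint /= !Rintegral_cst// !mul0r. Qed.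

Lemma cint_sum I (s : seq I) (P : pred I) (F : I -> T -> R[i]) :
  (forall i, P i -> bmeas (F i)) ->
  cint m (fun x => \sum_(i <- s | P i) F i x) = \sum_(i <- s | P i) cint m (F i).
Proof.
move=> FP; elim: s => [|h t IH].
  by under eq_fun do rewrite big_nil; rewrite cint0 big_nil.
under eq_fun do rewrite big_cons; rewrite big_cons.
case: (P h) (FP h) => // /(_ isT) Fh.
rewrite cintD ?IH//.
by apply: bmeas_sum => i Pi; exact: FP.
Qed.

Lemma cint_real (h : T -> R) : cint m (fun x => (h x)%:C) = (\int[m]_x h x)%:C.
Proof. by rewrite /cint /= Rintegral_cst// mul0r. Qed.

End finite_measure.
End complex_integral.

Lemma bmeas_comp d1 d2 (T1 : measurableType d1) (T2 : measurableType d2)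
    (R : realType) (h : T1 -> T2) (f : T2 -> R[i]) :
  measurable_fun setT h -> bmeas f -> bmeas (fun x => f (h x)).
Proof.
move=> mh [f1 f2 [K fK]]; split; last by exists K => x.
  exact: (measurableT_comp f1 mh).
exact: (measurableT_comp f2 mh).
Qed.

Section product_cint.
Context d1 d2 (T1 : measurableType d1) (T2 : measurableType d2) (R : realType).
Variables (m1 : {finite_measure set T1 -> \bar R}).
Variables (m2 : {finite_measure set T2 -> \bar R}).
Variables (f : T1 -> R[i]) (g : T2 -> R[i]).
Hypotheses (bf : bmeas f) (bg : bmeas g).

Let integrable_prod (u : R[i] -> R) (v : R[i] -> R) :
  m1.-integrable setT (EFin \o (fun x => u (f x))) ->
  m2.-integrable setT (EFin \o (fun x => v (g x))) ->
  (m1 \x m2)%E.-integrable setT (EFin \o fun p => u (f p.1) * v (g p.2)).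
Proof. exact: integrable_prodM. Qed.

Lemma cprodM_integrable :
  (m1 \x m2)%E.-integrable setT (EFin \o fun p => complex.Re (f p.1 * g p.2)) /\
  (m1 \x m2)%E.-integrable setT (EFin \o fun p => complex.Im (f p.1 * g p.2)).
Proof.
have [f1 f2] := bmeas_integrable m1 bf; have [g1 g2] := bmeas_integrable m2 bg.
split.
  have := integrableB measurableT (integrable_prod f1 g1) (integrable_prod f2 g2).
  apply: eq_integrable => // p _ /=.
  by rewrite -EFinB; case: (f p.1) (g p.2) => ? ? [].
have := integrableD measurableT (integrable_prod f1 g2) (integrable_prod f2 g1).
apply: eq_integrable => // p _ /=.
by rewrite -EFinD; case: (f p.1) (g p.2) => ? ? [].
Qed.

Lemma cint_prodM :
  cint (m1 \x m2)%E (fun p => f p.1 * g p.2) = cint m1 f * cint m2 g.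
Proof.
have [f1 f2] := bmeas_integrable m1 bf; have [g1 g2] := bmeas_integrable m2 bg.
apply/eqP; rewrite eq_complex /cint /= -!Rintegral_prodM//.
rewrite -RintegralB ?integrable_prod// -RintegralD ?integrable_prod//.
apply/andP; split; apply/eqP; apply: eq_Rintegral => x _.
  by case: (f x.1) (g x.2) => ? ? [].
by case: (f x.1) (g x.2) => ? ? [].
Qed.

End product_cint.

Lemma cint_tuple d (T : measurableType d) (R : realType)
    (mu : {finite_measure set T -> \bar R}) n (f : 'I_n -> T -> R[i]) :
  (forall i, bmeas (f i)) ->
  cint (tuple_measure mu (n:=n)) (fun t => \prod_(i < n) f i (tnth t i))
    = \prod_(i < n) cint mu (f i).
Proof.
elim: n f => [|n IH] f bf.
  under eq_fun do rewrite big_ord0; rewrite big_ord0.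
  rewrite /cint /= !Rintegral_cst//= /dirac indicE in_setT mul1r mul0r.
  by [].
rewrite big_ord_recl -(IH (fun i => f (lift ord0 i)))//.
have bt k (F : 'I_k -> T -> R[i]) : (forall i, bmeas (F i)) ->
    bmeas (fun t : k.-tuple T => \prod_(i < k) F i (tnth t i)).
  move=> bF; apply: bmeas_prod => i _; apply: bmeas_comp => //.
  exact: measurable_tnth.
have bf1 : bmeas (fun p : T * n.-tuple T =>
    f ord0 p.1 * \prod_(i < n) f (lift ord0 i) (tnth p.2 i)).
  apply: bmeasM; first exact: (bmeas_comp measurable_fst).
  have := bt n (fun i => f (lift ord0 i)) (fun i => bf _).
  exact: (bmeas_comp measurable_snd).
rewrite -cint_prodM//; last by apply: (bt n (fun i => f (lift ord0 i))).
have E p : \prod_(i < n.+1) f i (tnth (tcons p) i)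
    = f ord0 p.1 * \prod_(i < n) f (lift ord0 i) (tnth p.2 i).
  rewrite big_ord_recl tnth0; congr (_ * _).
  by apply: eq_bigr => i _; rewrite tnthS.
have [b1 b2 _] := bt _ _ bf.
have [i1 i2] := cprodM_integrable mu (tuple_measure mu (n:=n)) (bf ord0)
  (bt n (fun i => f (lift ord0 i)) (fun i => bf _)).
congr Complex.
  rewrite Rintegral_tupleS//; first by apply: eq_Rintegral => p _; rewrite E.
  by under eq_fun do rewrite E.
rewrite Rintegral_tupleS//; first by apply: eq_Rintegral => p _; rewrite E.
by under eq_fun do rewrite E.
Qed.

(** * Spinors *)

Section density_measure.
Local Open Scope ereal_scope.
Context d (T : measurableType d) (R : realType).
Variables (mu : {measure set T -> \bar R}) (h : T -> R).

(** The proofs of positivity and integrability are arguments so that a finite measure structure can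
    be attached to the constant itself. *)
Definition density_measure (_ : forall x, (0 <= h x)%R)
    (_ : mu.-integrable setT (EFin \o h)) (A : set T) : \bar R :=
  \int[mu]_(x in A) (h x)%:E.

Hypotheses (h0 : forall x, (0 <= h x)%R) (hi : mu.-integrable setT (EFin \o h)).
Local Notation nu := (density_measure h0 hi).

Let mh : measurable_fun setT (EFin \o h). Proof. exact: measurable_int hi. Qed.

Let density_measure0 : nu set0 = 0.
Proof. exact: integral_set0. Qed.

Let density_measure_ge0 A : 0 <= nu A.
Proof. by apply: integral_ge0 => x _; rewrite lee_fin. Qed.

Let density_measure_sigma_additive : semi_sigma_additive nu.
Proof.
move=> F mF tF mUF; rewrite /density_measure; apply: cvg_toP.
  apply: ereal_nondecreasing_is_cvgn => m n mn.
  by apply: lee_sum_nneg_natr => // k _ _; exact: density_measure_ge0.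
rewrite ge0_integral_bigcup//=.
  exact: measurable_funTS.
by move=> x _; rewrite lee_fin.
Qed.

HB.instance Definition _ := isMeasure.Build _ _ _ nu
  density_measure0 density_measure_ge0 density_measure_sigma_additive.

Let density_measure_fin : fin_num_fun nu.
Proof.
move=> A mA; apply: integrable_fin_num => //.
exact: integrableS hi.
Qed.

HB.instance Definition _ := Measure_isFinite.Build _ _ _ nu density_measure_fin.

End density_measure.

(** * The area element in spherical coordinates *)

Section angle_measure.
Context {R : realType}.
Local Notation mu := (@lebesgue_measure R).

Let jac1 (t : R) : R := sin t * \1_`[0, pi] t.
Let jac2 (t : R) : R := \1_`[0, 2 * pi] t.

Let sph_jacobianE (x : R * R) : sph_jacobian x = jac1 x.1 * jac2 x.2.
Proof.
rewrite /sph_jacobian /jac1 /jac2 !indicE !mem_setE/= !in_itv/=.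
by case: (0 <= x.1); case: (x.1 <= pi); case: (0 <= x.2); case: (x.2 <= _);
  rewrite /= ?mulr1 ?mulr0.
Qed.

Let patch_integrable (f : R -> R) (a b : R) : continuous f ->
  mu.-integrable setT (EFin \o fun t => f t * \1_`[a, b] t).
Proof.
move=> cf; have := @continuous_itv_integrable R f a b (fun x _ => cf x).
rewrite integrable_mkcond//; apply: eq_integrable => // x _ /=.
by rewrite patchE indicE; case: ifP; rewrite ?mulr1 ?mulr0.
Qed.

Let Rintegral_patch (f : R -> R) (a b : R) :
  \int[mu]_t (f t * \1_`[a, b] t) = \int[mu]_(t in `[a, b]) f t.
Proof.
rewrite [RHS]Rintegral_mkcond; apply: eq_Rintegral => x _.
by rewrite patchE indicE; case: ifP; rewrite ?mulr1 ?mulr0.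
Qed.

Lemma integrable_sph_jacobian :
  (mu \x mu)%E.-integrable setT (EFin \o @sph_jacobian R).
Proof.
have i1 : mu.-integrable setT (EFin \o jac1) := patch_integrable 0 pi (@continuous_sin R).
have i2 : mu.-integrable setT (EFin \o jac2).
  have := @patch_integrable (fun=> 1) 0 (2 * pi) (fun x => @cst_continuous _ _ _ x).
  by apply: eq_integrable => // t _ /=; rewrite mul1r.
have := integrable_prodM i1 i2; apply: eq_integrable => // x _ /=.
by rewrite sph_jacobianE.
Qed.

(** The measure on coordinates of which [surface_measure] is the image. Integrals are taken here
    because the spinors carry a phase that is a function of the coordinates and not of the point at
    the poles. *)
Definition angle_measure := @density_measure _ _ R (mu \x mu)%E (@sph_jacobian R)
  (@sph_jacobian_ge0 R) integrable_sph_jacobian.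

HB.instance Definition _ := FiniteMeasure.on angle_measure.

Lemma surface_measureE (A : set (3.-tuple R)) :
  surface_measure A = angle_measure (sph_coord @^-1` A).
Proof. by []. Qed.

Lemma Rintegral_angle (f g : R -> R) K : continuous f -> continuous g ->
  (forall x, `|f x| <= K) -> (forall x, `|g x| <= K) ->
  \int[angle_measure]_x (f x.1 * g x.2)
    = (\int[mu]_(t in `[0, pi]) (f t * sin t)) * (\int[mu]_(t in `[0, 2 * pi]) g t).
Proof.
move=> cf cg fK gK.
pose f1 t := (f t * sin t) * \1_`[0, pi] t; pose g1 t := g t * \1_`[0, 2 * pi] t.
have i1 : mu.-integrable setT (EFin \o f1).
  by apply: patch_integrable => t; apply: continuousM; [exact: cf|exact: continuous_sin].
have i2 : mu.-integrable setT (EFin \o g1) by exact: patch_integrable.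
have E x : f x.1 * g x.2 * sph_jacobian x = f1 x.1 * g1 x.2.
  by rewrite sph_jacobianE /f1 /g1 /jac1 /jac2; ring.
rewrite -Rintegral_patch -[X in _ = _ * X]Rintegral_patch -Rintegral_prodM//.
rewrite (@Rintegral_density _ _ _ (mu \x mu)%E _ sph_jacobian)//.
- by apply: eq_Rintegral => x _; rewrite E.
- exact: measurable_sph_jacobian.
- exact: sph_jacobian_ge0.
- by apply: measurable_funM; apply: measurableT_comp => //;
    exact: continuous_measurable_fun.
- by have := integrable_prodM i1 i2; apply: eq_integrable => // x _ /=; rewrite E.
Qed.

End angle_measure.

Section spinors.
Local Open Scope complex_scope.
Context {R : realType}.
Local Notation mu := (@lebesgue_measure R).
Implicit Types x y : R * R.

(* A unit vector of C^2 over the point of the sphere with coordinates x. *)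
Definition spin1 x : R[i] := (cos (x.1 / 2))%:C.
Definition spin2 x : R[i] := (sin (x.1 / 2))%:C * cis x.2.

(** The Hermitian product and the determinant of two spinors; w is the squared modulus of the
    former. *)
Definition spin_dot x y := spin1 x * conjc (spin1 y) + spin2 x * conjc (spin2 y).
Definition spin_wedge x y := spin1 x * spin2 y - spin1 y * spin2 x.

Lemma csq_spin x : csq (spin1 x) + csq (spin2 x) = 1.
Proof. by rewrite csqM csq_cis !csq_real mulr1 cos2Dsin2. Qed.

(** Lagrange's identity for two unit vectors. *)
Lemma csq_spin_dot x y : csq (spin_dot x y) = 1 - csq (spin_wedge x y).
Proof.
rewrite -[1](mulr1 1) -{1}(csq_spin x) -(csq_spin y) /spin_dot /spin_wedge.
case: (spin1 x) (spin2 x) (spin1 y) (spin2 y) => a b [a' b'] [c e] [c' e'].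
by rewrite /csq /=; ring.
Qed.

Lemma cos_half (t : R) : cos t = cos (t / 2) ^+ 2 - sin (t / 2) ^+ 2.
Proof.
have h : t = t / 2 + t / 2 by field.
by rewrite [in LHS]h cosD !expr2.
Qed.

Lemma sin_half (t : R) : sin t = 2 * cos (t / 2) * sin (t / 2).
Proof.
have h : t = t / 2 + t / 2 by field.
by rewrite [in LHS]h sinD; ring.
Qed.

(** A factor of the weight of the ensemble is thus the squared modulus of a two by two determinant,
    which is what a homogeneous Vandermonde determinant is made of. *)
Lemma edist_sph_coord x y :
  Defs.edist (sph_coord x) (sph_coord y) ^+ 2 = 4 * csq (spin_wedge x y).
Proof.
rewrite sqr_sqrtr; last by apply: sumr_ge0 => i _; exact: sqr_ge0.
rewrite !big_ord_recl big_ord0 !(tnth_nth 0) /=.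
rewrite !(cos_half x.1) !(cos_half y.1) !(sin_half x.1) !(sin_half y.1).
rewrite /spin_wedge /spin1 /spin2 /cis /csq /=.
have := cos2Dsin2 (x.1 / 2); have := cos2Dsin2 (y.1 / 2).
have := cos2Dsin2 x.2; have := cos2Dsin2 y.2.
set c1 := cos (x.1 / 2); set s1 := sin (x.1 / 2).
set c2 := cos (y.1 / 2); set s2 := sin (y.1 / 2).
set C1 := cos x.2; set S1 := sin x.2; set C2 := cos y.2; set S2 := sin y.2.
move=> h1 h2 h3 h4.
have e1 : C2 ^+ 2 = 1 - S2 ^+ 2 by rewrite -h1; ring.
have e2 : C1 ^+ 2 = 1 - S1 ^+ 2 by rewrite -h2; ring.
have e3 : c2 ^+ 2 = 1 - s2 ^+ 2 by rewrite -h3; ring.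
have e4 : c1 ^+ 2 = 1 - s1 ^+ 2 by rewrite -h4; ring.
ring: e1 e2 e3 e4.
Qed.

Lemma usphere_sph_coord x : usphere (sph_coord x).
Proof.
rewrite /usphere /= !big_ord_recl big_ord0 !(tnth_nth 0) /=.
have e1 : sin x.1 ^+ 2 = 1 - cos x.1 ^+ 2 by rewrite -(cos2Dsin2 x.1); ring.
have e2 : sin x.2 ^+ 2 = 1 - cos x.2 ^+ 2 by rewrite -(cos2Dsin2 x.2); ring.
ring: e1 e2.
Qed.

Definition spin_mono n l x := spin1 x ^+ l * spin2 x ^+ (n - l).

Let continuous_half (f : R -> R) : continuous f -> continuous (fun t : R => f (t / 2)).
Proof.
move=> cf t; apply: continuous_comp; last exact: cf.
by apply: continuous_fM; [exact: cvg_id|exact: cst_continuous].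
Qed.

Let continuousX (f : R -> R) n : continuous f -> continuous (fun t : R => f t ^+ n).
Proof.
move=> cf t; elim: n => [|n IH]; first exact: cst_continuous.
have -> : (fun t => f t ^+ n.+1) = (fun t => f t * f t ^+ n).
  by apply/funext => u; rewrite exprS.
exact: (@continuous_fM _ f (fun t => f t ^+ n) t (cf t) IH).
Qed.

Lemma bmeas_spin1 : bmeas (spin1 : measurableTypeR R * measurableTypeR R -> R[i]).
Proof.
split; [|exact: measurable_cst|].
- have := continuous_measurable_fun (continuous_half (@continuous_cos R)) => h.
  exact: (measurableT_comp h).
- by exists 1 => x; rewrite -(csq_spin x) lerDl csq_ge0.
Qed.

Lemma bmeas_spin2 : bmeas (spin2 : measurableTypeR R * measurableTypeR R -> R[i]).
Proof.
have hs := continuous_measurable_fun (continuous_half (@continuous_sin R)).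
have mc := continuous_measurable_fun (@continuous_cos R).
have ms := continuous_measurable_fun (@continuous_sin R).
split.
- rewrite (_ : (fun x => _) = fun x => sin (x.1 / 2) * cos x.2).
    by apply: measurable_funM; [exact: (measurableT_comp hs)|exact: (measurableT_comp mc)].
  by apply/funext => x; rewrite /= mul0r subr0.
- rewrite (_ : (fun x => _) = fun x => sin (x.1 / 2) * sin x.2).
    by apply: measurable_funM; [exact: (measurableT_comp hs)|exact: (measurableT_comp ms)].
  by apply/funext => x; rewrite /= mul0r addr0.
- by exists 1 => x; rewrite -(csq_spin x) lerDr csq_ge0.
Qed.

Lemma bmeas_spin_mono n l :
  bmeas (spin_mono n l : measurableTypeR R * measurableTypeR R -> R[i]).
Proof. by apply: bmeasM; apply: bmeasX; [exact: bmeas_spin1|exact: bmeas_spin2]. Qed.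

Lemma conj_spin_mono n l x : conjc (spin_mono n l x) =
  (conjc (spin1 x)) ^+ l * (conjc (spin2 x)) ^+ (n - l).
Proof. by rewrite /spin_mono rmorphM !rmorphXn. Qed.

(** Up to a constant this is the reproducing kernel of the homogeneous polynomials of degree n: the
    binomial coefficients are proportional to the inverse squared norms of the monomials. *)
Lemma spin_dotX n x y : spin_dot x y ^+ n =
  \sum_(l < n.+1) 'C(n, l)%:R * (spin_mono n l x * conjc (spin_mono n l y)).
Proof.
rewrite /spin_dot addrC exprDn; apply: eq_bigr => l _.
by rewrite conj_spin_mono /spin_mono !exprMn [RHS]mulr_natl; congr (_ *+ _); ring.
Qed.

(** Twice the Beta integral B(l + 1, m + 1), in the variable cos^2 (t / 2). *)
Definition half_beta l m : R :=
  \int[mu]_(t in `[0, pi]) (cos (t / 2) ^+ (2 * l) * sin (t / 2) ^+ (2 * m) * sin t).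

Let bfun l m (t : R) := cos (t / 2) ^+ (2 * l) * sin (t / 2) ^+ (2 * m) * sin t.

Let continuous_bfun l m : continuous (bfun l m).
Proof.
have cc := @continuousX _ (2 * l)%N (continuous_half (@continuous_cos R)).
have cs := @continuousX _ (2 * m)%N (continuous_half (@continuous_sin R)).
move=> t; have := continuous_fM (continuous_fM (cc t) (cs t)) (@continuous_sin R t).
exact.
Qed.

Let is_derive_half (f : R -> R) (t d : R) : is_derive (t / 2) 1 f d ->
  is_derive t 1 (fun t => f (t / 2)) (d / 2).
Proof.
move=> h; have h2 : is_derive t 1 (fun t : R => t * 2^-1) 2^-1.
  have h1 : is_derive t 1 (fun=> 2^-1 : R) 0 by exact: is_derive_cst.
  apply: (is_derive_eq (is_derive_fM (is_derive_id t 1) h1)).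
  by rewrite mul1r mulr0 addr0.
exact: (@is_derive1_comp _ f (fun t => t * 2^-1) _ _ _ h h2).
Qed.

Lemma half_beta_shift l m :
  m.+1%:R * half_beta l.+1 m = l.+1%:R * half_beta l m.+1.
Proof.
have cb k j (t : R) : {for t, continuous (bfun k j)} by exact: continuous_bfun.
apply/eqP; rewrite -subr_eq0 -(@Rintegral_lin_comb R (bfun l.+1 m) (bfun l m.+1))//.
have dF (t : R) : 0 <= t <= pi -> is_derive t 1
    (fun t => 2 * (cos (t / 2) ^+ (2 * l.+1) * sin (t / 2) ^+ (2 * m.+1)))
    (m.+1%:R * bfun l.+1 m t - l.+1%:R * bfun l m.+1 t).
  move=> _; rewrite !mulnS /=.
  have dc := is_derive_fX (2 * l).+1 (is_derive_half (is_derive_cos (t / 2))).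
  have ds := is_derive_fX (2 * m).+1 (is_derive_half (is_derive_sin (t / 2))).
  have h2 : is_derive t 1 (fun=> 2 : R) 0 by exact: is_derive_cst.
  apply: (is_derive_eq (is_derive_fM h2 (is_derive_fM dc ds))).
  have e j : (2 * j).+2%:R = 2 * j.+1%:R :> R by rewrite -natrM mulnS.
  rewrite /bfun (sin_half t) !mulnS !add2n !exprS !e.
  by field.
rewrite (Rintegral_FTC (pi_ge0 R) dF).
  by rewrite cos_pihalf mul0r sin0 !mulnS !expr0n/= !(mul0r, mulr0) subrr.
by move=> t _; exact: continuous_lin_comb.
Qed.

Lemma half_beta_split l m : half_beta l m = half_beta l.+1 m + half_beta l m.+1.
Proof.
have bi k j : mu.-integrable `[0, pi] (EFin \o bfun k j).
  by apply: continuous_itv_integrable => t _; exact: continuous_bfun.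
rewrite /half_beta -RintegralD//; [|exact: bi..].
apply: eq_Rintegral => t _; rewrite !mulnS !exprS.
have h : sin (t / 2) ^+ 2 = 1 - cos (t / 2) ^+ 2 by have := cos2Dsin2 (t / 2); lra.
ring: h.
Qed.

(** [half_beta_shift] and [half_beta_split] form a linear system that expresses both neighbours of
    (l, m) through [half_beta l m]; the induction climbs in m along l = 0, then in l. *)
Lemma half_betaE l m : half_beta l m = 2 / ((l + m).+1%:R * 'C(l + m, l)%:R).
Proof.
have S1 j k : half_beta j.+1 k = (j%:R + 1) / (j%:R + k%:R + 2) * half_beta j k.
  have := half_beta_shift j k; have := half_beta_split j k.
  set a := half_beta _ _; set b := half_beta _ _; set c := half_beta _ _.
  rewrite -!natr1 => -> h; have j0 : (0 : R) <= j%:R by []; have k0 : (0 : R) <= k%:R by [].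
  have -> : c = (k%:R + 1) / (j%:R + 1) * b.
    by rewrite mulrAC h; field; rewrite gt_eqF//; lra.
  by field; rewrite !gt_eqF//; lra.
have S2 j k : half_beta j k.+1 = (k%:R + 1) / (j%:R + k%:R + 2) * half_beta j k.
  have := half_beta_split j k; rewrite S1 => h.
  have j0 : (0 : R) <= j%:R by []; have k0 : (0 : R) <= k%:R by [].
  have : half_beta j k.+1 = half_beta j k - (j%:R + 1) / (j%:R + k%:R + 2) * half_beta j k by lra.
  by move=> ->; field; rewrite !gt_eqF//; lra.
elim: l => [|l IHl]; last first.
  rewrite S1 IHl addSn.
  have h := mul_bin_diag (l + m).+1 l.
  have C0 : 'C(l + m, l)%:R != 0 :> R by rewrite pnatr_eq0 -lt0n bin_gt0 leq_addr.
  have l0 : (0 : R) <= l%:R by []; have m0 : (0 : R) <= m%:R by [].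
  have e1 : (l + m).+1%:R = l%:R + m%:R + 1 :> R by rewrite -natr1 natrD.
  have e2 : (l + m).+2%:R = l%:R + m%:R + 1 + 1 :> R by rewrite -natr1 e1.
  have -> : 'C((l + m).+1, l.+1)%:R =
      (l%:R + m%:R + 1) * 'C(l + m, l)%:R / (l%:R + 1) :> R.
    have := congr1 (fun n => n%:R : R) h; rewrite !natrM e1 natr1 => ->.
    by rewrite mulrAC divff ?mul1r// pnatr_eq0.
  by rewrite e1 e2; field; rewrite C0 !gt_eqF//; lra.
elim: m => [|m IHm]; last first.
  rewrite S2 IHm !add0n !bin0 -[m.+2%:R]natr1 -natr1; have m0 : (0 : R) <= m%:R by [].
  by field; rewrite !gt_eqF//; lra.
rewrite /half_beta addn0 bin0 mul1r divr1.
have dF (t : R) : 0 <= t <= pi -> is_derive t 1 (fun t => - cos t) (sin t).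
  by move=> _; apply: (is_derive_eq (is_deriveN (is_derive_cos t))); rewrite opprK.
under eq_Rintegral do rewrite mul1r.
rewrite (Rintegral_FTC (pi_ge0 R) dF); first by rewrite cospi cos0; ring.
by move=> t _; exact: continuous_sin.
Qed.

Lemma Rintegral_cis_diff (a b : nat) :
  \int[mu]_(t in `[0, 2 * pi]) cos ((a%:R - b%:R) * t) = (a == b)%:R * (2 * pi) /\
  \int[mu]_(t in `[0, 2 * pi]) sin ((a%:R - b%:R) * t) = 0.
Proof.
have tp0 : 0 <= 2 * pi :> R by rewrite mulr_ge0// pi_ge0.
have [->|ab] := eqVneq a b.
  rewrite subrr mul1r; split.
    by under eq_Rintegral do rewrite mul0r cos0; rewrite Rintegral_itv_cst// subr0 mul1r.
  by under eq_Rintegral do rewrite mul0r sin0; rewrite Rintegral_itv_cst// mul0r.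
set D : R := a%:R - b%:R; have D0 : D != 0 by rewrite subr_eq0 eqr_nat.
(* D is a nonzero integer, so the primitives below take equal values at 0 and 2 pi. *)
have cD : cis (D * (2 * pi)) = 1.
  rewrite /D mulrBl cisD -conjc_cis -[cis (a%:R * _)]cisX -[cis (b%:R * _)]cisX.
  by rewrite cis2pi !expr1n mul1r; exact: conjc1.
have [c1 s1] : cos (D * (2 * pi)) = 1 /\ sin (D * (2 * pi)) = 0 by case: cD.
have dl (t : R) : is_derive t 1 (fun t => D * t) D.
  apply: (is_derive_eq (is_derive_fM (is_derive_cst D t 1) (is_derive_id t 1))).
  by rewrite mul0r add0r mulr1.
have cl : continuous (fun t : R => D * t).
  by move=> t; apply: (@continuous_fM _ (fun=> D)); [exact: cst_continuous|exact: cvg_id].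
split.
  have dF (t : R) : 0 <= t <= 2 * pi ->
      is_derive t 1 (fun t => D^-1 * sin (D * t)) (cos (D * t)).
    move=> _; have h := is_derive1_comp (is_derive_sin (D * t)) (dl t).
    apply: (is_derive_eq (is_derive_fM (is_derive_cst D^-1 t 1) h)).
    by rewrite mul0r add0r -[cst _ t]/(D^-1); field.
  rewrite (Rintegral_FTC tp0 dF); first by rewrite s1 !mulr0 sin0 mulr0 subrr mul0r.
  by move=> t _; apply: continuous_comp; [exact: cl|exact: continuous_cos].
have dF (t : R) : 0 <= t <= 2 * pi ->
    is_derive t 1 (fun t => - D^-1 * cos (D * t)) (sin (D * t)).
  move=> _; have h := is_derive1_comp (is_derive_cos (D * t)) (dl t).
  apply: (is_derive_eq (is_derive_fM (is_derive_cst (- D^-1) t 1) h)).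
  by rewrite mul0r add0r -[cst _ t]/(- D^-1); field.
rewrite (Rintegral_FTC tp0 dF); first by rewrite c1 !mulr0 cos0 subrr.
by move=> t _; apply: continuous_comp; [exact: cl|exact: continuous_sin].
Qed.

(** The squared norm of [spin_mono n l] in L^2 of the sphere, whose area is 4 pi. *)
Definition mono_norm n l : R := 4 * pi / (n.+1%:R * 'C(n, l)%:R).

(** The longitude enters only through e^(i (m - l) x.2), which separates distinct exponents; for
    equal ones the colatitude gives a Beta integral. *)
Lemma cint_spin_mono n l m : (l <= n)%N -> (m <= n)%N ->
  cint angle_measure (fun x => spin_mono n l x * conjc (spin_mono n m x))
    = ((l == m)%:R * mono_norm n l)%:C.
Proof.
move=> ln mn; pose D : R := (n - l)%:R - (n - m)%:R.
pose F t : R := cos (t / 2) ^+ (l + m) * sin (t / 2) ^+ ((n - l) + (n - m)).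
have E x : spin_mono n l x * conjc (spin_mono n m x) =
    (F x.1 * cos (D * x.2)) +i* (F x.1 * sin (D * x.2)).
  transitivity ((F x.1)%:C * cis (D * x.2)); last first.
    by rewrite /cis; apply/eqP; rewrite eq_complex /=; apply/andP; split; apply/eqP; ring.
  have c2 : conjc (spin2 x) = (sin (x.1 / 2))%:C * conjc (cis x.2).
    by apply/eqP; rewrite eq_complex /spin2 /=; apply/andP; split; apply/eqP; ring.
  rewrite /D mulrBl cisD -conjc_cis -!cisX conj_spin_mono c2 /spin1 conjc_real.
  rewrite rmorphXn /F rmorphM !rmorphXn !exprD /spin_mono /spin1 /spin2 !exprMn.
  ring.
have cF : continuous F.
  have cc := @continuousX _ (l + m)%N (continuous_half (@continuous_cos R)).
  have cs := @continuousX _ (n - l + (n - m))%N (continuous_half (@continuous_sin R)).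
  by move=> t; exact: (continuous_fM (cc t) (cs t)).
have cl : continuous (fun t : R => D * t).
  by move=> t; apply: (@continuous_fM _ (fun=> D)); [exact: cst_continuous|exact: cvg_id].
have cc : continuous (fun t : R => cos (D * t)).
  by move=> t; apply: continuous_comp; [exact: cl|exact: continuous_cos].
have cs : continuous (fun t : R => sin (D * t)).
  by move=> t; apply: continuous_comp; [exact: cl|exact: continuous_sin].
have c1 (t : R) : `|cos t| <= 1 by rewrite ler_norml cos_geN1 cos_le1.
have s1 (t : R) : `|sin t| <= 1 by rewrite ler_norml sin_geN1 sin_le1.
have F1 t : `|F t| <= 1.
  by rewrite normrM !normrX mulr_ile1 ?exprn_ge0// exprn_ile1.
have [I1 I2] := Rintegral_cis_diff (n - l) (n - m).
rewrite /cint; under eq_Rintegral do rewrite E /=.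
under [X in _ +i* X]eq_Rintegral do rewrite E /=.
rewrite (@Rintegral_angle _ F (fun t => cos (D * t)) 1)//.
rewrite (@Rintegral_angle _ F (fun t => sin (D * t)) 1)//.
rewrite I1 I2 mulr0; congr (_ +i* _).
(* Truncated subtraction from n is injective up to n, whence the bounds on l and m. *)
have -> : ((n - l)%N == (n - m)%N) = (l == m).
  by apply/eqP/eqP => [h|->//]; rewrite -(subKn ln) h subKn.
have [lm|_] := eqVneq l m; last by rewrite !mul0r mulr0.
rewrite !mul1r /mono_norm -[in RHS](subnKC ln).
have := half_betaE l (n - l); rewrite /half_beta /F -lm !addnn -!mul2n => ->.
by rewrite mulrAC; congr (_ / _); ring.
Qed.

End spinors.

(** * Determinants *)

Section permutation_expansion.
Context {F : comNzRingType} {n : nat}.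
Implicit Types (A B : 'M[F]_n) (s t : 'S_n).

(** Agreeing off {a, b}, the two permutations map {a, b} onto the same pair, and there are only two
    bijections between pairs. *)
Lemma perm_agree_off_pair s t (a b : 'I_n) : a != b ->
  (forall i, i != a -> i != b -> s i = t i) -> t = s \/ t = (tperm a b * s)%g.
Proof.
move=> ab st.
have pre c : c \in [:: a; b] -> exists2 j, s j = t c & j \in [:: a; b].
  move=> cab; exists ((s^-1)%g (t c)); first by rewrite permKV.
  apply/negP => /negP; rewrite !inE negb_or => /andP[ja jb].
  have := st _ ja jb; rewrite permKV => /perm_inj cj.
  by move: cab; rewrite cj !inE (negbTE ja) (negbTE jb).
have [|ja sja] := pre a; rewrite ?mem_head// !inE => /orP[]/eqP jaE.
  left; apply/permP => i.
  have [->|ia] := eqVneq i a; first by rewrite -sja jaE.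
  have [->|ib] := eqVneq i b; last by rewrite st.
  have [|jb sjb] := pre b; first by rewrite !inE eqxx orbT.
  rewrite !inE => /orP[]/eqP jbE; last by rewrite -sjb jbE.
  by move: ab; rewrite -(inj_eq (@perm_inj _ t)) -sja -sjb jaE jbE eqxx.
right; apply/permP => i; rewrite permM.
have [->|ia] := eqVneq i a; first by rewrite tpermL -sja jaE.
have [->|ib] := eqVneq i b; last by rewrite tpermD 1?eq_sym// st.
rewrite tpermR; have [|jb sjb] := pre b; first by rewrite !inE eqxx orbT.
rewrite !inE => /orP[]/eqP jbE; first by rewrite -sjb jbE.
by move: ab; rewrite -(inj_eq (@perm_inj _ t)) -sja -sjb jaE jbE eqxx.
Qed.

Lemma sum_perm_insert2 A B s (a b : 'I_n) : a != b ->
  \sum_(t : 'S_n) (-1) ^+ s * (-1) ^+ t *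
     \prod_i (if i == a then A (s i) (t i) else if i == b then B (s i) (t i)
              else (s i == t i)%:R)
  = A (s a) (s a) * B (s b) (s b) - A (s a) (s b) * B (s b) (s a).
Proof.
move=> ab; have ba : b != a by rewrite eq_sym.
have prodE t : (forall i, i != a -> i != b -> s i = t i) ->
    \prod_i (if i == a then A (s i) (t i) else if i == b then B (s i) (t i)
              else (s i == t i)%:R) = A (s a) (t a) * B (s b) (t b).
  move=> st; rewrite (bigD1 a)//= eqxx (bigD1 b)//= eqxx (negbTE ba) big1 ?mulr1//.
  by move=> i /andP[ia ib]; rewrite (negbTE ia) (negbTE ib) st// eqxx.
pose u := (tperm a b * s)%g.
have us : u != s.
  apply/eqP => /permP/(_ a); rewrite permM tpermL => /perm_inj/eqP.
  by rewrite (negbTE ba).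
rewrite (bigD1 s)//= (bigD1 u)//= [X in _ + (_ + X)]big1 ?addr0; last first.
  move=> t /andP[ts tu].
  have [i /and3P[ia ib ist]] : exists i, [&& i != a, i != b & s i != t i].
    apply/existsP; apply: contraT; rewrite negb_exists => /forallP h.
    have st i : i != a -> i != b -> s i = t i.
      by move=> ia ib; have := h i; rewrite ia ib/= negbK => /eqP.
    by have [tE|tE] := perm_agree_off_pair ab st; [rewrite tE eqxx in ts|rewrite tE eqxx in tu].
  by rewrite (bigD1 i)//= (negbTE ia) (negbTE ib) (negbTE ist) mul0r mulr0.
rewrite prodE// prodE; last first.
  by move=> i ia ib; rewrite permM tpermD// eq_sym.
rewrite !permM tpermL tpermR odd_mul_tperm ab -signr_addb addbb mul1r.
by rewrite -signr_addb addbCA addbb addbF expr1 mulN1r.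
Qed.

Lemma sum_perm_delta s :
  \sum_(t : 'S_n) (-1) ^+ s * (-1) ^+ t * \prod_i (s i == t i)%:R = 1 :> F.
Proof.
rewrite (bigD1 s)//= -signr_addb addbb mul1r big1 => [|i _]; last by rewrite eqxx.
rewrite big1 ?addr0// => t ts.
have [i ist] : exists i, s i != t i.
  apply/existsP; apply: contraT; rewrite negb_exists => /forallP h.
  case/eqP: ts; apply/permP => i; have := h i; rewrite negbK => /eqP ->.
  by [].
by rewrite (bigD1 i)//= (negbTE ist) mul0r mulr0.
Qed.

(** For fixed s the indices l = s a and m = s b run over all pairs l != m. The terms with l = m
    vanish and can be added, so every s contributes the same double sum. *)
Lemma sum_pairs_perm_insert2 A B :
  \sum_a \sum_(b | a != b) \sum_(s : 'S_n) \sum_(t : 'S_n)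
     (-1) ^+ s * (-1) ^+ t *
     \prod_i (if i == a then A (s i) (t i) else if i == b then B (s i) (t i)
              else (s i == t i)%:R)
  = (n`!)%:R * \sum_l \sum_m (A l l * B m m - A l m * B m l).
Proof.
pose f l m := A l l * B m m - A l m * B m l.
transitivity (\sum_a \sum_(b | a != b) \sum_(s : 'S_n) f (s a) (s b)).
  by apply: eq_bigr => a _; apply: eq_bigr => b ab; apply: eq_bigr => s _;
    rewrite sum_perm_insert2.
under eq_bigr do rewrite exchange_big; rewrite exchange_big/=.
rewrite (eq_bigr (fun=> \sum_l \sum_m f l m)); last first.
  move=> s _; rewrite [RHS](reindex_inj (@perm_inj _ s)); apply: eq_bigr => a _.
  rewrite [RHS](reindex_inj (@perm_inj _ s)) [RHS](bigD1 a)//=.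
  rewrite [f (s a) (s a)]subrr add0r.
  by apply: eq_bigl => b; rewrite eq_sym.
by rewrite sumr_const card_Sn mulr_natl.
Qed.

End permutation_expansion.

(** * Vandermonde determinants in homogeneous coordinates *)

Section homogeneous_vandermonde.

(** Each index belongs to exactly n - 1 pairs, as the smaller or as the larger member. *)
Lemma prod_pairs_swap (F : comNzRingType) n (f : 'I_n -> F) :
  \prod_(i < n) \prod_(j < n | (i < j)%N) (f i * f j) = \prod_(i < n) f i ^+ n.-1.
Proof.
have E : \prod_(i < n) \prod_(j < n | (i < j)%N) f j
    = \prod_(i < n) \prod_(j < n | (j < i)%N) f i.
  exact: exchange_big_dep.
transitivity (\prod_(i < n) ((\prod_(j < n | (i < j)%N) f i) *
    \prod_(j < n | (j < i)%N) f i)).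
  by rewrite big_split -E -big_split; apply: eq_bigr => i _; rewrite big_split.
have cst (P : pred 'I_n) x : \prod_(j | P j) x = x ^+ (\sum_(j | P j) 1)%N :> F.
  by rewrite -prodrXr; apply: eq_bigr => j _; rewrite expr1.
apply: eq_bigr => i _; rewrite !cst -exprD; congr (_ ^+ _).
have h : (\sum_(j < n | j != i) 1 = n.-1)%N by rewrite sum1_card cardC1 card_ord.
rewrite -h [RHS](bigID (fun j : 'I_n => (i < j)%N))/=.
by congr (_ + _)%N; apply: eq_bigl => j; rewrite -val_eqE/=; case: ltngtP.
Qed.

(** Row i is b_i^(n-1) times a Vandermonde row in a_i / b_i. As i lies in n - 1 pairs, these factors
    exactly clear the denominators of the differences. *)
Lemma det_homogeneous_vandermonde_nz (F : fieldType) n (a b : 'I_n -> F) :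
  (forall i, b i != 0) ->
  \det (\matrix_(i, l < n) (a i ^+ l * b i ^+ (n.-1 - l)))
    = \prod_(i < n) \prod_(j < n | (i < j)%N) (a j * b i - a i * b j).
Proof.
move=> b0; pose x := \row_i (a i / b i).
have -> : \matrix_(i, l < n) (a i ^+ l * b i ^+ (n.-1 - l))
    = diag_mx (\row_i b i ^+ n.-1) *m (Vandermonde n x)^T.
  apply/matrixP => i l; rewrite mul_diag_mx !mxE expr_div_n mulrCA; congr (_ * _).
  have ln : (l <= n.-1)%N by rewrite -ltnS (ltn_predK (ltn_ord i)).
  by rewrite -{2}(subnKC ln) exprD mulrAC divff ?mul1r// expf_neq0.
rewrite det_mulmx det_diag det_tr det_Vandermonde.
under eq_bigr do rewrite mxE; rewrite -prod_pairs_swap -big_split/=.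
apply: eq_bigr => i _; rewrite -big_split/=; apply: eq_bigr => j _.
by rewrite !mxE; field; rewrite !b0.
Qed.

(* The b i may vanish: perturb them to b i + 'X in the fraction field of the
   polynomials, and specialize at 0. *)
Lemma det_homogeneous_vandermonde (F : fieldType) n (a b : 'I_n -> F) :
  \det (\matrix_(i, l < n) (a i ^+ l * b i ^+ (n.-1 - l)))
    = \prod_(i < n) \prod_(j < n | (i < j)%N) (a j * b i - a i * b j).
Proof.
pose a' i : {poly F} := (a i)%:P; pose b' i : {poly F} := (b i)%:P + 'X.
have E : \det (\matrix_(i, l < n) (a' i ^+ l * b' i ^+ (n.-1 - l)))
    = \prod_(i < n) \prod_(j < n | (i < j)%N) (a' j * b' i - a' i * b' j).
  apply/eqP; rewrite -tofrac_eq; apply/eqP; rewrite -det_map_mx.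
  have := @det_homogeneous_vandermonde_nz {fraction {poly F}} n
    (fun i => tofrac (a' i)) (fun i => tofrac (b' i)).
  rewrite rmorph_prod; under [X in _ -> _ = X]eq_bigr do rewrite rmorph_prod.
  under [X in _ -> _ = X]eq_bigr => i _ do
    under eq_bigr => j _ do rewrite rmorphB !rmorphM.
  move=> <-; last first.
    by move=> i; rewrite tofrac_eq0 /b' addrC -size_poly_gt0 size_XaddC.
  by congr (\det _); apply/matrixP => i l; rewrite !mxE rmorphM !rmorphXn.
have := congr1 (horner_eval 0) E; rewrite -det_map_mx.
have -> : horner_eval 0 (\prod_(i < n) \prod_(j < n | (i < j)%N)
      (a' j * b' i - a' i * b' j))
    = \prod_(i < n) \prod_(j < n | (i < j)%N) (a j * b i - a i * b j).
  rewrite /horner_eval horner_prod; apply: eq_bigr => i _.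
  by rewrite horner_prod; apply: eq_bigr => j _; rewrite !hornerE.
move=> <-; congr (\det _); apply/matrixP => i l.
by rewrite !mxE /= /horner_eval hornerM !horner_exp !hornerE.
Qed.

End homogeneous_vandermonde.

(** * Two-point functions *)

Section biorthogonal_ensemble.
Local Open Scope complex_scope.
Context d (T : measurableType d) (R : realType).
Variables (mu : {finite_measure set T -> \bar R}) (r : nat).
Variables phi psi : 'I_r -> T -> R[i].
Hypotheses (bphi : forall l, bmeas (phi l)) (bpsi : forall l, bmeas (psi l)).
Hypothesis orth : forall l m,
  cint mu (fun x => psi l x * conjc (phi m x)) = (l == m)%:R.
Local Notation TM := (@tuple_measure _ T R mu r).

(** Two biorthogonal families rather than one orthonormal family: the squared norms are divided out
    on one side, without square roots. *)
Definition biorth_weight (x : r.-tuple T) : R[i] :=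
  \det (\matrix_(i, l) psi l (tnth x i)) * conjc (\det (\matrix_(i, l) phi l (tnth x i))).

Lemma biorth_weightE x : biorth_weight x =
  \sum_(s : 'S_r) \sum_(t : 'S_r) (-1) ^+ s * (-1) ^+ t *
    \prod_(i < r) (psi (s i) (tnth x i) * conjc (phi (t i) (tnth x i))).
Proof.
rewrite /biorth_weight /determinant rmorph_sum big_distrlr/=.
apply: eq_bigr => s _; apply: eq_bigr => t _.
rewrite rmorphM rmorph_sign rmorph_prod big_split mulrACA; congr (_ * (_ * _)).
  by apply: eq_bigr => i _; rewrite mxE.
by apply: eq_bigr => i _; rewrite mxE.
Qed.

Let bpp l m : bmeas (fun x => psi l x * conjc (phi m x)).
Proof. by apply: bmeasM => //; exact: bmeas_conj. Qed.

Let btnth (f : T -> R[i]) i : bmeas f -> bmeas (fun x : r.-tuple T => f (tnth x i)).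
Proof. by apply: bmeas_comp; exact: measurable_tnth. Qed.

Let bmeas_perm_sum (f : 'S_r -> 'S_r -> 'I_r -> T -> R[i]) :
  (forall s t i, bmeas (f s t i)) ->
  bmeas (fun x : r.-tuple T => \sum_(s : 'S_r) \sum_(t : 'S_r)
    (-1) ^+ s * (-1) ^+ t * \prod_(i < r) f s t i (tnth x i)).
Proof.
move=> bf; apply: bmeas_sum => s _; apply: bmeas_sum => t _.
apply: bmeasM; first exact: bmeas_cst.
by apply: bmeas_prod => i _; exact: btnth.
Qed.

Let cint_perm_sum (f : 'S_r -> 'S_r -> 'I_r -> T -> R[i]) :
  (forall s t i, bmeas (f s t i)) ->
  cint TM (fun x => \sum_(s : 'S_r) \sum_(t : 'S_r)
    (-1) ^+ s * (-1) ^+ t * \prod_(i < r) f s t i (tnth x i))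
  = \sum_(s : 'S_r) \sum_(t : 'S_r)
    (-1) ^+ s * (-1) ^+ t * \prod_(i < r) cint mu (f s t i).
Proof.
move=> bf; have bp (s t : 'S_r) : bmeas (fun x : r.-tuple T => \prod_(i < r) f s t i (tnth x i)).
  by apply: bmeas_prod => i _; exact: btnth.
have bc (s t : 'S_r) : bmeas (fun x : r.-tuple T =>
    (-1) ^+ s * (-1) ^+ t * \prod_(i < r) f s t i (tnth x i)).
  by apply: bmeasM => //; exact: bmeas_cst.
rewrite cint_sum; last by move=> s _; apply: bmeas_sum.
apply: eq_bigr => s _; rewrite cint_sum//; apply: eq_bigr => t _.
by rewrite cintZ// cint_tuple.
Qed.

Lemma cint_biorth_weight : cint TM biorth_weight = (r`!)%:R.
Proof.
rewrite (funext biorth_weightE).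
rewrite (cint_perm_sum (f := fun s t i x => psi (s i) x * conjc (phi (t i) x)))//.
rewrite -card_Sn -sum1_card natr_sum; apply: eq_bigr => s _.
rewrite -[RHS](@sum_perm_delta R[i] r s); apply: eq_bigr => t _; congr (_ * _).
by apply: eq_bigr => i _; exact: orth.
Qed.

Lemma prod_insert2 (a b : 'I_r) (A B : 'I_r -> R[i]) : a != b ->
  \prod_i (if i == a then A i else if i == b then B i else 1) = A a * B b.
Proof.
move=> ab; have ba : b != a by rewrite eq_sym.
rewrite (bigD1 a)//= eqxx (bigD1 b)//= eqxx (negbTE ba) big1 ?mulr1// => i.
by move=> /andP[/negbTE -> /negbTE ->].
Qed.

(* After integration of the variables other than a and b, only the pairs of
   permutations s, t with t = s or t = tperm a b * s contribute. *)
Lemma sum_cint_biorth_pairs (Q : finType) (u v : Q -> T -> R[i]) :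
  (forall q, bmeas (u q)) -> (forall q, bmeas (v q)) ->
  let A q := \matrix_(l, m) cint mu (fun x => psi l x * conjc (phi m x) * u q x) in
  let B q := \matrix_(l, m) cint mu (fun x => psi l x * conjc (phi m x) * v q x) in
  \sum_a \sum_(b | a != b)
    cint TM (fun x => biorth_weight x * \sum_q u q (tnth x a) * v q (tnth x b))
  = (r`!)%:R * \sum_q \sum_l \sum_m (A q l l * B q m m - A q l m * B q m l).
Proof.
move=> bu bv A B.
pose G a b q (s t : 'S_r) i (x : T) := psi (s i) x * conjc (phi (t i) x) *
  (if i == a then u q x else if i == b then v q x else 1).
have bG a b q s t i : bmeas (G a b q s t i).
  apply: bmeasM => //; rewrite /G; case: (i == a) => //; case: (i == b) => //.
  exact: bmeas_cst.
have step a b : a != b ->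
    cint TM (fun x => biorth_weight x * \sum_q u q (tnth x a) * v q (tnth x b))
   = \sum_q \sum_(s : 'S_r) \sum_(t : 'S_r) (-1) ^+ s * (-1) ^+ t *
     \prod_i (if i == a then A q (s i) (t i) else if i == b then B q (s i) (t i)
              else (s i == t i)%:R).
  move=> ab; rewrite (_ : (fun x => _) = fun x : r.-tuple T =>
      \sum_q \sum_(s : 'S_r) \sum_(t : 'S_r) (-1) ^+ s * (-1) ^+ t *
        \prod_i G a b q s t i (tnth x i)); last first.
    apply/funext => x; rewrite mulr_sumr; apply: eq_bigr => q _.
    rewrite biorth_weightE mulr_suml; apply: eq_bigr => s _.
    rewrite mulr_suml; apply: eq_bigr => t _; rewrite -[LHS]mulrA; congr (_ * _).
    rewrite -(prod_insert2 (fun i => u q (tnth x i)) (fun i => v q (tnth x i)) ab).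
    by rewrite -big_split.
  rewrite cint_sum; last by move=> q _; exact: bmeas_perm_sum.
  apply: eq_bigr => q _; rewrite cint_perm_sum//.
  apply: eq_bigr => s _; apply: eq_bigr => t _; congr (_ * _).
  apply: eq_bigr => i _; rewrite /G; case: ifP => _; first by rewrite mxE.
  case: ifP => _; first by rewrite mxE.
  by rewrite -orth; congr cint; apply/funext => x; rewrite mulr1.
transitivity (\sum_q \sum_a \sum_(b | a != b) \sum_(s : 'S_r) \sum_(t : 'S_r)
    (-1) ^+ s * (-1) ^+ t *
     \prod_i (if i == a then A q (s i) (t i) else if i == b then B q (s i) (t i)
              else (s i == t i)%:R)).
  rewrite exchange_big; apply: eq_bigr => a _; rewrite exchange_big.
  by apply: eq_bigr => b ab; exact: step.
by rewrite mulr_sumr; apply: eq_bigr => q _; rewrite sum_pairs_perm_insert2.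
Qed.

End biorthogonal_ensemble.

Section real_complex_morphism.
Local Open Scope complex_scope.
Context {R : realType}.
Implicit Types a b : R.

Lemma realcM a b : (a * b)%:C = a%:C * b%:C :> R[i]. Proof. exact: rmorphM. Qed.
Lemma realcD a b : (a + b)%:C = a%:C + b%:C :> R[i]. Proof. exact: rmorphD. Qed.
Lemma realcB a b : (a - b)%:C = a%:C - b%:C :> R[i]. Proof. exact: rmorphB. Qed.
Lemma realcX a n : (a ^+ n)%:C = a%:C ^+ n :> R[i]. Proof. exact: rmorphXn. Qed.
Lemma realc_nat n : (n%:R)%:C = n%:R :> R[i]. Proof. exact: rmorph_nat. Qed.
Lemma realc_prod (I : finType) (f : I -> R) :
  (\prod_i f i)%:C = \prod_i (f i)%:C :> R[i].
Proof. exact: rmorph_prod. Qed.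

End real_complex_morphism.

(** * Pair moments of the spherical ensemble *)

Section spherical_pairs.
Local Open Scope complex_scope.
Context {R : realType}.
Local Notation angles := (measurableTypeR R * measurableTypeR R)%type.
Local Notation TM r := (@tuple_measure _ angles R angle_measure r).

Definition spin_det r (x : r.-tuple (R * R)) : R[i] :=
  \det (\matrix_(i, l < r) spin_mono r.-1 l (tnth x i)).

Lemma spherical_weightE r (x : r.-tuple (R * R)) :
  spherical_weight (map_tuple (@sph_coord R) x)
    = (\prod_(i < r) \prod_(j < r | (i < j)%N) 4) * csq (spin_det x).
Proof.
rewrite /spin_det /spin_mono det_homogeneous_vandermonde csq_prod -big_split.
apply: eq_bigr => i _; rewrite csq_prod -big_split; apply: eq_bigr => j _.
rewrite /= !tnth_map edist_sph_coord; congr (_ * _).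
rewrite /spin_wedge; move: (_ * _) (_ * _) => z z'; rewrite -(opprB z').
by case: (z' - z) => p q; rewrite /csq /= !sqrrN.
Qed.

Definition cint2 (f : R * R -> R * R -> R[i]) : R[i] :=
  cint (TM 2) (fun t => f (tnth t ord0) (tnth t ord_max)).

Lemma cint2_prod (u v : angles -> R[i]) : bmeas u -> bmeas v ->
  cint2 (fun x y => u x * v y) = cint angle_measure u * cint angle_measure v.
Proof.
move=> bu bv; have := @cint_tuple _ angles R angle_measure 2
  (fun i => if i == ord0 then u else v).
rewrite /cint2 !big_ord_recl big_ord0 /= mulr1 => <-; last by move=> i; case: ifP.
congr cint; apply/funext => t; rewrite !big_ord_recl big_ord0 /= mulr1.
by congr (_ * v (tnth t _)); apply/val_inj.
Qed.

Lemma cint2_sum (I : finType) (u v : I -> angles -> R[i]) :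
  (forall i, bmeas (u i)) -> (forall i, bmeas (v i)) ->
  cint2 (fun x y => \sum_i u i x * v i y)
    = \sum_i cint angle_measure (u i) * cint angle_measure (v i).
Proof.
move=> bu bv; rewrite /cint2 cint_sum.
  by apply: eq_bigr => i _; exact: cint2_prod.
by move=> i _; apply: bmeasM; apply: bmeas_comp => //; exact: measurable_tnth.
Qed.

(** The index q pairs a monomial from the expansion of <x, y>^M with one from its conjugate; both
    binomial coefficients go to the left factor. *)
Definition dot_left M (q : 'I_M.+1 * 'I_M.+1) (x : R * R) : R[i] :=
  'C(M, q.1)%:R * 'C(M, q.2)%:R * (spin_mono M q.1 x * conjc (spin_mono M q.2 x)).
Definition dot_right M (q : 'I_M.+1 * 'I_M.+1) (y : R * R) : R[i] :=
  spin_mono M q.2 y * conjc (spin_mono M q.1 y).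

Lemma csq_dotX M (x y : R * R) : (csq (spin_dot x y) ^+ M)%:C =
  \sum_q dot_left (M := M) q x * dot_right q y.
Proof.
rewrite -csqX csqE spin_dotX rmorph_sum big_distrlr/=.
rewrite pair_bigA/=; apply: eq_bigr => q _.
rewrite /dot_left /dot_right.
have cM m (a b : R[i]) : conjc (m%:R * (a * conjc b)) = m%:R * (conjc a * b).
  by rewrite !rmorphM /= conjcK; congr (_ * _); exact: rmorph_nat.
move: (spin_mono M q.1 x) (spin_mono M q.1 y) (spin_mono M q.2 x) (spin_mono M q.2 y).
move=> a b c e; transitivity ('C(M, q.1)%:R * (a * conjc b) *
    ('C(M, q.2)%:R * (conjc c * e))); last by ring.
by congr (_ * _); exact: cM.
Qed.

Lemma bmeas_dot_left M (q : 'I_M.+1 * 'I_M.+1) : bmeas (dot_left q : angles -> R[i]).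
Proof.
apply: bmeasM; first exact: bmeas_cst.
by apply: bmeasM; [|apply: bmeas_conj]; exact: bmeas_spin_mono.
Qed.

Lemma bmeas_dot_right M (q : 'I_M.+1 * 'I_M.+1) : bmeas (dot_right q : angles -> R[i]).
Proof. by apply: bmeasM; [|apply: bmeas_conj]; exact: bmeas_spin_mono. Qed.

Lemma mono_norm_neq0 n l : (l <= n)%N -> mono_norm n l != 0 :> R.
Proof.
move=> ln; rewrite /mono_norm mulf_neq0// ?mulf_neq0 ?gt_eqF ?pi_gt0//.
by rewrite invr_gt0 mulr_gt0// ltr0n bin_gt0.
Qed.

(** Orthogonality keeps the M + 1 diagonal indices, each worth (4 pi / (M + 1))^2. *)
Lemma cint2_csq_dotX M : cint2 (fun x y => (csq (spin_dot x y) ^+ M)%:C)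
  = ((4 * pi) ^+ 2 / M.+1%:R)%:C.
Proof.
have -> : (fun x y => (csq (spin_dot x y) ^+ M)%:C) =
    (fun x y : R * R => \sum_q dot_left (M := M) q x * dot_right q y).
  by apply/funext => x; apply/funext => y; exact: csq_dotX.
rewrite (cint2_sum (@bmeas_dot_left M) (@bmeas_dot_right M)).
rewrite -(pair_bigA _ (fun s t => cint angle_measure (dot_left (s, t)) *
  cint angle_measure (dot_right (s, t))))/=.
have E (s t : 'I_M.+1) : cint angle_measure (dot_left (s, t)) *
    cint angle_measure (dot_right (s, t)) =
    (s == t)%:R * ((4 * pi / M.+1%:R) ^+ 2)%:C.
  have sM : (s <= M)%N by rewrite -ltnS. have tM : (t <= M)%N by rewrite -ltnS.
  rewrite cintZ; last by apply: bmeasM; [|apply: bmeas_conj]; exact: bmeas_spin_mono.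
  rewrite !cint_spin_mono// (eq_sym (t : nat)) val_eqE.
  have [->|_] := eqVneq s t; last by rewrite !mul0r mulr0.
  rewrite !mul1r -!realc_nat -!realcM; congr (_%:C).
  rewrite /mono_norm; field.
  rewrite nat1r !pnatr_eq0 /= -lt0n bin_gt0.
  exact: tM.
under eq_bigr => s _.
  under eq_bigr => t _ do rewrite E.
  rewrite (bigD1 s)//= eqxx mul1r big1 ?addr0; last first.
    by move=> t /negbTE ts; rewrite eq_sym ts mul0r.
  over.
rewrite sumr_const card_ord.
transitivity (M.+1%:R%:C * ((4 * pi / M.+1%:R) ^+ 2)%:C : R[i]).
  by rewrite -[LHS]mulr_natl; congr (_ * _); exact/esym/realc_nat.
rewrite -realcM.
by congr (_%:C); field.
Qed.

Section fixed_r.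
Variable n : nat.
Local Notation r := n.+1.

Definition spin_phi (l : 'I_r) : angles -> R[i] := spin_mono n l.
Definition spin_psi (l : 'I_r) (x : angles) : R[i] :=
  (mono_norm n l)^-1%:C * spin_phi l x.

Lemma bmeas_spin_phi l : bmeas (spin_phi l).
Proof. exact: bmeas_spin_mono. Qed.

Lemma bmeas_spin_psi l : bmeas (spin_psi l).
Proof. by apply: bmeasM; [exact: bmeas_cst|exact: bmeas_spin_phi]. Qed.

Lemma cint_psi_phi l m :
  cint angle_measure (fun x => spin_psi l x * conjc (spin_phi m x)) = (l == m)%:R.
Proof.
have ln : (l <= n)%N by rewrite -ltnS.
have mn : (m <= n)%N by rewrite -ltnS.
have b : bmeas (fun x => spin_phi l x * conjc (spin_phi m x)).
  by apply: bmeasM; [|apply: bmeas_conj]; exact: bmeas_spin_phi.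
rewrite (_ : (fun x => _) = fun x : angles =>
    (mono_norm n l)^-1%:C * (spin_phi l x * conjc (spin_phi m x))); last first.
  by apply/funext => x; rewrite mulrA.
rewrite cintZ// cint_spin_mono// -realcM val_eqE -realc_nat; congr (_%:C).
by rewrite mulrCA mulVf ?mulr1// mono_norm_neq0.
Qed.

Lemma csq_spin_detE (x : r.-tuple angles) : (csq (spin_det x))%:C =
  (\prod_(l < r) mono_norm n l)%:C * biorth_weight spin_phi spin_psi x.
Proof.
rewrite csqE /biorth_weight mulrA; congr (_ * conjc _).
rewrite /spin_det /determinant mulr_sumr; apply: eq_bigr => s _.
rewrite mulrCA; congr (_ * _).
rewrite realc_prod [X in X * _](reindex_inj (@perm_inj _ s)) -big_split.
apply: eq_bigr => i _.
transitivity ((mono_norm n (s i))%:C * spin_psi (s i) (tnth x i)); last by rewrite mxE.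
rewrite mxE /spin_psi mulrA -realcM divff ?mul1r//.
by rewrite mono_norm_neq0// -ltnS.
Qed.

Lemma cint_csq_det : cint (TM r) (fun x => (csq (spin_det x))%:C)
  = ((\prod_(l < r) mono_norm n l) * (r`!)%:R)%:C.
Proof.
rewrite (_ : (fun x => _) = fun x : r.-tuple angles =>
    (\prod_(l < r) mono_norm n l)%:C * biorth_weight spin_phi spin_psi x).
  rewrite cintZ.
    rewrite cint_biorth_weight ?realcM ?realc_nat//.
    - exact: bmeas_spin_phi.
    - exact: bmeas_spin_psi.
    - exact: cint_psi_phi.
  apply: bmeasM; last apply: bmeas_conj; apply: bmeas_sum => s _.
    apply: bmeasM; first exact: bmeas_cst.
    apply: bmeas_prod => i _; under eq_fun do rewrite mxE.
    exact: (bmeas_comp (@measurable_tnth _ angles r i) (bmeas_spin_psi _)).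
  apply: bmeasM; first exact: bmeas_cst.
  apply: bmeas_prod => i _; under eq_fun do rewrite mxE.
  exact: (bmeas_comp (@measurable_tnth _ angles r i) (bmeas_spin_phi _)).
by apply/funext => x; exact: csq_spin_detE.
Qed.

Local Notation kappa := (r%:R / (4 * pi) : R).

Lemma spin_psiE l x : spin_psi l x = kappa%:C * ('C(n, l)%:R * spin_phi l x).
Proof.
have ln : (l <= n)%N by rewrite -ltnS.
rewrite /spin_psi -realc_nat mulrA -realcM; congr (_%:C * _).
rewrite /mono_norm invf_div; ring.
Qed.

(** The kernel K of the ensemble. On the diagonal it is the constant kappa, r points over the area 4
    pi. *)
Lemma kernelE (x y : angles) :
  \sum_l spin_psi l x * conjc (spin_phi l y) = kappa%:C * spin_dot x y ^+ n.
Proof.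
rewrite spin_dotX mulr_sumr; apply: eq_bigr => l _.
by rewrite spin_psiE /spin_phi -!mulrA.
Qed.

Lemma spin_dotC (x y : angles) : spin_dot y x = conjc (spin_dot x y).
Proof.
rewrite /spin_dot; case: (spin1 x) (spin2 x) (spin1 y) (spin2 y) => a b [c e] [a' b'] [c' e'].
by apply/eqP; rewrite eq_complex /=; apply/andP; split; apply/eqP; ring.
Qed.

Lemma bmeas_csq_dotX M p (a b : 'I_p) : bmeas (fun x : p.-tuple angles =>
  (csq (spin_dot (tnth x a) (tnth x b)) ^+ M)%:C).
Proof.
under eq_fun do rewrite csq_dotX; apply: bmeas_sum => q _; apply: bmeasM.
  by apply: bmeas_comp (bmeas_dot_left q); exact: measurable_tnth.
by apply: bmeas_comp (bmeas_dot_right q); exact: measurable_tnth.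
Qed.

Lemma spin_dotxx (x : angles) : spin_dot x x = 1.
Proof. by rewrite /spin_dot -!csqE -realcD csq_spin. Qed.

(** In the sum of A l l * B m m - A l m * B m l, the first term only sees the diagonal of K and
    yields kappa^2 times the integral of w^M. The second reassembles |K|^2 = kappa^2 w^n and yields
    the moment of order M + n. Both are integrals over two independent points. *)
Lemma sum_cint_csq_det_dotX M :
  \sum_(a < r) \sum_(b < r | a != b) cint (TM r) (fun x =>
     (csq (spin_det x) * csq (spin_dot (tnth x a) (tnth x b)) ^+ M)%:C)
  = ((\prod_(l < r) mono_norm n l) * (r`!)%:R *
      (r%:R ^+ 2 * (M.+1%:R^-1 - (M + r)%:R^-1)))%:C.
Proof.
have bpp l m : bmeas (fun x : angles => spin_psi l x * conjc (spin_phi m x)).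
  by apply: bmeasM; [exact: bmeas_spin_psi|apply: bmeas_conj; exact: bmeas_spin_phi].
have bt (f : angles -> R[i]) i : bmeas f -> bmeas (fun x : r.-tuple angles => f (tnth x i)).
  by apply: bmeas_comp; exact: measurable_tnth.
have bw : bmeas (fun x : r.-tuple angles => biorth_weight spin_phi spin_psi x).
  under eq_fun do rewrite biorth_weightE.
  apply: bmeas_sum => s _; apply: bmeas_sum => t _.
  apply: bmeasM; first exact: bmeas_cst.
  by apply: bmeas_prod => i _; exact: (bt _ _ (bpp _ _)).
pose u := @dot_left M; pose v := @dot_right M.
have bu q : bmeas (u q) by exact: bmeas_dot_left.
have bv q : bmeas (v q) by exact: bmeas_dot_right.
transitivity ((\prod_(l < r) mono_norm n l)%:C * \sum_(a < r) \sum_(b < r | a != b)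
    cint (TM r) (fun x => biorth_weight spin_phi spin_psi x *
      \sum_q u q (tnth x a) * v q (tnth x b))).
  rewrite mulr_sumr; apply: eq_bigr => a _; rewrite mulr_sumr; apply: eq_bigr => b _.
  rewrite -cintZ; last first.
    apply: bmeasM => //; apply: bmeas_sum => q _.
    by apply: bmeasM; [exact: (bt _ a (bu q))|exact: (bt _ b (bv q))].
  congr cint; apply/funext => x.
  by rewrite mulrA -csq_spin_detE -csq_dotX -realcM.
rewrite (sum_cint_biorth_pairs bmeas_spin_phi bmeas_spin_psi cint_psi_phi bu bv).
rewrite mulrA -realc_nat -realcM [RHS]realcM; congr (_ * _).
have bA q l m : bmeas (fun x : angles => spin_psi l x * conjc (spin_phi m x) * u q x).
  by apply: bmeasM; [exact: bpp|exact: bu].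
have bB q l m : bmeas (fun x : angles => spin_psi l x * conjc (spin_phi m x) * v q x).
  by apply: bmeasM; [exact: bpp|exact: bv].
have trace (w : angles -> R[i]) : bmeas w ->
    \sum_l cint angle_measure (fun x => spin_psi l x * conjc (spin_phi l x) * w x)
    = kappa%:C * cint angle_measure w.
  move=> bw'; rewrite -cint_sum; last by move=> l _; apply: bmeasM.
  rewrite -cintZ//; congr cint; apply/funext => x.
  by rewrite -mulr_suml kernelE spin_dotxx expr1n mulr1.
transitivity ((kappa ^+ 2)%:C * cint2 (fun x y => (csq (spin_dot x y) ^+ M)%:C) -
  (kappa ^+ 2)%:C * cint2 (fun x y => (csq (spin_dot x y) ^+ (M + n))%:C)); last first.
  rewrite !cint2_csq_dotX -!realcM -realcB; congr (_%:C).
  have : pi != 0 :> R by rewrite gt_eqF ?pi_gt0.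
  move: pi => p p0; rewrite addnS; field.
  by rewrite p0 -natrD !nat1r !pnatr_eq0.
have -> : cint2 (fun x y => (csq (spin_dot x y) ^+ M)%:C) =
    \sum_q cint angle_measure (u q) * cint angle_measure (v q).
  rewrite -(cint2_sum bu bv); congr cint2; apply/funext => x; apply/funext => y.
  exact: csq_dotX.
pose U (p : ('I_M.+1 * 'I_M.+1) * ('I_r * 'I_r)) (x : angles) :=
  spin_psi p.2.1 x * conjc (spin_phi p.2.2 x) * u p.1 x.
pose V (p : ('I_M.+1 * 'I_M.+1) * ('I_r * 'I_r)) (x : angles) :=
  spin_psi p.2.2 x * conjc (spin_phi p.2.1 x) * v p.1 x.
have -> : (kappa ^+ 2)%:C * cint2 (fun x y => (csq (spin_dot x y) ^+ (M + n))%:C) =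
    \sum_p cint angle_measure (U p) * cint angle_measure (V p).
  rewrite -(cint2_sum (fun p => bA _ _ _) (fun p => bB _ _ _)).
  rewrite /cint2 -cintZ; last exact: bmeas_csq_dotX.
  congr cint; apply/funext => t; move: (tnth t ord0) (tnth t ord_max) => x y.
  rewrite exprD realcM csq_dotX.
  (* Written this way, w^n supplies one kernel for each of the sums over l and m. *)
  have -> : (csq (spin_dot x y) ^+ n)%:C = spin_dot x y ^+ n * spin_dot y x ^+ n.
    by rewrite realcX csqE -(spin_dotC x y); exact: exprMn.
  rewrite realcX mulrCA (_ : kappa%:C ^+ 2 * _ =
    (kappa%:C * spin_dot x y ^+ n) * (kappa%:C * spin_dot y x ^+ n)); last by ring.
  rewrite -!kernelE big_distrlr pair_bigA /= big_distrlr pair_bigA /=.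
  have rearrange (a b c e f g : R[i]) : a * b * (c * e * (f * g)) = c * g * a * (f * e * b).
    by ring.
  by apply: eq_bigr => p _; exact: rearrange.
rewrite -(pair_bigA _ (fun q lm => cint angle_measure (U (q, lm)) *
   cint angle_measure (V (q, lm)))) mulr_sumr -sumrB.
apply: eq_bigr => q _.
transitivity ((kappa%:C * cint angle_measure (u q)) * (kappa%:C * cint angle_measure (v q))
  - \sum_lm cint angle_measure (U (q, lm)) * cint angle_measure (V (q, lm))); last first.
  by rewrite realcX; congr (_ - _); ring.
transitivity ((\sum_l cint angle_measure (fun x => spin_psi l x * conjc (spin_phi l x) * u q x))
  * (\sum_l cint angle_measure (fun x => spin_psi l x * conjc (spin_phi l x) * v q x))
  - \sum_lm cint angle_measure (U (q, lm)) * cint angle_measure (V (q, lm))); last first.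
  by congr (_ * _ - _); [exact: (trace _ (bu q))|exact: (trace _ (bv q))].
rewrite big_distrlr.
rewrite -(pair_bigA _ (fun l m => cint angle_measure (U (q, (l, m))) *
   cint angle_measure (V (q, (l, m))))) -sumrB.
apply: eq_bigr => l _; rewrite -sumrB; apply: eq_bigr => m _.
by rewrite !mxE.
Qed.

End fixed_r.
End spherical_pairs.

(** * Uniform approximation and moments *)

Section moments.
Context d (T : measurableType d) (R : realType) (m : {measure set T -> \bar R}).
Variables (D : set T) (u g : T -> R) (K : R).
Hypotheses (mD : measurable D) (Dfin : (m D < +oo)%E).
Hypotheses (mu : measurable_fun D u) (mg : measurable_fun D g).
Hypothesis u01 : forall x, D x -> 0 <= u x <= 1.
Hypothesis gK : forall x, D x -> `|g x| <= K.

Lemma comp_integrable (F : R -> R) C : measurable_fun setT F ->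
  (forall x, 0 <= x <= 1 -> `|F x| <= C) ->
  m.-integrable D (EFin \o (fun x => F (u x) * g x)).
Proof.
move=> mF FC; apply: measurable_bounded_integrable => //.
  by apply: measurable_funM => //; exact: (measurableT_comp mF).
exists (C * K); split; first exact: num_real.
move=> y Cy x Dx /=; rewrite normrM (le_trans _ (ltW Cy))//.
by rewrite ler_pM// ?FC ?u01 ?gK.
Qed.

Lemma monomial_integrable i : m.-integrable D (EFin \o (fun x => u x ^+ i * g x)).
Proof.
apply: (@comp_integrable (fun x => x ^+ i) 1); first exact: exprn_measurable.
by move=> x /andP[x0 x1]; rewrite normrX ger0_norm// exprn_ile1.
Qed.

Lemma Rintegral_horner (p : {poly R}) :
  \int[m]_(x in D) (p.[u x] * g x)
    = \sum_(i < size p) p`_i * \int[m]_(x in D) (u x ^+ i * g x).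
Proof.
transitivity (\int[m]_(x in D) \sum_(i < size p) p`_i * (u x ^+ i * g x)).
  apply: eq_Rintegral => x _; rewrite horner_coef mulr_suml.
  by apply: eq_bigr => i _; rewrite mulrA.
rewrite Rintegral_sum//.
  by apply: eq_bigr => i _; rewrite RintegralZl//; exact: monomial_integrable.
by move=> i; have := integrableZl mD p`_i (monomial_integrable i); apply.
Qed.

Lemma Rintegral_horner_close (F : R -> R) C (p : {poly R}) e : measurable_fun setT F ->
  (forall x, 0 <= x <= 1 -> `|F x| <= C) ->
  {in `[0, 1], forall x, `|F x - p.[x]| <= e} ->
  `|\int[m]_(x in D) (F (u x) * g x) - \int[m]_(x in D) (p.[u x] * g x)|
    <= e * K * fine (m D).
Proof.
move=> mF FC Fp; have iF := comp_integrable mF FC.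
have ip : m.-integrable D (EFin \o (fun x => p.[u x] * g x)).
  apply: (@comp_integrable (horner p) (C + e)).
    by apply: continuous_measurable_fun; exact: continuous_horner.
  move=> x x01; have := FC x x01.
  have := Fp x; rewrite in_itv/= => /(_ x01).
  by rewrite !ler_norml => /andP[? ?] /andP[? ?]; apply/andP; split; lra.
rewrite -RintegralB//; apply: le_trans (le_normr_Rintegral mD _) _.
  by have := integrableB mD iF ip; apply: eq_integrable.
rewrite -Rintegral_cst//; apply: le_Rintegral => //.
- by have := integrableB mD iF ip => /integrable_abse; apply: eq_integrable.
- apply: measurable_bounded_integrable => //; exists `|e * K|; split; first exact: num_real.
  by move=> y Cy x Dx /=; rewrite ltW.
move=> x Dx; rewrite -mulrBl normrM ler_pM//; last exact: gK.
by apply: Fp; rewrite in_itv/=; exact: u01.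
Qed.

End moments.

(** Equality of moments extends to polynomials by linearity, then to F: with bounded weights on sets
    of finite measure, a uniform error e costs at most e * B. A whole family indexed by q is allowed
    because only the sum over pairs of points has known moments. *)
Lemma moments_determine d1 d2 (T1 : measurableType d1) (T2 : measurableType d2)
    (R : realType) (m1 : {measure set T1 -> \bar R}) (m2 : {measure set T2 -> \bar R})
    (D1 : set T1) (D2 : set T2) (Q : finType) (A : pred Q) (u : Q -> T1 -> R) (g : T1 -> R)
    (v h : T2 -> R) (K L a : R) (F : R -> R) :
  measurable D1 -> (m1 D1 < +oo)%E -> measurable D2 -> (m2 D2 < +oo)%E ->
  (forall q, measurable_fun D1 (u q)) -> measurable_fun D1 g ->
  measurable_fun D2 v -> measurable_fun D2 h ->
  (forall q x, D1 x -> 0 <= u q x <= 1) -> (forall x, D1 x -> `|g x| <= K) ->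
  (forall x, D2 x -> 0 <= v x <= 1) -> (forall x, D2 x -> `|h x| <= L) ->
  (forall i, \sum_(q | A q) \int[m1]_(x in D1) (u q x ^+ i * g x)
     = a * \int[m2]_(x in D2) (v x ^+ i * h x)) ->
  measurable_fun setT F ->
  {in `[0, 1] &, forall x y, `|F x - F y| <= Num.sqrt `|x - y|} ->
  \sum_(q | A q) \int[m1]_(x in D1) (F (u q x) * g x)
    = a * \int[m2]_(x in D2) (F (v x) * h x).
Proof.
move=> mD1 fD1 mD2 fD2 mu mg mv mh u01 gK v01 hL H mF Fmod.
pose B := \sum_(q | A q) K * fine (m1 D1) + `|a| * (L * fine (m2 D2)).
have FC x : 0 <= x <= 1 -> `|F x| <= `|F 0| + 1.
  move=> x01; have := Fmod x 0; rewrite !in_itv/= x01 lexx ler01 subr0 => /(_ isT isT) h1.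
  have : Num.sqrt `|x| <= 1.
    by rewrite -[leRHS]sqrtr1 ler_sqrt//; case/andP: x01 => *; rewrite ger0_norm.
  have := ler_normD (F x - F 0) (F 0); rewrite subrK; lra.
suff H2 e : 0 < e -> `|\sum_(q | A q) \int[m1]_(x in D1) (F (u q x) * g x)
    - a * \int[m2]_(x in D2) (F (v x) * h x)| <= e * B.
  apply/eqP; rewrite -subr_eq0 -normr_le0; apply/ler_addgt0Pr => e e0; rewrite add0r.
  have B1 : 0 < `|B| + 1 by rewrite ltr_wpDl.
  apply: le_trans (H2 (e / (`|B| + 1)) _) _; first by rewrite divr_gt0.
  rewrite mulrAC ler_pdivrMr// ler_pM2l//.
  by rewrite (le_trans (ler_norm B))// lerDl.
move=> e0; have [p Fp] := poly_approx e0 Fmod.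
have pE : \sum_(q | A q) \int[m1]_(x in D1) (p.[u q x] * g x)
    = a * \int[m2]_(x in D2) (p.[v x] * h x).
  rewrite (Rintegral_horner mD2 fD2 mv mh v01 hL).
  under eq_bigr => q _ do rewrite (Rintegral_horner mD1 fD1 (mu q) mg (u01 q) gK).
  rewrite exchange_big mulr_sumr; apply: eq_bigr => i _.
  by rewrite -mulr_sumr H mulrCA.
rewrite -[X in X - _](subrK (\sum_(q | A q) \int[m1]_(x in D1) (p.[u q x] * g x))).
rewrite -addrA {2}pE -mulrBr -sumrB; apply: le_trans (ler_normD _ _) _.
have -> : e * B = \sum_(q | A q) e * K * fine (m1 D1) + `|a| * (e * L * fine (m2 D2)).
  rewrite [LHS]mulrDr mulr_sumr; congr (_ + _); last by ring.
  by apply: eq_bigr => q _; rewrite mulrA.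
apply: lerD.
  apply: le_trans (ler_norm_sum _ _ _) _; apply: ler_sum => q _.
  exact: (Rintegral_horner_close mD1 fD1 (mu q) mg (u01 q) gK mF FC Fp).
rewrite normrM ler_wpM2l// distrC.
exact: (Rintegral_horner_close mD2 fD2 mv mh v01 hL mF FC Fp).
Qed.

(** * The spherical ensemble *)

Lemma measurable_edist d (T : measurableType d) (R : realType) n (f g : T -> n.-tuple R) :
  measurable_fun setT f -> measurable_fun setT g ->
  measurable_fun setT (fun x => Defs.edist (f x) (g x)).
Proof.
move=> mf mg.
have ms : measurable_fun setT (@Num.sqrt R).
  by apply: continuous_measurable_fun; exact: sqrt_continuous.
apply: (measurableT_comp ms); apply: measurable_sum => i; apply: measurable_funX.
by apply: measurable_funB; apply: (measurableT_comp (measurable_tnth i)).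
Qed.

Section spherical_law.
Local Open Scope complex_scope.
Context {R : realType} {d : measure_display} {T : measurableType d}.
Context {P : probability T R} (n : nat).
Local Notation r := n.+1.
Local Notation angles := (measurableTypeR R * measurableTypeR R)%type.
Local Notation TM := (@tuple_measure _ angles R angle_measure r).
Local Notation SM := (@tuple_measure _ (3.-tuple R) R surface_measure r).

Definition sph_tuple (x : r.-tuple angles) : r.-tuple (3.-tuple R) :=
  map_tuple (@sph_coord R) x.

Lemma measurable_sph_tuple : measurable_fun setT sph_tuple.
Proof.
apply/measurable_fun_tnthP => i; rewrite (_ : _ \o _ = fun x => sph_coord (tnth x i)).
  exact: (measurableT_comp measurable_sph_coord (measurable_tnth i)).
by apply/funext => x; rewrite /= tnth_map.
Qed.

Lemma measurable_spherical_weight :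
  measurable_fun setT (spherical_weight : r.-tuple (3.-tuple R) -> R).
Proof.
apply: measurable_prod => i _; under eq_fun do rewrite big_mkcond.
apply: measurable_prod => j _; case: (i < j)%N; last exact: measurable_cst.
apply: measurable_funX; apply: measurable_edist; exact: measurable_tnth.
Qed.

Lemma spherical_weight_ge0 (y : r.-tuple (3.-tuple R)) : 0 <= spherical_weight y.
Proof. by apply: prodr_ge0 => i _; apply: prodr_ge0 => j _; exact: sqr_ge0. Qed.

Lemma bmeas_spin_det : bmeas (fun x : r.-tuple angles => spin_det x).
Proof.
apply: bmeas_sum => s _; apply: bmeasM; first exact: bmeas_cst.
apply: bmeas_prod => i _; under eq_fun do rewrite mxE.
apply: bmeas_comp (bmeas_spin_mono _ _); exact: measurable_tnth.
Qed.

Lemma bmeas_csq d' (T' : measurableType d') (f : T' -> R[i]) : bmeas f ->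
  measurable_fun setT (fun x => csq (f x)) /\ exists K, forall x, `|csq (f x)| <= K.
Proof.
move=> [f1 f2 [K fK]]; split; last by exists K => x; rewrite ger0_norm ?csq_ge0.
rewrite (_ : (fun x => _) = fun x => complex.Re (f x) ^+ 2 + complex.Im (f x) ^+ 2).
  by apply: measurable_funD; exact: measurable_funX.
by apply/funext => x; case: (f x).
Qed.

Variable Y : {RV P >-> r.-tuple (3.-tuple R)}.
Hypothesis hY : spherical_ensemble Y.

Let total_mass : R := (\prod_(l < r) mono_norm n l) * (r`!)%:R.

Lemma Rintegral_csq_det : \int[TM]_x csq (spin_det x) = total_mass.
Proof. by have := cint_csq_det (R := R) n; rewrite cint_real => -[]. Qed.

Lemma spherical_ensemble_density : exists2 c : R, 0 <= c &
  forall C, measurable C -> distribution P Y C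
    = (\int[TM]_(x in sph_tuple @^-1` C) (c * csq (spin_det x))%:E)%E.
Proof.
have [c hc] := hY.
have mw : measurable_fun setT (EFin \o (spherical_weight : r.-tuple (3.-tuple R) -> R)).
  by apply/measurable_EFinP; exact: measurable_spherical_weight.
(* The definition leaves the sign of c open, but c < 0 would make the total mass at most 0. With c
   >= 0 the constant can be absorbed into a density. *)
have c0 : 0 <= c.
  have := hc _ measurableT; rewrite probability_setT => h.
  rewrite leNgt; apply/negP => c0.
  have : (c%:E * \int[SM]_y (spherical_weight y)%:E <= 0)%E.
    apply: mule_le0_ge0; first by rewrite lee_fin ltW.
    by apply: integral_ge0 => y _; rewrite lee_fin spherical_weight_ge0.
  by rewrite -h lee_fin ler10.
have SME A : measurable A -> SM A = TM (sph_tuple @^-1` A).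
  apply: tuple_measure_pushforward; first exact: measurable_sph_coord.
  by move=> B _; exact: surface_measureE.
exists (c * \prod_(i < r) \prod_(j < r | (i < j)%N) 4) => [|C mC].
  by rewrite mulr_ge0// prodr_ge0// => i _; rewrite prodr_ge0.
rewrite hc// -ge0_integralZl_EFin//; last 2 first.
  by move=> y _; rewrite lee_fin spherical_weight_ge0.
  exact: measurable_funTS.
rewrite integral_mkcond (ge0_integral_image measurable_sph_tuple SME); last 2 first.
- apply/(measurable_restrictT _ _).1 => //; apply: measurable_funTS.
  exact: measurable_funeM.
- by move=> y; rewrite patchE; case: ifP => // _; rewrite mule_ge0// lee_fin spherical_weight_ge0.
rewrite [RHS]integral_mkcond; apply: eq_integral => x _.
rewrite !patchE; have -> : (x \in sph_tuple @^-1` C) = (sph_tuple x \in C) by [].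
by case: ifP => // _; rewrite spherical_weightE -EFinM mulrA.
Qed.

Lemma spherical_ensemble_null (B : set (r.-tuple (3.-tuple R))) : measurable B ->
  (forall x, B (sph_tuple x) -> spin_det x = 0) -> P (Y @^-1` B) = 0%E.
Proof.
move=> mB B0; have [c c0 hc] := spherical_ensemble_density.
rewrite -[LHS]/(distribution P Y B) hc//; apply: integral0_eq => x /B0 ->.
by rewrite /csq /= expr0n /= addr0 mulr0.
Qed.

(** The normalization is read off at f = 1. Boundedness is required only on images of coordinates,
    since the functions of [chordal_dot] used later are unbounded off the sphere. *)
Lemma spherical_expectation : exists2 c : R, c * total_mass = 1 &
  forall f : r.-tuple (3.-tuple R) -> R, measurable_fun setT f ->
    (exists K, forall x, `|f (sph_tuple x)| <= K) ->
  P.-integrable setT (EFin \o (f \o Y)) /\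
  \int[P]_w f (Y w) = c * \int[TM]_x (f (sph_tuple x) * csq (spin_det x)).
Proof.
have [c c0 hc] := spherical_ensemble_density.
have [mdet [K detK]] := bmeas_csq bmeas_spin_det.
pose h x := c * csq (spin_det (x : r.-tuple angles)).
have mh : measurable_fun setT h by exact: measurable_funM.
have hK x : `|h x| <= c * K by rewrite normrM ger0_norm// ler_wpM2l.
have hi : TM.-integrable setT (EFin \o h) by exact: bounded_integrable hK.
have h0 x : 0 <= h x by rewrite mulr_ge0 ?csq_ge0.
pose lam := [the {measure set (r.-tuple angles) -> \bar R} of density_measure h0 hi].
have lamE A : measurable A -> lam A = (\int[TM]_(x in A) (h x)%:E)%E by [].
have hcl A : measurable A -> distribution P Y A = lam (sph_tuple @^-1` A).
  exact: hc.
have main (f : r.-tuple (3.-tuple R) -> R) : measurable_fun setT f ->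
    (exists K, forall x, `|f (sph_tuple x)| <= K) ->
  P.-integrable setT (EFin \o (f \o Y)) /\
  \int[P]_w f (Y w) = c * \int[TM]_x (f (sph_tuple x) * csq (spin_det x)).
  move=> mf [L fL].
  have mfs : measurable_fun setT (f \o sph_tuple).
    exact: (measurableT_comp mf measurable_sph_tuple).
  have ifd : TM.-integrable setT (EFin \o (fun x => f (sph_tuple x) * csq (spin_det x))).
    apply: (@bounded_integrable _ _ _ _ _ (L * K)); first exact: measurable_funM.
    by move=> x; rewrite normrM ler_pM.
  have ifh : TM.-integrable setT (fun x => (f (sph_tuple x) * h x)%:E).
    have := integrableZl measurableT c ifd; apply: eq_integrable => // x _ /=.
    by rewrite -EFinM /h mulrCA.
  have il : lam.-integrable setT (EFin \o (f \o sph_tuple)).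
    exact: (integrable_density mh h0 lamE mfs ifh).
  have idist : (distribution P Y).-integrable setT (EFin \o f).
    exact: (integrable_image measurable_sph_tuple hcl mf il).
  have iP : P.-integrable setT (EFin \o (f \o Y)).
    apply/integrableP; split.
      by apply/measurable_EFinP; exact: (measurableT_comp mf).
    have /integrableP[_] := idist.
    rewrite (ge0_integral_image (mu := P) (phi := Y))//.
    by apply: measurableT_comp => //; exact/measurable_EFinP.
  split=> //.
  rewrite -(Rintegral_image (nu := distribution P Y) _ _ mf iP)//.
  rewrite (Rintegral_image measurable_sph_tuple hcl mf il).
  rewrite (Rintegral_density mh h0 lamE mfs ifh) -RintegralZl//.
  by apply: eq_Rintegral => x _; rewrite /h mulrCA.
exists c => //.
have [|_] := main (fun=> 1) (measurable_cst _); first by exists 1 => x; rewrite normr1.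
have -> : \int[P]_w (fun=> 1 : R) (Y w) = 1.
  rewrite (Rintegral_cst P measurableT 1). rewrite mul1r.
  exact: (congr1 fine (probability_setT P)).
move=> ->.
by rewrite -Rintegral_csq_det; congr (_ * _); apply: eq_Rintegral => x _; rewrite mul1r.
Qed.

End spherical_law.

(** * The averaged potential ln (1 + sqrt (1 - w)) *)

Section ln_onem_sqrt.
Context {R : realType}.
Local Notation mu := (@lebesgue_measure R).

Definition ln_onem_sqrt (w : R) : R := ln (1 + Num.sqrt (1 - w)).

Lemma measurable_ln_onem_sqrt : measurable_fun setT ln_onem_sqrt.
Proof.
apply: (measurableT_comp (@measurable_ln R)); apply: measurable_funD => //.
have ms : measurable_fun setT (@Num.sqrt R).
  by apply: continuous_measurable_fun; exact: sqrt_continuous.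
by apply: (measurableT_comp ms); exact: measurable_funB.
Qed.

Lemma ln_onem_sqrt_bounds w : 0 <= w <= 1 -> 0 <= ln_onem_sqrt w <= ln 2.
Proof.
move=> /andP[w0 w1]; have s0 := sqrtr_ge0 (1 - w).
rewrite ln_ge0 ?lerDl// ler_ln ?posrE ?ltr_wpDr//.
have : Num.sqrt (1 - w) <= 1 by rewrite -[leRHS]sqrtr1 ler_sqrt//; lra.
lra.
Qed.

(** The logarithm is 1-Lipschitz on [1, +oo[, and (a - b)^2 <= a^2 - b^2 for 0 <= b <= a. This is
    the modulus of continuity that [poly_approx] asks for. *)
Lemma ln_onem_sqrt_modulus :
  {in `[0, 1] &, forall x y, `|ln_onem_sqrt x - ln_onem_sqrt y| <= Num.sqrt `|x - y|}.
Proof.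
move=> x y; rewrite !in_itv/= => /andP[x0 x1] /andP[y0 y1].
wlog xy : x y x0 x1 y0 y1 / x <= y.
  move=> h; have [|/ltW] := leP x y; first exact: h.
  by move=> yx; rewrite distrC (distrC x); exact: h.
rewrite /ln_onem_sqrt; set a := Num.sqrt (1 - x); set b := Num.sqrt (1 - y).
have b0 : 0 <= b by exact: sqrtr_ge0.
have ba : b <= a by rewrite ler_sqrt; lra.
have a2 : a ^+ 2 = 1 - x by rewrite sqr_sqrtr// subr_ge0.
have b2 : b ^+ 2 = 1 - y by rewrite sqr_sqrtr// subr_ge0.
have lt0 : 0 < 1 + b by rewrite ltr_pwDl.
have le1 : ln (1 + a) - ln (1 + b) <= a - b.
  rewrite -ln_div ?posrE//; last by lra.
  have -> : (1 + a) / (1 + b) = 1 + (a - b) / (1 + b) by field; rewrite gt_eqF.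
  apply: le_trans (le_ln1Dx _) _.
    apply: lt_le_trans (ltrN10 R) _.
    by rewrite divr_ge0 ?subr_ge0 ?(ltW lt0).
  by rewrite ler_pdivrMr// ler_peMr ?subr_ge0//; lra.
have le0 : 0 <= ln (1 + a) - ln (1 + b) by rewrite subr_ge0 ler_ln ?posrE//; lra.
rewrite ger0_norm// (le_trans le1)//.
rewrite -[a - b]ger0_norm ?subr_ge0// -sqrtr_sqr ler_sqrt// distrC ger0_norm ?subr_ge0//.
have -> : y - x = a ^+ 2 - b ^+ 2 by rewrite a2 b2; ring.
by nra.
Qed.

Lemma Rintegral_ln_onem_sqrt n :
  \int[mu]_(v in `[0, 1]) (ln_onem_sqrt (1 - v ^+ 2) * (2 * v * (1 - (1 - v ^+ 2) ^+ n)))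
    = 1 / 2 - (onem_sqr_int n - (2 * n.+1%:R)^-1) / n.+1%:R.
Proof.
have cf k (v : R) : 0 <= v <= 1 ->
    {for v, continuous (fun v : R => ln (1 + v) * (2 * v * (1 - v ^+ 2) ^+ k))}.
  move=> /andP[v0 _]; apply: continuous_fM.
    apply: continuous_comp; last by apply: continuous_ln; rewrite ltr_pwDl.
    by apply: continuousD; [exact: cst_continuous|exact: cvg_id].
  apply: continuous_fM; last exact: continuous_onem_sqrX.
  by apply: continuous_fM; [exact: cst_continuous|exact: cvg_id].
have W0 : onem_sqr_int 0 = 1 :> R.
  rewrite /onem_sqr_int; under eq_Rintegral do rewrite expr0.
  by rewrite Rintegral_itv_cst// mul1r subr0.
transitivity (\int[mu]_(v in `[0, 1]) (1 * (ln (1 + v) * (2 * v * (1 - v ^+ 2) ^+ 0))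
    - 1 * (ln (1 + v) * (2 * v * (1 - v ^+ 2) ^+ n)))).
  apply: eq_Rintegral => v; rewrite inE/= in_itv/= => /andP[v0 v1].
  rewrite /ln_onem_sqrt subKr sqrtr_sqr ger0_norm// expr0; ring.
rewrite (Rintegral_lin_comb 1 1 (cf 0%N) (cf n)) !Rintegral_ln_onem_sqr W0 !mul1r.
by congr (_ - _); field.
Qed.

Lemma Rintegral_onem_sqr_diff n i :
  \int[mu]_(v in `[0, 1]) ((1 - v ^+ 2) ^+ i * (2 * v * (1 - (1 - v ^+ 2) ^+ n)))
    = i.+1%:R^-1 - (i + n.+1)%:R^-1.
Proof.
have cf k (v : R) : {for v, continuous (fun v : R => 2 * v * (1 - v ^+ 2) ^+ k)}.
  apply: continuous_fM; last exact: continuous_onem_sqrX.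
  by apply: continuous_fM; [exact: cst_continuous|exact: cvg_id].
transitivity (\int[mu]_(v in `[0, 1]) (1 * (2 * v * (1 - v ^+ 2) ^+ i)
    - 1 * (2 * v * (1 - v ^+ 2) ^+ (i + n)))).
  by apply: eq_Rintegral => v _; rewrite exprD; ring.
rewrite (Rintegral_lin_comb 1 1 (fun v _ => cf i v) (fun v _ => cf (i + n)%N v)).
by rewrite !Rintegral_onem_sqr_moment !mul1r addnS.
Qed.

End ln_onem_sqrt.

(** * The sum over pairs of base points *)

Section pair_expectation.
Context {R : realType} {d : measure_display} {T : measurableType d}.
Context {P : probability T R} (n : nat).
Local Notation r := n.+1.
Local Notation angles := (measurableTypeR R * measurableTypeR R)%type.
Local Notation TM := (@tuple_measure _ angles R angle_measure r).
Local Notation mu := (@lebesgue_measure R).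
Variable Y : {RV P >-> r.-tuple (3.-tuple R)}.
Hypothesis hY : spherical_ensemble Y.

Definition chordal_dot (p q : 3.-tuple R) : R := 1 - Defs.edist p q ^+ 2 / 4.

Lemma chordal_dot_sph (x y : R * R) :
  chordal_dot (sph_coord x) (sph_coord y) = csq (spin_dot x y).
Proof. by rewrite /chordal_dot edist_sph_coord csq_spin_dot; congr (_ - _); field. Qed.

Lemma csq_spin_dot01 (x y : R * R) : 0 <= csq (spin_dot x y) <= 1.
Proof. by rewrite csq_ge0 csq_spin_dot lerBlDr lerDl csq_ge0. Qed.

Lemma measurable_chordal_dot (i j : 'I_r) : measurable_fun setT
  (fun y : r.-tuple (3.-tuple R) => chordal_dot (tnth y i) (tnth y j)).
Proof.
apply: measurable_funB => //; apply: measurable_funM => //; apply: measurable_funX.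
by apply: measurable_edist; exact: measurable_tnth.
Qed.

Lemma pair_expectation_integrable i j : P.-integrable setT
  (EFin \o (fun w => ln_onem_sqrt (chordal_dot (tnth (Y w) i) (tnth (Y w) j)))).
Proof.
have [c _ hc] := spherical_expectation hY.
have [||iP _] := hc (fun y => ln_onem_sqrt (chordal_dot (tnth y i) (tnth y j))).
- exact: (measurableT_comp measurable_ln_onem_sqrt (measurable_chordal_dot i j)).
- exists (ln 2) => x; rewrite !tnth_map chordal_dot_sph.
  by have /ln_onem_sqrt_bounds/andP[h0 h1] := csq_spin_dot01 (tnth x i) (tnth x j);
      rewrite ger0_norm.
exact: iP.
Qed.

Lemma sum_pair_expectation :
  \sum_(i < r) \sum_(j < r | i != j)
     \int[P]_w ln_onem_sqrt (chordal_dot (tnth (Y w) i) (tnth (Y w) j))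
  = r%:R ^+ 2 / 2 - r%:R * onem_sqr_int n + 1 / 2.
Proof.
have [c c1 hc] := spherical_expectation hY.
pose m : R := (\prod_(l < r) mono_norm n l) * (r`!)%:R.
have E i j : \int[P]_w ln_onem_sqrt (chordal_dot (tnth (Y w) i) (tnth (Y w) j)) =
    c * \int[TM]_x (ln_onem_sqrt (csq (spin_dot (tnth x i) (tnth x j))) * csq (spin_det x)).
  have [||_ ->] := hc (fun y => ln_onem_sqrt (chordal_dot (tnth y i) (tnth y j))).
  - exact: (measurableT_comp measurable_ln_onem_sqrt (measurable_chordal_dot i j)).
  - exists (ln 2) => x; rewrite !tnth_map chordal_dot_sph.
    by have /ln_onem_sqrt_bounds/andP[h0 h1] := csq_spin_dot01 (tnth x i) (tnth x j);
      rewrite ger0_norm.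
  by congr (_ * _); apply: eq_Rintegral => x _; rewrite !tnth_map chordal_dot_sph.
under eq_bigr => i _ do under eq_bigr => j _ do rewrite E.
pose u (q : 'I_r * 'I_r) (x : r.-tuple angles) := csq (spin_dot (tnth x q.1) (tnth x q.2)).
transitivity (c * \sum_(q : 'I_r * 'I_r | q.1 != q.2)
    \int[TM]_x (ln_onem_sqrt (u q x) * csq (spin_det x))).
  by rewrite (pair_big_dep xpredT (fun i j => i != j)) mulr_sumr.
have mu_u q : measurable_fun setT (u q).
  by have [m1 _ _] := bmeas_csq_dotX (R := R) 1 q.1 q.2; exact: m1.
have [mdet [K detK]] := bmeas_csq (bmeas_spin_det (R := R) n).
have cont_mfun (f : R -> R) : continuous f -> measurable_fun (`[0 : R, 1]%classic) f.
  by move=> cf; apply: measurable_funTS; exact: continuous_measurable_fun.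
have cX k := @continuous_onem_sqrX R k.
have c2 : continuous (fun v : R => 2 * v).
  by move=> v; apply: (@continuous_fM _ (fun=> 2)); [exact: cst_continuous|exact: cvg_id].
(* The factor m * r^2 is the one in front of the difference of inverses in [sum_cint_csq_det_dotX];
   afterwards c * m = 1 removes m. K and 2 bound the two weights. *)
rewrite (@moments_determine _ _ _ _ R TM mu setT (`[0 : R, 1]%classic) _ _ u
  (fun x => csq (spin_det x)) (fun v => 1 - v ^+ 2)
  (fun v => 2 * v * (1 - (1 - v ^+ 2) ^+ n)) K 2 (m * r%:R ^+ 2)).
- rewrite Rintegral_ln_onem_sqrt -[m * _ * _]mulrA mulrA (c1 : c * m = 1) mul1r.
  by field; rewrite nat1r pnatr_eq0.
- by [].
- by have := fin_num_measure TM setT measurableT; rewrite ge0_fin_numE.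
- by [].
- have := lebesgue_measure_itv (`[0 : R, 1]); rewrite /= lte_fin ltr01 => h.
  by rewrite [ltLHS]h -EFinD ltry.
- exact: mu_u.
- exact: mdet.
- by apply: cont_mfun => v; exact: (cX 1%N v).
- apply: cont_mfun => v; apply: (@continuous_fM _ (fun v => 2 * v)); first exact: c2.
  by apply: continuousB; [exact: cst_continuous|exact: cX].
- by move=> q x _; exact: csq_spin_dot01.
- by move=> x _; exact: detK.
- move=> v; rewrite /= in_itv/= => /andP[v0 v1]; apply/andP; split.
    by rewrite subr_ge0 expr_le1.
  by rewrite lerBlDr lerDl sqr_ge0.
- move=> v; rewrite /= in_itv/= => /andP[v0 v1].
  have w0 : 0 <= 1 - v ^+ 2 by rewrite subr_ge0 expr_le1.
  have w1 : 1 - v ^+ 2 <= 1 by rewrite lerBlDr lerDl sqr_ge0.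
  have := exprn_ile1 n w0 w1; have := exprn_ge0 n w0; move: (_ ^+ n) => z z0 z1.
  by rewrite ger0_norm; nra.
- move=> i; rewrite Rintegral_onem_sqr_diff -mulrA.
  have := sum_cint_csq_det_dotX (R := R) n i.
  rewrite (pair_big_dep xpredT (fun i j => i != j)) /= => h.
  apply: (@complexI R); rewrite -[RHS]h rmorph_sum; apply: eq_bigr => q _.
  transitivity (cint TM (fun x => (u q x ^+ i * csq (spin_det x))%:C%C)).
    exact/esym/cint_real.
  by congr cint; apply/funext => x; rewrite mulrC.
- exact: measurable_ln_onem_sqrt.
- exact: ln_onem_sqrt_modulus.
Qed.

End pair_expectation.

(** * Rotated fibres *)

Section independence.
Local Open Scope ereal_scope.
Context {R : realType} {d : measure_display} {T : measurableType d}.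
Variable P : probability T R.

(** Both sides are finite measures of B: the law of the pair restricted to W, and its law scaled by
    P W. Rectangles generate and are stable under intersection, so agreement on them suffices. *)
Lemma indep_pair d1 d2 (T1 : measurableType d1) (T2 : measurableType d2)
    (Z1 : T -> T1) (Z2 : T -> T2) (W : set T) :
  measurable_fun setT Z1 -> measurable_fun setT Z2 -> measurable W ->
  (forall C D, measurable C -> measurable D ->
     P (Z1 @^-1` C `&` Z2 @^-1` D `&` W) = P (Z1 @^-1` C `&` Z2 @^-1` D) * P W) ->
  forall B, measurable B ->
    P ((fun w => (Z1 w, Z2 w)) @^-1` B `&` W) = P ((fun w => (Z1 w, Z2 w)) @^-1` B) * P W.
Proof.
move=> mZ1 mZ2 mW H; set Z := fun w => (Z1 w, Z2 w).
have mZ : measurable_fun setT Z by exact: measurable_fun_pair.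
have W0 : (0 <= fine (P W))%R by rewrite fine_ge0.
pose m1' := [the {measure set (T1 * T2) -> \bar R} of
  pushforward [the {measure set T -> \bar R} of mrestr P mW] Z].
pose m1 : {measure set (T1 * T2) -> \bar R} := m1' mZ.
pose m2' := [the {measure set (T1 * T2) -> \bar R} of pushforward P Z].
pose m2 : {measure set (T1 * T2) -> \bar R} := [the {measure set (T1 * T2) -> \bar R} of
  mscale (NngNum W0) (m2' mZ)].
move=> B mB; suff : m1 B = m2 B.
  rewrite /m1 /m2 /= /pushforward /mrestr /mscale /= fineK ?fin_num_measure//.
  by rewrite [RHS]muleC.
apply: (@measure_unique _ _ _ [set A `*` D | A in measurable & D in measurable] (fun=> setT)).
- exact: measurable_prod_measurableType.
- move=> _ _ [A1 mA1 [D1 mD1 <-]] [A2 mA2 [D2 mD2 <-]].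
  exists (A1 `&` A2); first exact: measurableI.
  by exists (D1 `&` D2); [exact: measurableI|rewrite setXI].
- by move=> _; exists setT => //; exists setT => //; rewrite setXTT.
- by rewrite bigcup_const//; exists 0%N.
- move=> _ [C mC [D mD <-]]; rewrite /m1 /m2 /= /pushforward /mrestr /mscale /=.
  rewrite fineK ?fin_num_measure// [RHS]muleC; exact: H.
- move=> _; rewrite /m1 /= /pushforward /mrestr /= preimage_setT setTI.
  by rewrite -ge0_fin_numE// fin_num_measure.
- exact: mB.
Qed.

Variables (r : nat) (Y : {RV P >-> r.-tuple (3.-tuple R)}) (Th : 'I_r -> {RV P >-> R}).
Hypotheses (hTh : uniform_angles Th) (hind : independent_angles Y Th).
Local Notation angle := (measurableTypeR R).
Local Notation U := (uniform_prob (@two_pi_gt0 R)).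

Lemma prob_two_angles (i j : 'I_r) C A B : i != j -> measurable C -> measurable A ->
  measurable B ->
  P (Y @^-1` C `&` Th i @^-1` A `&` Th j @^-1` B)
    = P (Y @^-1` C) * P (Th i @^-1` A) * P (Th j @^-1` B).
Proof.
move=> ij mC mA mB; have ji : j != i by rewrite eq_sym.
pose V k := if k == i then A else if k == j then B else setT.
have := hind (U := V) mC; rewrite (bigD1 i)//= (bigD1 j)//= big1 ?mule1; last first.
  move=> k /andP[/negbTE ki /negbTE kj].
  by rewrite /V ki kj preimage_setT probability_setT.
have -> : V i = A by rewrite /V eqxx.
have -> : V j = B by rewrite /V eqxx (negbTE ji).
rewrite -muleA => <-; last first.
  by move=> k; rewrite /V; case: ifP => // _; case: ifP.
congr (P _); apply/seteqP; split=> w /=.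
  move=> [[Cw Aw] Bw]; split=> // k; rewrite /V.
  by case: eqP => [->//|_]; case: eqP => [->//|].
move=> [Cw h]; have := h i; have := h j; rewrite /V eqxx (negbTE ji) eqxx.
by move=> Bw Aw.
Qed.

(* Averaging the second angle alone is enough; the law of (Y, Th i) is not
   needed. *)
Lemma ge0_expectation_average (i j : 'I_r)
    (f : (r.-tuple (3.-tuple R) * angle) * angle -> \bar R) :
  i != j -> measurable_fun setT f -> (forall z, 0 <= f z) ->
  \int[P]_w f ((Y w, Th i w), Th j w) = \int[P]_w \int[U]_t f ((Y w, Th i w), t).
Proof.
move=> ij mf f0; pose Z w := (Y w, Th i w).
have mT k : measurable_fun setT (Th k : T -> angle) by exact: (measurable_funPT (Th k)).
have mZ : measurable_fun setT (Z : T -> (r.-tuple (3.-tuple R) * angle)%type).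
  exact: measurable_fun_pair (mT i).
pose Zf : {mfun T >-> (r.-tuple (3.-tuple R) * angle)%type} :=
  HB.pack Z (isMeasurableFun.Build _ _ _ _ _ mZ).
pose L := distribution P Zf.
have mZT : measurable_fun setT
    (fun w => (Z w, Th j w) : ((r.-tuple (3.-tuple R) * angle) * angle)%type).
  exact: measurable_fun_pair mZ (mT j).
pose ZT : {mfun T >-> ((r.-tuple (3.-tuple R) * angle) * angle)%type} :=
  HB.pack (fun w => (Z w, Th j w)) (isMeasurableFun.Build _ _ _ _ _ mZT).
have mpre (V : set angle) : measurable V -> measurable (Th j @^-1` V).
  by move=> mV; rewrite -[X in measurable X]setTI; exact: mT.
have lawE S : measurable S -> (L \x U) S = P ((fun w => (Z w, Th j w)) @^-1` S).
  move=> mS; apply: (product_measure_unique (m' := distribution P ZT)) => // B V mB mV.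
  transitivity (P (Z @^-1` B) * P (Th j @^-1` V)); last by congr (_ * _); exact: hTh.
  apply: indep_pair => //; first exact: mpre.
  move=> C A mC mA; rewrite prob_two_angles//; congr (_ * _).
  (* With the whole line for the angle j, this is the product rule for Y and Th i. *)
  have := prob_two_angles ij mC mA measurableT.
  by rewrite preimage_setT setIT probability_setT mule1.
rewrite -(ge0_integral_image mZT lawE mf f0) fubini_tonelli1//.
have LE A : measurable A -> L A = P (Z @^-1` A) by [].
rewrite (ge0_integral_image mZ LE)//.
- exact: measurable_fun_fubini_tonelli_F.
- by move=> z; apply: integral_ge0.
Qed.

End independence.

(** * Distances between points of Hopf fibres *)

Section hopf_geometry.
Context {R : realType}.
Local Notation mu := (@lebesgue_measure R).
Implicit Types (p q : 4.-tuple R) (t u : R).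

Lemma edist_sqr n (x y : n.-tuple R) :
  Defs.edist x y ^+ 2 = \sum_(i < n) (tnth x i - tnth y i) ^+ 2.
Proof. by rewrite sqr_sqrtr// sumr_ge0// => i _; exact: sqr_ge0. Qed.

Lemma edist_le2 n (x y : n.-tuple R) : usphere x -> usphere y -> Defs.edist x y <= 2.
Proof.
move=> hx hy; rewrite -(@ler_pXn2r _ 2) ?nnegrE ?sqrtr_ge0// edist_sqr.
apply: (@le_trans _ _ (\sum_(i < n) (2 * tnth x i ^+ 2 + 2 * tnth y i ^+ 2))).
  by apply: ler_sum => i _; have := sqr_ge0 (tnth x i + tnth y i); lra.
rewrite big_split /= -!mulr_sumr.
have -> : \sum_(i < n) tnth x i ^+ 2 = 1 := hx.
have -> : \sum_(i < n) tnth y i ^+ 2 = 1 := hy.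
lra.
Qed.

(* Shifting the potential by ln 2 makes it nonnegative, as Tonelli requires. *)
Lemma ln_edist_inv n (x y : n.-tuple R) : usphere x -> usphere y -> 0 < Defs.edist x y ->
  ln (Defs.edist x y)^-1 = `|ln (Defs.edist x y / 2)| - ln 2.
Proof.
move=> hx hy xy0; have le2 := edist_le2 hx hy.
rewrite ler0_norm; last by rewrite ln_le0// ler_pdivrMr// mul1r.
by rewrite ln_div ?posrE// lnV ?posrE//; ring.
Qed.

Lemma usphere4E p : usphere p ->
  p`_0 ^+ 2 = 1 - p`_1 ^+ 2 - p`_2 ^+ 2 - p`_3 ^+ 2.
Proof. by rewrite /usphere /= !big_ord_recl big_ord0 !(tnth_nth 0) /= => <-; ring. Qed.

Lemma hopf_rotD t u p : hopf_rot (t + u) p = hopf_rot t (hopf_rot u p).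
Proof. by apply/val_inj => /=; rewrite cosD sinD; congr [:: _; _; _; _]; ring. Qed.

Lemma usphere_hopf_rot t p : usphere p -> usphere (hopf_rot t p).
Proof.
move=> /usphere4E h; rewrite /usphere /= !big_ord_recl big_ord0 !(tnth_nth 0) /=.
have e : sin t ^+ 2 = 1 - cos t ^+ 2 by rewrite -(cos2Dsin2 t); ring.
ring: e h.
Qed.

Lemma edist_hopf_rot_same t u p : usphere p ->
  Defs.edist (hopf_rot t p) (hopf_rot u p) ^+ 2 = csq (cis t - cis u).
Proof.
move=> /usphere4E h; rewrite edist_sqr !big_ord_recl big_ord0 !(tnth_nth 0) /csq /=.
ring: h.
Qed.

(* The inner product of p with hopf_rot t q is
   fibre_cos p q * cos t + fibre_sin p q * sin t. *)
Definition fibre_cos p q := p`_0 * q`_0 + p`_1 * q`_1 + p`_2 * q`_2 + p`_3 * q`_3.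
Definition fibre_sin p q := p`_1 * q`_0 - p`_0 * q`_1 + p`_2 * q`_3 - p`_3 * q`_2.

Lemma edist_hopf_rot t p q : usphere p -> usphere q ->
  Defs.edist p (hopf_rot t q) ^+ 2
    = 2 - 2 * (fibre_cos p q * cos t + fibre_sin p q * sin t).
Proof.
move=> /usphere4E hp /usphere4E hq.
rewrite edist_sqr !big_ord_recl big_ord0 !(tnth_nth 0) /fibre_cos /fibre_sin /=.
have e : sin t ^+ 2 = 1 - cos t ^+ 2 by rewrite -(cos2Dsin2 t); ring.
ring: e hp hq.
Qed.

(** After conjugating the second complex coordinate, [hopf_rot] is multiplication by e^(it), and
    fibre_cos + i fibre_sin is the Hermitian product of p and q. Its modulus depends only on the two
    fibres. *)
Lemma fibre_sqr p q : usphere p -> usphere q ->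
  fibre_cos p q ^+ 2 + fibre_sin p q ^+ 2 = chordal_dot (hopf p) (hopf q).
Proof.
move=> /usphere4E hp /usphere4E hq; rewrite /chordal_dot edist_sqr.
rewrite !big_ord_recl big_ord0 !(tnth_nth 0) /fibre_cos /fibre_sin /=.
by field: hp hq.
Qed.

Section average.
Variables p q : 4.-tuple R.
Hypotheses (hp : usphere p) (hq : usphere q).
Hypothesis pq : chordal_dot (hopf p) (hopf q) < 1.

(** At distance 0 one would have X cos t + Y sin t = 1, hence X^2 + Y^2 >= 1 by Cauchy-Schwarz,
    against the hypothesis on the base points. *)
Lemma edist_hopf_rot_gt0 t : 0 < Defs.edist p (hopf_rot t q).
Proof.
rewrite lt0r sqrtr_ge0 andbT -sqrf_eq0 edist_hopf_rot//; apply: contraTneq pq.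
move: (fibre_sqr hp hq); set X := fibre_cos p q; set Y := fibre_sin p q => <- h.
rewrite -leNgt; have e := cos2Dsin2 t.
have : X * cos t + Y * sin t = 1 by lra.
have := sqr_ge0 (X * sin t - Y * cos t).
have : (X ^+ 2 + Y ^+ 2) * (cos t ^+ 2 + sin t ^+ 2) =
  (X * cos t + Y * sin t) ^+ 2 + (X * sin t - Y * cos t) ^+ 2 by ring.
by rewrite e mulr1 => -> ? ->; rewrite expr1n lerDl.
Qed.

Let lnE t : `|ln (Defs.edist p (hopf_rot t q) / 2)| = ln 2 - 1 / 2 *
  ln (2 - 2 * (fibre_cos p q * cos t + fibre_sin p q * sin t)).
Proof.
have D0 := edist_hopf_rot_gt0 t.
have := ln_edist_inv hp (usphere_hopf_rot t hq) D0.
rewrite lnV ?posrE// -edist_hopf_rot// lnXn// => h.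
have -> : `|ln (Defs.edist p (hopf_rot t q) / 2)| = ln 2 - ln (Defs.edist p (hopf_rot t q)).
  by rewrite h; ring.
by congr (_ - _); rewrite -mulr_natr; field.
Qed.

Lemma average_ln_edist :
  (\int[uniform_prob (@two_pi_gt0 R)]_t `|ln (Defs.edist p (hopf_rot t q) / 2)|%:E
    = (ln 2 - 1 / 2 * ln_onem_sqrt (chordal_dot (hopf p) (hopf q)))%:E)%E.
Proof.
pose X := fibre_cos p q; pose Y := fibre_sin p q.
pose f (t : R) := ln (2 - 2 * (X * cos t + Y * sin t)).
have f0 t : 0 < 2 - 2 * (X * cos t + Y * sin t).
  by rewrite -edist_hopf_rot// exprn_gt0// edist_hopf_rot_gt0.
have cf : continuous f.
  move=> t; apply: continuous_comp; last exact: continuous_ln.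
  apply: continuousB; first exact: cst_continuous.
  apply: continuous_fM; first exact: cst_continuous.
  apply: continuousD; apply: continuous_fM; try exact: cst_continuous.
    exact: continuous_cos.
  exact: continuous_sin.
pose g (t : R) := ln 2 * 1 - 1 / 2 * f t.
have cg : continuous g.
  by move=> t; apply: (@continuous_lin_comb _ (fun=> 1)); [exact: cst_continuous|exact: cf].
have gE t : `|ln (Defs.edist p (hopf_rot t q) / 2)| = g t by rewrite lnE /g mulr1.
under eq_integral do rewrite gE.
rewrite integral_uniform; last 2 first.
- by apply/measurable_EFinP; exact: continuous_measurable_fun.
- by move=> t; rewrite -gE lee_fin.
have ig : mu.-integrable `[0, 2 * pi] (EFin \o g).
  by apply: continuous_itv_integrable => t _; exact: cg.
rewrite -(fineK (integrable_fin_num _ ig))// -EFinM; congr (_%:E).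
rewrite -[fine _]/(\int[mu]_(t in `[0, 2 * pi]) g t) subr0.
rewrite (@Rintegral_lin_comb _ (fun=> 1) f); last 2 first.
- by move=> t _; exact: cst_continuous.
- by move=> t _; exact: cf.
rewrite Rintegral_itv_cst ?(ltW (@two_pi_gt0 R))// Rintegral_ln_cos_sin fibre_sqr//.
have : pi != 0 :> R by rewrite gt_eqF ?pi_gt0.
by rewrite /ln_onem_sqrt; move: pi => x x0; field.
Qed.

End average.

Lemma measurable_hopf_rot d (T : measurableType d) (f : T -> R) (g : T -> 4.-tuple R) :
  measurable_fun setT f -> measurable_fun setT g ->
  measurable_fun setT (fun w => hopf_rot (f w) (g w)).
Proof.
move=> mf mg.
have mg' i : measurable_fun setT (fun w => (g w)`_(i : 'I_4)).
  under eq_fun do rewrite -tnth_nth.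
  exact: (measurableT_comp (measurable_tnth i) mg).
have mc : measurable_fun setT (fun w => cos (f w)).
  by apply: measurableT_comp => //; apply: continuous_measurable_fun; exact: continuous_cos.
have ms : measurable_fun setT (fun w => sin (f w)).
  by apply: measurableT_comp => //; apply: continuous_measurable_fun; exact: continuous_sin.
have m0 := mg' (@Ordinal 4 0 isT); have m1 := mg' (@Ordinal 4 1 isT).
have m2 := mg' (@Ordinal 4 2 isT); have m3 := mg' (@Ordinal 4 3 isT).
apply/measurable_fun_tnthP => -[[|[|[|[|//]]]] i4].
- apply: (eq_measurable_fun (fun w => cos (f w) * (g w)`_0 - sin (f w) * (g w)`_1)) => //.
  by apply: measurable_funB; apply: measurable_funM.
- apply: (eq_measurable_fun (fun w => sin (f w) * (g w)`_0 + cos (f w) * (g w)`_1)) => //.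
  by apply: measurable_funD; apply: measurable_funM.
- apply: (eq_measurable_fun (fun w => cos (f w) * (g w)`_2 + sin (f w) * (g w)`_3)) => //.
  by apply: measurable_funD; apply: measurable_funM.
- apply: (eq_measurable_fun (fun w => cos (f w) * (g w)`_3 - sin (f w) * (g w)`_2)) => //.
  by apply: measurable_funB; apply: measurable_funM.
Qed.

End hopf_geometry.

Lemma sum_pair_neq (V : nmodType) (I J : finType) (t : I * J -> I * J -> V) :
  \sum_p \sum_(q | p != q) t p q =
    \sum_i \sum_a \sum_(b | a != b) t (i, a) (i, b)
    + \sum_p \sum_(q | p.1 != q.1) t p q.
Proof.
rewrite (pair_bigA _ (fun i a => \sum_(b | a != b) t (i, a) (i, b))) -big_split /=.
apply: eq_bigr => -[i a] _; rewrite (bigID (fun q => i == q.1)) /=; congr (_ + _).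
  pose f j b := if ((i, a) != (j, b)) && (i == j) then t (i, a) (j, b) else 0.
  transitivity (\sum_q f q.1 q.2); first by rewrite big_mkcond; apply: eq_bigr => -[].
  rewrite -(pair_bigA _ f) /f /=.
  rewrite (bigD1 i)//= [X in _ + X]big1 ?addr0; last first.
    by move=> j ji; apply: big1 => b _; rewrite (eq_sym i) (negbTE ji) andbF.
  rewrite [RHS]big_mkcond; apply: eq_bigr => b _.
  by rewrite eqxx andbT xpair_eqE eqxx.
apply: eq_bigl => -[j b] /=; rewrite xpair_eqE.
by case: (i == j); rewrite ?andbF ?andbT.
Qed.

Lemma sum_fst (S : pzSemiRingType) (I : finType) k (F : I -> S) :
  \sum_(p : I * 'I_k) F p.1 = k%:R * \sum_i F i.
Proof.
rewrite -(pair_bigA _ (fun i _ => F i)) mulr_sumr /=; apply: eq_bigr => i _.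
by rewrite sumr_const card_ord mulr_natl.
Qed.

(** * The exact expected energy *)

Section exact_energy.
Context {R : realType} {d : measure_display} {T : measurableType d}.
Context {P : probability T R} (n k : nat).
Local Notation r := n.+1.
Local Notation angle := (measurableTypeR R).
Variable s : 3.-tuple R -> 4.-tuple R.
Hypothesis hs : hopf_section s.
Variables (Y : {RV P >-> r.-tuple (3.-tuple R)}) (Th : 'I_r -> {RV P >-> R}).
Hypotheses (hY : spherical_ensemble Y) (hTh : uniform_angles Th).
Hypothesis hind : independent_angles Y Th.
Hypothesis k0 : (0 < k)%N.

(** A measurable function whose vanishing says that all base points lie on the sphere, where
    [hopf_section] constrains s. *)
Let off_sphere (y : r.-tuple (3.-tuple R)) : R :=
  \sum_(i < r) (\sum_(c < 3) tnth (tnth y i) c ^+ 2 - 1) ^+ 2.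

(* A nonzero weight means that the points are distinct. *)
Definition simple_configuration : set (r.-tuple (3.-tuple R)) :=
  [set y | spherical_weight y != 0 /\ off_sphere y = 0].
Local Notation G := simple_configuration.

Lemma measurable_simple_configuration : measurable G.
Proof.
have moff : measurable_fun setT off_sphere.
  apply: measurable_sum => i; apply: measurable_funX; apply: measurable_funB => //.
  apply: measurable_sum => c; apply: measurable_funX.
  exact: (measurableT_comp (measurable_tnth c) (measurable_tnth i)).
have -> : G = (spherical_weight @^-1` ~` [set 0]) `&` (off_sphere @^-1` [set 0]).
  by apply/seteqP; split=> y /= [h1 h2]; split=> //; exact/eqP.
apply: measurableI; rewrite -[X in measurable X]setTI.
  by apply: measurable_spherical_weight => //; exact: measurableC.
exact: moff.
Qed.

Lemma simple_configuration_usphere y i : G y -> usphere (tnth y i).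
Proof.
move=> [_ /eqP]; rewrite psumr_eq0; last by move=> c _; exact: sqr_ge0.
by move=> /allP/(_ i); rewrite mem_index_enum sqrf_eq0 subr_eq0 => /(_ isT)/eqP.
Qed.

Lemma simple_configuration_chordal y i j : G y -> i != j ->
  chordal_dot (tnth y i) (tnth y j) < 1.
Proof.
move=> [w0 _] ij; rewrite /chordal_dot ltrBlDr ltrDl divr_gt0// lt0r sqr_ge0 andbT.
apply: contraNneq w0 => e0; rewrite /spherical_weight.
have sym : Defs.edist (tnth y j) (tnth y i) ^+ 2 == 0.
  rewrite -e0 !edist_sqr; apply/eqP/eq_bigr => c _.
  by rewrite -sqrrN opprB.
have zero (a b : 'I_r) : (a < b)%N -> Defs.edist (tnth y a) (tnth y b) ^+ 2 == 0 ->
    \prod_(i < r) \prod_(j < r | (i < j)%N)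
      Defs.edist (tnth y i) (tnth y j) ^+ 2 == 0.
  by move=> ab /eqP e; rewrite (bigD1 a)//= (bigD1 b)//= e !mul0r.
have [lt|lt|/val_inj eij] := ltngtP i j; [by apply: (zero i j) => //; exact/eqP|exact: (zero j i)|].
by rewrite eij eqxx in ij.
Qed.

Lemma simple_configuration_null : P (Y @^-1` ~` G) = 0%E.
Proof.
apply: (spherical_ensemble_null hY).
  by apply: measurableC; exact: measurable_simple_configuration.
move=> x xG; apply/eqP; rewrite -csq_eq0; apply: contrapT => det0; apply: xG; split.
  rewrite spherical_weightE mulf_neq0//; last exact/negP.
  by apply/prodf_neq0 => i _; apply/prodf_neq0.
apply: big1 => i _; rewrite tnth_map.
have := usphere_sph_coord (tnth x i); rewrite /usphere /= => ->.
by rewrite subrr expr0n.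
Qed.

Lemma ae_eq_simple U (f g : T -> U) : (forall w, G (Y w) -> f w = g w) ->
  ae_eq P setT f g.
Proof.
move=> fg; exists (Y @^-1` ~` G); split.
- rewrite -[X in measurable X]setTI; apply: (measurable_funPT Y) => //.
  by apply: measurableC; exact: measurable_simple_configuration.
- exact: simple_configuration_null.
- by move=> w /= h Gw; apply: h => _; exact: fg.
Qed.

Let shift (a : 'I_k) : R := 2 * pi * a%:R / k%:R.
Let lift w := hopf_lift s (k := k) (Y w) (fun i => Th i w).

(** The absolute value makes it nonnegative on all of T. On simple configurations, for i != j, it is
    the potential plus ln 2. *)
Let pot i a j b w : R := `|ln (Defs.edist (lift w (i, a)) (lift w (j, b)) / 2)|.

Let mY i : measurable_fun setT (fun w => tnth (Y w) i).
Proof. exact: (measurableT_comp (measurable_tnth i) (measurable_funPT Y)). Qed.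

Let mlift ia : measurable_fun setT (fun w => lift w ia).
Proof.
apply: measurable_hopf_rot.
  by apply: measurable_funD => //; exact: (measurable_funPT (Th ia.1)).
by have [ms _] := hs; exact: (measurableT_comp ms (mY ia.1)).
Qed.

Let mpot i a j b : measurable_fun setT (pot i a j b).
Proof.
apply: measurableT_comp => //; apply: (measurableT_comp (@measurable_ln R)).
by apply: measurable_funM => //; exact: measurable_edist.
Qed.

Let energy i j w := ln_onem_sqrt (chordal_dot (tnth (Y w) i) (tnth (Y w) j)).

(** The angle of j is averaged first. The angle of i and both root-of-unity shifts are absorbed into
    points p and q of the two fibres, and the average only depends on the fibres. Being an identity
    of extended reals, this also proves integrability. *)
Let pot_integral i a j b : i != j ->
  (\int[P]_w (pot i a j b w)%:E = (ln 2 - 1 / 2 * \int[P]_w energy i j w)%:E)%E.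
Proof.
move=> ij.
pose f (z : (r.-tuple (3.-tuple R) * angle) * angle) : \bar R :=
  (`|ln (Defs.edist (hopf_rot (z.1.2 + shift a) (s (tnth z.1.1 i)))
     (hopf_rot (z.2 + shift b) (s (tnth z.1.1 j))) / 2)|)%:E.
have mf : measurable_fun setT f.
  have m11 c : measurable_fun setT
      (fun z : (r.-tuple (3.-tuple R) * angle) * angle => s (tnth z.1.1 c)).
    have [ms _] := hs; apply: (measurableT_comp ms).
    exact: (measurableT_comp (measurable_tnth c) (measurableT_comp measurable_fst measurable_fst)).
  apply/measurable_EFinP; apply: measurableT_comp => //.
  apply: (measurableT_comp (@measurable_ln R)); apply: measurable_funM => //.
  apply: measurable_edist; apply: measurable_hopf_rot => //; apply: measurable_funD => //.
  exact: (measurableT_comp measurable_snd measurable_fst).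
have f0 z : (0 <= f z)%E by rewrite lee_fin.
have ie := pair_expectation_integrable hY i j.
have Zl : P.-integrable setT (EFin \o (fun w => 1 / 2 * energy i j w)).
  by have := integrableZl measurableT (1 / 2) ie; apply.
have c2 : P.-integrable setT (EFin \o (fun=> ln 2)).
  by apply: finite_measure_integrable_cst.
rewrite -RintegralZl// (_ : ln 2 = \int[P]_w ln 2); last first.
  by rewrite Rintegral_cst// (congr1 fine (probability_setT P)) mulr1.
rewrite -RintegralB//.
rewrite /Rintegral fineK; last first.
  by apply: integrable_fin_num => //; have := integrableB measurableT c2 Zl; apply: eq_integrable.
rewrite -[LHS]/(\int[P]_w f ((Y w, Th i w), Th j w))%E.
rewrite (ge0_expectation_average hTh hind ij mf f0).
apply: ae_eq_integral => //.
- apply: (measurableT_comp (measurable_fun_fubini_tonelli_F f mf f0)).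
  exact: measurable_fun_pair (measurable_funPT Y) (measurable_funPT (Th i)).
- have := integrableB measurableT c2 Zl => /measurable_int; exact.
apply: ae_eq_simple => w Gw.
have [_ hsec] := hs.
have ui := simple_configuration_usphere i Gw; have uj := simple_configuration_usphere j Gw.
have [si ei] := hsec _ ui; have [sj ej] := hsec _ uj.
pose p := hopf_rot (Th i w + shift a) (s (tnth (Y w) i)).
pose q := hopf_rot (shift b) (s (tnth (Y w) j)).
have hp : hopf p = tnth (Y w) i by rewrite /p hopf_hopf_rot.
have hq : hopf q = tnth (Y w) j by rewrite /q hopf_hopf_rot.
transitivity (\int[uniform_prob (@two_pi_gt0 R)]_t `|ln (Defs.edist p (hopf_rot t q) / 2)|%:E)%E.
  by apply: eq_integral => t _; rewrite /f /= (hopf_rotD t).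
rewrite average_ln_edist ?hp ?hq//; try exact: usphere_hopf_rot.
exact: simple_configuration_chordal.
Qed.

Let pot_integrable i a j b : i != j -> P.-integrable setT (EFin \o pot i a j b).
Proof.
move=> ij; apply/integrableP; split; first exact/measurable_EFinP.
have -> : (\int[P]_w `|(EFin \o pot i a j b) w|)%E = (\int[P]_w (pot i a j b w)%:E)%E.
  by apply: eq_integral => w _; rewrite /= /pot normr_id.
by rewrite [ltLHS](pot_integral a b ij) ltry.
Qed.

Let same_fibre w i (a : 'I_k) : G (Y w) ->
  \sum_(b < k | a != b) ln (Defs.edist (lift w (i, a)) (lift w (i, b)))^-1 = - ln k%:R.
Proof.
move=> Gw; have [_ hsec] := hs.
have [si _] := hsec _ (simple_configuration_usphere i Gw).
have k2 : (k%:R : R) != 0 by rewrite pnatr_eq0 -lt0n.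
pose z b := csq (cis (shift a) - cis (shift b)) : R.
have zE b : Defs.edist (lift w (i, a)) (lift w (i, b)) ^+ 2 = z b.
  rewrite edist_hopf_rot_same// !cisD -mulrBr csqM csq_cis mul1r.
  by [].
have zprod : \prod_(b < k | a != b) z b = k%:R ^+ 2 := prod_csq_roots a.
have z0 b : a != b -> 0 < z b.
  move=> ab; rewrite lt0r csq_ge0 andbT.
  have : \prod_(b < k | a != b) z b != 0 by rewrite zprod expf_neq0.
  by move/prodf_neq0; apply.
transitivity (- (1 / 2 * \sum_(b < k | a != b) ln (z b))).
  rewrite mulr_sumr -sumrN; apply: eq_bigr => b ab.
  have D0 : 0 < Defs.edist (lift w (i, a)) (lift w (i, b)).
    rewrite lt0r sqrtr_ge0 andbT -sqrf_eq0 zE; exact: lt0r_neq0 (z0 _ ab).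
  by rewrite -zE lnXn// lnV ?posrE// -mulr_natr; congr (- _); field.
rewrite -ln_prod// zprod lnXn ?ltr0n// -mulr_natr; congr (- _); by field.
Qed.

Let cross p q w : R := if p.1 != q.1 then pot p.1 p.2 q.1 q.2 w - ln 2 else 0.

Let log_energyE w : G (Y w) -> log_energy (lift w) =
  - (r%:R * k%:R * ln k%:R) + \sum_p \sum_q cross p q w.
Proof.
move=> Gw; have [_ hsec] := hs.
rewrite /log_energy sum_pair_neq; congr (_ + _).
  under eq_bigr => i _ do under eq_bigr => a _ do rewrite same_fibre//.
  under eq_bigr => i _ do rewrite sumr_const card_ord.
  by rewrite sumr_const card_ord -[LHS]mulr_natl -[_ *+ k]mulr_natl; ring.
apply: eq_bigr => p _; rewrite big_mkcond; apply: eq_bigr => q _.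
rewrite /cross; case: ifP => // pq.
have [s1 e1] := hsec _ (simple_configuration_usphere p.1 Gw).
have [s2 e2] := hsec _ (simple_configuration_usphere q.1 Gw).
case: p q pq s1 e1 s2 e2 => i a [j b] /= ij s1 e1 s2 e2.
rewrite ln_edist_inv//; try exact: usphere_hopf_rot.
apply: edist_hopf_rot_gt0 => //; first exact: usphere_hopf_rot.
by rewrite hopf_hopf_rot e1 e2; exact: simple_configuration_chordal.
Qed.

(** The energy is replaced by E1, where the pairs within a fibre contribute their exact value and
    the others the integrable [pot] minus ln 2. The two agree on simple configurations, hence almost
    surely. *)
Lemma expected_log_energy (E0 := fun w => log_energy (lift w)) :
  P.-integrable setT (EFin \o E0) /\
  \int[P]_w E0 w = - (r%:R * k%:R * ln k%:R)
    - k%:R ^+ 2 / 2 * (r%:R ^+ 2 / 2 - r%:R * onem_sqr_int n + 1 / 2).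
Proof.
pose E1 w := - (r%:R * k%:R * ln k%:R) + \sum_p \sum_q cross p q w.
have icross p q : P.-integrable setT (EFin \o cross p q).
  rewrite /cross; case pq: (p.1 != q.1); last exact: finite_measure_integrable_cst.
  have c2 : P.-integrable setT (EFin \o (fun=> ln 2 : R)).
    exact: finite_measure_integrable_cst.
  by have := integrableB measurableT (pot_integrable p.2 q.2 pq) c2; apply: eq_integrable.
have isum p : P.-integrable setT (EFin \o (fun w => \sum_q cross p q w)).
  rewrite (_ : EFin \o _ = fun w => \sum_q (cross p q w)%:E)%E; last first.
    by apply/funext => w; rewrite sumEFin.
  by apply: integrable_sum => // q _; exact: icross.
have isum2 : P.-integrable setT (EFin \o (fun w => \sum_p \sum_q cross p q w)).
  rewrite (_ : EFin \o _ = fun w => \sum_p (\sum_q cross p q w)%:E)%E; last first.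
    by apply/funext => w; rewrite sumEFin.
  by apply: integrable_sum => // q _; exact: isum.
have icst : P.-integrable setT (EFin \o (fun=> - (r%:R * k%:R * ln k%:R) : R)).
  exact: finite_measure_integrable_cst.
have iE1 : P.-integrable setT (EFin \o E1).
  by have := integrableD measurableT icst isum2; apply: eq_integrable.
have E1E : \int[P]_w E1 w = - (r%:R * k%:R * ln k%:R)
    - k%:R ^+ 2 / 2 * (r%:R ^+ 2 / 2 - r%:R * onem_sqr_int n + 1 / 2).
  rewrite RintegralD// Rintegral_cst// (congr1 fine (probability_setT P)) mulr1.
  congr (_ + _); rewrite Rintegral_sum//.
  under eq_bigr => p _ do rewrite Rintegral_sum//.
  pose e i j := \int[P]_w energy i j w.
  have ce p q : \int[P]_w cross p q w = if p.1 != q.1 then - (1 / 2) * e p.1 q.1 else 0.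
    rewrite /cross; case pq: (p.1 != q.1); last by rewrite Rintegral_cst// mul0r.
    have c2 : P.-integrable setT (EFin \o (fun=> ln 2 : R)).
      exact: finite_measure_integrable_cst.
    rewrite RintegralB//; last exact: pot_integrable.
    rewrite Rintegral_cst// (congr1 fine (probability_setT P)) mulr1.
    have -> : \int[P]_w pot p.1 p.2 q.1 q.2 w = ln 2 - 1 / 2 * e p.1 q.1.
      exact: (congr1 fine (pot_integral p.2 q.2 pq)).
    ring.
  under eq_bigr => p _ do under eq_bigr => q _ do rewrite ce.
  under eq_bigr => p _.
    rewrite (sum_fst k (fun j => if p.1 != j then - (1 / 2) * e p.1 j else 0)).
    rewrite -big_mkcond -mulr_sumr.
    over.
  rewrite (sum_fst k (fun i => k%:R * (- (1 / 2) * \sum_(j | i != j) e i j))).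
  rewrite -!mulr_sumr (sum_pair_expectation hY).
  by field.
have mE0 : measurable_fun setT E0.
  apply: measurable_sum => p.
  (* The rewriting also holds at distance 0, where the conventions 0^-1 = 0 and ln 0 = 0 make both
     sides 0. *)
  rewrite (_ : (fun w => _) = fun w => \sum_q
    if p != q then - ln (Defs.edist (lift w p) (lift w q)) else 0); last first.
    apply/funext => w; rewrite big_mkcond; apply: eq_bigr => q _; case: ifP => // _.
    have [e0|e0] := ltP 0 (Defs.edist (lift w p) (lift w q)); first by rewrite lnV.
    have -> : Defs.edist (lift w p) (lift w q) = 0 by apply/eqP; rewrite eq_le e0 sqrtr_ge0.
    by rewrite invr0 ln0// oppr0.
  apply: measurable_sum => q; case: (p != q); last exact: measurable_cst.
  apply: measurable_funN; apply: (measurableT_comp (@measurable_ln R)).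
  exact: measurable_edist.
have ae : ae_eq P setT (EFin \o E0) (EFin \o E1).
  by apply: ae_eq_simple => w Gw; congr (_%:E); exact: log_energyE.
split.
  apply/integrableP; split; first exact/measurable_EFinP.
  have /integrableP[mE1 fE1] := iE1; apply: le_lt_trans fE1.
  rewrite le_eqVlt; apply/orP; left; apply/eqP; apply: ae_eq_integral => //.
  - by apply: measurableT_comp => //; exact/measurable_EFinP.
  - exact: measurableT_comp.
  - exact: ae_eq_abse.
rewrite -E1E /Rintegral; congr fine.
by apply: ae_eq_integral => //; [exact/measurable_EFinP|exact: measurable_int iE1].
Qed.

End exact_energy.

(** * Asymptotics *)

(** A form for any positive r, since [base_number] is not syntactically a successor. *)
Lemma expected_log_energy_gt0 (R : realType) (d : measure_display) (T : measurableType d)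
    (P : probability T R) (r k : nat) (s : 3.-tuple R -> 4.-tuple R)
    (Y : {RV P >-> r.-tuple (3.-tuple R)}) (Th : 'I_r -> {RV P >-> R}) :
  hopf_section s -> spherical_ensemble Y -> uniform_angles Th ->
  independent_angles Y Th -> (0 < k)%N -> (0 < r)%N ->
  let E0 w := log_energy (hopf_lift s (k := k) (Y w) (fun i => Th i w)) in
  P.-integrable setT (EFin \o E0) /\
  \int[P]_w E0 w = - (r%:R * k%:R * ln k%:R)
    - k%:R ^+ 2 / 2 * (r%:R ^+ 2 / 2 - r%:R * onem_sqr_int r.-1 + 1 / 2).
Proof.
move=> hs; case: r Y Th => // n Y Th hY hTh hind k0 _.
exact: expected_log_energy.
Qed.

Section asymptotics.
Context {R : realType}.
Implicit Types (A B k : nat).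

Lemma admissible_base A B k : (0 < A)%N -> (0 < B)%N -> admissible A B k ->
  [/\ (0 < k)%N, (0 < base_number A B k)%N &
    k%:R ^+ 2 = B%:R / A%:R * (base_number A B k)%:R :> R].
Proof.
move=> A0 B0 /andP[k0 dv]; have e := divnK dv.
have r0 : (0 < base_number A B k)%N.
  rewrite /base_number divn_gt0// dvdn_leq// muln_gt0 A0 expn_gt0.
  by rewrite k0.
split=> //; have h : (base_number A B k)%:R * B%:R = A%:R * k%:R ^+ 2 :> R.
  by rewrite -natrX -!natrM -e.
have A1 : A%:R != 0 :> R by rewrite pnatr_eq0 -lt0n.
by rewrite mulrAC (mulrC B%:R) h mulrAC divff// mul1r.
Qed.

Lemma ln_powR_third (b : R) : 0 < b -> ln (b `^ (1 / 3)) = 1 / 3 * ln b.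
Proof. by move=> b0; rewrite ln_powR. Qed.

(** From N = k^3 / b one gets ln k = (ln N + ln b) / 3, the source of both logarithmic terms. The
    Wallis term k^2 r W / 2 is N x / 2 with x = k W, and x is close to y = sqrt (b pi) / 2 because
    k^2 = b r and r W^2 is close to pi / 4. *)
Lemma energy_remainder (b N : R) (r k : nat) : 0 < b -> (0 < r)%N -> (0 < k)%N ->
  k%:R ^+ 2 = b * r%:R ->
  N = (k * r)%:R ->
  `|- (r%:R * k%:R * ln k%:R)
      - k%:R ^+ 2 / 2 * (r%:R ^+ 2 / 2 - r%:R * onem_sqr_int r.-1 + 1 / 2)
    - (- (N ^+ 2 / 4) - 1 / 3 * N * ln N
         + N * (Num.sqrt pi / 4 * b `^ (1 / 2) - ln (b `^ (1 / 3))))|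
  <= (b `^ (1 / 2) * Num.sqrt pi / 8 + 1 / 4) * k%:R ^+ 2.
Proof.
move=> b0 r0 k0 kb NE; have kR : 0 < k%:R :> R by rewrite ltr0n.
have rR : 0 < r%:R :> R by rewrite ltr0n.
have k1 : 1 <= k%:R :> R by rewrite ler1n.
have lnN : ln N = 3 * ln k%:R - ln b.
  have -> : N = k%:R ^+ 3 / b by rewrite exprSr kb NE natrM; field; rewrite gt_eqF.
  by rewrite ln_div ?posrE ?exprn_gt0// lnXn// mulr_natl.
set c := b `^ (1 / 2); have c0 : 0 < c by exact: powR_gt0.
have c2 : c ^+ 2 = b.
  by rewrite /c div1r -powR_mulrn ?powR_ge0// -powRrM mulVf ?powRr1// ltW.
set p := Num.sqrt pi; have p0 : 0 < p by rewrite sqrtr_gt0 pi_gt0.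
have p2 : p ^+ 2 = pi by rewrite sqr_sqrtr// pi_ge0.
set W := onem_sqr_int r.-1; have W0 : 0 <= W := onem_sqr_int_ge0 _.
have := @onem_sqr_int_bounds R r.-1; rewrite prednK// -/W -p2 => /andP[lo hi].
pose x := k%:R * W; pose y := c * p / 2.
have x0 : 0 <= x by rewrite mulr_ge0// ltW.
have y0 : 0 < y by rewrite !mulr_gt0.
have x2 : x ^+ 2 = c ^+ 2 * (r%:R * W ^+ 2) by rewrite exprMn kb -c2; ring.
have yx : y <= x.
  rewrite -(@ler_pXn2r _ 2) ?nnegrE// ?(ltW y0)// x2.
  have -> : y ^+ 2 = c ^+ 2 * (p ^+ 2 / 4) by rewrite /y; field.
  by rewrite ler_pM2l// exprn_gt0.
have xy : x - y <= c * p / (4 * r%:R).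
  have : x ^+ 2 - y ^+ 2 <= c ^+ 2 * (p ^+ 2 / (4 * r%:R)).
    have -> : y ^+ 2 = c ^+ 2 * (p ^+ 2 / 4) by rewrite /y; field.
    by rewrite x2 -mulrBr ler_pM2l ?exprn_gt0//; lra.
  (* As c p = 2 y <= x + y, the bound on x^2 - y^2 becomes a bound on x - y. *)
  move=> h; have : (x - y) * (c * p) <= c * p / (4 * r%:R) * (c * p).
    apply: le_trans (_ : x ^+ 2 - y ^+ 2 <= _).
      have -> : c * p = 2 * y by rewrite /y; field.
      by nra.
    by apply: le_trans h _; rewrite le_eqVlt; apply/orP; left; apply/eqP; field; rewrite gt_eqF.
  by rewrite ler_pM2r// mulr_gt0.
have -> : - (r%:R * k%:R * ln k%:R)
      - k%:R ^+ 2 / 2 * (r%:R ^+ 2 / 2 - r%:R * W + 1 / 2)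
    - (- (N ^+ 2 / 4) - 1 / 3 * N * ln N + N * (p / 4 * c - ln (b `^ (1 / 3))))
    = N * (x - y) / 2 - k%:R ^+ 2 / 4.
  by rewrite lnN ln_powR_third// NE natrM /x /y; field.
have Nle : N * (x - y) / 2 <= c * p / 8 * k%:R ^+ 2.
  have : N * (x - y) <= N * (c * p / (4 * r%:R)) by rewrite ler_wpM2l// NE.
  have -> : N * (c * p / (4 * r%:R)) = c * p / 4 * k%:R.
    by rewrite NE natrM; field; rewrite gt_eqF.
  have cp : 0 < c * p by rewrite mulr_gt0.
  have : k%:R <= k%:R ^+ 2 :> R by rewrite expr2 ler_peMr// ltW.
  nra.
have N0 : 0 <= N * (x - y) / 2 by rewrite divr_ge0// mulr_ge0 ?subr_ge0// NE.
have cp : 0 <= c * p / 8 * k%:R ^+ 2 by rewrite mulr_ge0 ?sqr_ge0// divr_ge0// mulr_ge0 ?ltW.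
rewrite mulrDl ler_norml; move: (sqr_ge0 (k%:R : R)) => kk.
by apply/andP; split; lra.
Qed.

Lemma linear_coefE A B : (0 < A)%N -> (0 < B)%N -> let x := A%:R / B%:R : R in
  linear_coef R A B = Num.sqrt pi / 4 * Num.sqrt x^-1 + 1 / 3 * ln x.
Proof.
move=> A0 B0 x; have A1 : 0 < A%:R :> R by rewrite ltr0n.
have B1 : 0 < B%:R :> R by rewrite ltr0n.
have xV : B%:R / A%:R = x^-1 by rewrite invf_div.
have x0 : 0 < x by rewrite divr_gt0.
rewrite /linear_coef xV ln_powR_third ?invr_gt0// lnV ?posrE// div1r powR12_sqrt ?invr_ge0 ?ltW//.
by rewrite mulrN opprK.
Qed.

Lemma linear_coef_limit (e : R) : 0 < e -> exists2 delta : R, 0 < delta &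
  forall A B, (0 < A)%N -> (0 < B)%N ->
    `|A%:R / B%:R - 3 ^+ 2 * pi / 4 ^+ 3| < delta ->
    `|linear_coef R A B - 1 / 3 * (2 + ln (9 * pi / 64))| < e.
Proof.
move=> e0; pose x0 : R := 3 ^+ 2 * pi / 4 ^+ 3.
have p0 : 0 < pi :> R by exact: pi_gt0.
have x0_gt0 : 0 < x0 by rewrite divr_gt0 ?exprn_gt0 ?mulr_gt0 ?exprn_gt0.
pose g (x : R) := Num.sqrt pi / 4 * Num.sqrt x^-1 + 1 / 3 * ln x.
have gx0 : g x0 = 1 / 3 * (2 + ln (9 * pi / 64)).
  have -> : 9 * pi / 64 = x0 by rewrite /x0; field.
  have s0 : 0 < Num.sqrt pi :> R by rewrite sqrtr_gt0.
  have -> : g x0 = Num.sqrt pi / 4 * Num.sqrt x0^-1 + 1 / 3 * ln x0 by [].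
  (* x0^-1 = 64 / (9 pi) is a square over pi, so the first term of g x0 is 2 / 3. *)
  have -> : x0^-1 = (8 / (3 * Num.sqrt pi)) ^+ 2.
    have := sqr_sqrtr (ltW p0); rewrite /x0; move: (Num.sqrt pi) s0 => q q0 <-.
    by field; rewrite gt_eqF.
  rewrite sqrtr_sqr ger0_norm ?divr_ge0 ?mulr_ge0 ?(ltW s0)//.
  by field; rewrite gt_eqF.
have cg : {for x0, continuous g}.
  apply: continuousD.
    apply: continuous_fM; first exact: cst_continuous.
    apply: continuous_comp; last exact: sqrt_continuous.
    by apply: continuousV; [rewrite gt_eqF|exact: cvg_id].
  by apply: continuous_fM; [exact: cst_continuous|exact: continuous_ln].
move/cvgrPdist_lt : cg => /(_ _ e0) /nbhs_ballP[delta /= d0 hd].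
exists delta => // A B A0 B0 h; rewrite linear_coefE// -gx0 distrC.
by apply: hd; rewrite /ball /= distrC.
Qed.

End asymptotics.

Theorem theorem1p2 (R : realType) :
  (forall (A B : nat) (hA : (0 < A)%N) (hB : (0 < B)%N)
     (s : 3.-tuple R -> 4.-tuple R) (hs : hopf_section s)
     (d : nat -> measure_display) (T : forall k, measurableType (d k))
     (P : forall k, probability (T k) R)
     (Y : forall k, {RV (P k) >-> (base_number A B k).-tuple (3.-tuple R)})
     (Th : forall k, 'I_(base_number A B k) -> {RV (P k) >-> R})
     (hY : forall k, admissible A B k -> spherical_ensemble (Y k))
     (hTh : forall k, admissible A B k -> uniform_angles (Th k))
     (hind : forall k, admissible A B k -> independent_angles (Y k) (Th k)),
   let E0 k (x : T k) : R :=
     log_energy (hopf_lift s (k:=k) (Y k x) (fun i => Th k i x)) in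
   let N k : R := (point_number A B k)%:R in
   (forall k, admissible A B k -> (P k).-integrable setT (EFin \o E0 k)) /\
   (fun k => fine 'E_(P k)[E0 k]) =
     (fun k => - (N k ^+ 2 / 4) - 1 / 3 * N k * ln (N k)
               + N k * linear_coef R A B)
     +o_ (within (admissible A B) \oo) N) /\
  (forall e : R, 0 < e -> exists2 delta : R, 0 < delta &
     forall A B : nat, (0 < A)%N -> (0 < B)%N ->
       `|A%:R / B%:R - 3 ^+ 2 * pi / 4 ^+ 3| < delta ->
       `|linear_coef R A B - 1 / 3 * (2 + ln (9 * pi / 64))| < e).
Proof.
split; last exact: linear_coef_limit.
move=> A B hA hB s hs d T P Y Th hY hTh hind E0 N.
have exact_k k : admissible A B k -> (P k).-integrable setT (EFin \o E0 k) /\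
    \int[P k]_w E0 k w = - ((base_number A B k)%:R * k%:R * ln k%:R)
    - k%:R ^+ 2 / 2 * ((base_number A B k)%:R ^+ 2 / 2
       - (base_number A B k)%:R * onem_sqr_int (base_number A B k).-1 + 1 / 2).
  move=> ak; have [k0 r0 _] := admissible_base (R := R) hA hB ak.
  exact: (expected_log_energy_gt0 hs (hY k ak) (hTh k ak) (hind k ak) k0 r0).
split; first by move=> k /exact_k[].
pose b : R := B%:R / A%:R.
have b0 : 0 < b by rewrite divr_gt0 ?ltr0n.
pose C : R := b `^ (1 / 2) * Num.sqrt pi / 8 + 1 / 4.
have C0 : 0 < C by rewrite ltr_wpDl// divr_ge0// mulr_ge0 ?powR_ge0 ?sqrtr_ge0.
apply/eqaddoP => e e0; rewrite near_withinE; near=> k => ak.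
have [k0 r0 kb] := admissible_base (R := R) hA hB ak; have [_ EE] := exact_k _ ak.
have Ek : fine 'E_(P k)[E0 k] = \int[P k]_w E0 k w by rewrite unlock.
suff : `|fine 'E_(P k)[E0 k] - (- (N k ^+ 2 / 4) - 1 / 3 * N k * ln (N k)
     + N k * linear_coef R A B)| <= e * `|N k| by [].
rewrite Ek EE; apply: le_trans (energy_remainder b0 r0 k0 kb _) _; first by [].
have kR : 0 < k%:R :> R by rewrite ltr0n.
have Nk : N k = k%:R ^+ 2 * (k%:R / b).
  by rewrite (kb : _ = b * _) /N /point_number natrM; field; rewrite gt_eqF.
rewrite ger0_norm; last by rewrite /N.
(* With N = k^3 / b, the bound C k^2 <= e N amounts to C b / e <= k. *)
rewrite Nk [leLHS]mulrC [leRHS]mulrCA ler_pM2l ?exprn_gt0// mulrA ler_pdivlMr//.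
rewrite [leRHS]mulrC -ler_pdivrMr//.
by near: k; exact: nbhs_infty_ger.
Unshelve. all: by end_near.
Qed.
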